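(* Assume that $\Phi$ is a stationary point process on $\mathbf{R}^N$ having all finite moments. Then for any $0\le r\le s<\infty$ there exists a constant $\hat\beta_q^{r,s}$ such that $$\frac{\mathbb{E}[\beta_q^{r,s}(\mathbb{K}(\Phi_{\Lambda_L}))]}{L^N}\to\hat\beta_q^{r,s}\quad\text{as }L\to\infty .$$ In addition, if $\Phi$ is ergodic, then $$\frac{\beta_q^{r,s}(\mathbb{K}(\Phi_{\Lambda_L}))}{L^N}\to\hat\beta_q^{r,s}\quad\text{almost surely as }L\to\infty .$$
   Context: Fix integers $N\ge 1$, $q\ge 0$ and a field $\mathbf{F}$; all homology is simplicial homology with coefficients in $\mathbf{F}$. The function $\kappa$. Let $\mathscr{F}(\mathbf{R}^N)$ be the set of all nonempty finite subsets of $\mathbf{R}^N$. A function $f$ on $\mathscr{F}(\mathbf{R}^N)$ is measurable if for each $k\ge1$ the permutation-invariant function $(x_1,\dots,x_k)\mapsto f(\{x_1,\dots,x_k\})$ on $(\mathbf{R}^N)^k$ is measurable. Fix a measurable function $\kappa:\mathscr{F}(\mathbf{R}^N)\to[0,\infty]$ such that: (K1) $0\le\kappa(\sigma)\le\kappa(\tau)$ if $\sigma\subset\tau$; (K2) $\kappa(\sigma+x)=\kappa(\sigma)$ for all $x\in\mathbf{R}^N$; (K3) there is an increasing function $\rho:[0,\infty]\to[0,\infty]$ with $\rho(t)<\infty$ for $t<\infty$ such that $\|x-y\|\le\rho(\kappa(\{x,y\}))$ for all $x,y$ (Euclidean norm); normalized by $\kappa(\{x\})=0$. The filtration. For a finite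 set $\Xi\subset\mathbf{R}^N$ and $t\ge 0$, let $K(\Xi,t)$ be the simplicial complex of all nonempty $\sigma\subset\Xi$ with $\kappa(\sigma)\le t$, and $\mathbb{K}(\Xi)=\{K(\Xi,t)\}_{t\ge0}$. Persistent Betti numbers. For a filtration $\mathbb{K}=\{K_t\}_{t\ge0}$ and $r\le s$, $$\beta_q^{r,s}(\mathbb{K})=\operatorname{rank}\frac{Z_q(K_r)}{Z_q(K_r)\cap B_q(K_s)},$$ where $Z_q$ and $B_q$ are the spaces of $q$-cycles and $q$-boundaries; equivalently it is the rank of the map $H_q(K_r)\to H_q(K_s)$ induced by inclusion. Point processes. A point process $\Phi$ on $\mathbf{R}^N$ is a random integer-valued Radon measure; it is always assumed simple, i.e. almost surely $\Phi(\{x\})\le1$ for every $x$, and is identified with its random set of points. It has all finite moments if $\mathbb{E}[\Phi(A)^k]<\infty$ for all bounded Borel sets $A$ and all $k=1,2,\dots$. It is stationary if its law is invariant under all translations. It is ergodic if every measurable set $I$ of integer-valued Radon measures on $\mathbf{R}^N$ such that $\mathbb{P}(\Phi\in (I\setminus I_x)\cup(I_x\setminus I))=0$ for all $x\in\mathbf{R}^N$ satisfies $\mathbb{P}(\Phi\in I)\in\{0,1\}$, where $I_x=\{\mu(\cdot-x):\mu\in I\}$. $\Phi_A$ denotes the restriction of $\Phi$ to $A$, and $\Lambda_L=[-\frac L2,\frac L2)^N$. *)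

(* Defs.v *)
From HB Require Import structures.
From mathcomp Require Import all_boot all_order all_algebra.
From mathcomp Require Import finmap.
From mathcomp Require Import all_classical all_reals all_analysis measurable_realfun.

Set Implicit Arguments.
Unset Strict Implicit.
Unset Printing Implicit Defensive.

Import Order.TTheory GRing.Theory Num.Theory.
Import numFieldNormedType.Exports.

Local Open Scope classical_set_scope.
Local Open Scope ring_scope.

Section simplicial_homology.
Context (F : fieldType) (T : finType).
Implicit Types (v : T) (s : {set T}) (K : {set {set T}}).

(* Chains of all degrees on the full simplex over T, with basis the [cell s].
   [F^o] is F as a vector space over itself. *)
Definition chain := {ffun {set T} -> F^o}.

Definition cell s : chain := [ffun t => (t == s)%:R].

(* Simplices are oriented by the enumeration order of T: if s = {v_0 < .. < v_q}
   then [face_sign s v_i] is (-1)^i. *)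
Definition face_sign s v : F :=
  (-1) ^+ #|[pred w in s | (enum_rank w < enum_rank v)%N]|.

(* Homology is not reduced: the boundary of a vertex is 0. *)
Definition simplex_boundary s : chain :=
  if (#|s| <= 1)%N then 0 else \sum_(v in s) face_sign s v *: cell (s :\ v).

Definition boundary (c : chain) : chain := \sum_s c s *: simplex_boundary s.

Lemma boundary_is_linear : linear boundary.
Proof.
move=> a c d; rewrite /boundary scaler_sumr -big_split /=.
by apply: eq_bigr => s _; rewrite !ffunE scalerDl scalerA.
Qed.

HB.instance Definition _ :=
  GRing.isLinear.Build F chain chain *:%R boundary boundary_is_linear.

Lemma boundary_cell s : boundary (cell s) = simplex_boundary s.
Proof.
rewrite /boundary (bigD1 s) //= ffunE eqxx scale1r big1 ?addr0 // => t /negPf ts.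
by rewrite ffunE ts scale0r.
Qed.

Lemma face_signD1 s v w : v \in s -> w \in s -> v != w ->
  face_sign (s :\ v) w = (-1) ^+ (enum_rank v < enum_rank w)%N * face_sign s w.
Proof.
move=> vs ws vw; rewrite /face_sign.
have [vltw|vltw'] := boolP (enum_rank v < enum_rank w)%N.
  rewrite (cardD1 v [pred u in s | (enum_rank u < enum_rank w)%N]).
  rewrite !inE vs vltw /= exprD mulrA -expr2 sqrr_sign mul1r; congr (_ ^+ _).
  by apply: eq_card => u; rewrite !inE andbA.
rewrite mul1r; congr (_ ^+ _); apply: eq_card => u; rewrite !inE -andbA.
by case: eqVneq => //= ->; rewrite (negPf vltw') andbF.
Qed.

Lemma boundary_boundary (c : chain) : boundary (boundary c) = 0.
Proof.
have cell0 s : boundary (simplex_boundary s) = 0.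
  rewrite /simplex_boundary; case: leqP => s1; first by rewrite raddf0.
  rewrite raddf_sum /=.
  under eq_bigr do rewrite linearZ /= boundary_cell /simplex_boundary.
  have [s2|s2] := leqP #|s| 2.
    rewrite big1 // => v vs; rewrite ifT ?scaler0 //.
    by rewrite (cardsD1 v s) vs in s2.
  pose f v w := face_sign s v * face_sign (s :\ v) w *: cell (s :\ v :\ w).
  have fC v w : v \in s -> w \in s -> (enum_rank v < enum_rank w)%N ->
      f v w + f w v = 0.
    move=> vs ws vw; have vNw : v != w by apply: contraTneq vw => ->; rewrite ltnn.
    rewrite /f !face_signD1 // 1?eq_sym // vw ltnNge (ltnW vw) /=.
    rewrite expr1 expr0 mulN1r mul1r mulrN scaleNr mulrC.
    have -> : s :\ w :\ v = s :\ v :\ w.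
      by apply/finset.setP => u; rewrite !inE andbCA.
    by rewrite addNr.
  transitivity (\sum_(v in s) \sum_(w in s | w != v) f v w).
    apply: eq_bigr => v vs; rewrite ifF; last first.
      by apply/negbTE; rewrite -ltnNge (cardsD1 v s) vs in s2 *.
    rewrite scaler_sumr; apply: eq_big => [w|w _]; last by rewrite scalerA.
    by rewrite !inE andbC.
  pose lt (v w : T) := (enum_rank v < enum_rank w)%N.
  have ltNgt v w : (w != v) && ~~ lt v w = lt w v.
    rewrite /lt -leqNgt ltn_neqAle; congr (~~ _ && _).
    by rewrite -(inj_eq enum_rank_inj).
  transitivity (\sum_(v in s) \sum_(w in s | lt v w) (f v w + f w v)); last first.
    by apply: big1 => v vs; apply: big1 => w /andP[ws vw]; exact: fC.
  under [RHS]eq_bigr do rewrite big_split /=.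
  rewrite big_split /= [X in _ + X](exchange_big_dep (mem s)) /=; last first.
    by move=> v w _ /andP[].
  rewrite -big_split /=; apply: eq_bigr => v vs.
  rewrite (bigID (lt v)) /=; congr (_ + _); apply: eq_bigl => w.
    by rewrite -andbA; congr (_ && _); case: eqVneq => //= ->; rewrite /lt ltnn.
  by rewrite -andbA ltNgt vs.
rewrite {2}/boundary linear_sum big1 // => s _.
by rewrite linearZ /= cell0 scaler0.
Qed.

Variable q : nat.

Definition chains (p : nat) K : {vspace chain} :=
  (\sum_(s in K | #|s| == p.+1) <[cell s]>)%VS.

Definition cycles K : {vspace chain} := (chains q K :&: lker (linfun boundary))%VS.

Definition boundaries K : {vspace chain} := (linfun boundary @: chains q.+1 K)%VS.

(* The dimension of the quotient of Z_q(K r) by Z_q(K r) `&` B_q(K s). *)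
Definition persistent_betti (I : Type) (K : I -> {set {set T}}) (r s : I) : nat :=
  (\dim (cycles (K r)) - \dim (cycles (K r) :&: boundaries (K s)))%N.

End simplicial_homology.
Arguments persistent_betti F {T} q {I} K r s.

Section borel_matrix.
Context (R : realType) (m n : nat).

Definition borel_mx : set_system 'M[R]_(m, n) := <<s @open 'M[R]_(m, n) >>.

Let borel_mx0 : borel_mx set0.
Proof. exact: sigma_algebra0. Qed.

Let borel_mxC (A : set 'M[R]_(m, n)) : borel_mx A -> borel_mx (~` A).
Proof. exact: sigma_algebraC. Qed.

Let borel_mxU (A : (set 'M[R]_(m, n))^nat) :
  (forall i, borel_mx (A i)) -> borel_mx (\bigcup_i A i).
Proof. exact: sigma_algebra_bigcup. Qed.

HB.instance Definition _ :=
  @isMeasurable.Build (sigma_display borel_mx) 'M[R]_(m, n) borel_mx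
    borel_mx0 borel_mxC borel_mxU.

End borel_matrix.

Section filtered_complex.
Context (R : realType) (N : nat).
Implicit Types (kappa : {fset 'rV[R]_N} -> \bar R) (x y : 'rV[R]_N).

(* The library's norm on 'rV[R]_N is the sup norm. *)
Definition euclidean_norm x : R := Num.sqrt (\sum_i x ord0 i ^+ 2).

Definition fset_translate x (s : {fset 'rV[R]_N}) : {fset 'rV[R]_N} :=
  [fset (y + x)%R | y in s]%fset.

(* Measurability of a function on nonempty finite sets; the value at the empty
   set never matters. *)
Definition measurable_on_finite_sets kappa : Prop :=
  forall k : nat, (0 < k)%N ->
    measurable_fun [set: k.-tuple 'rV[R]_N]
      (fun t : k.-tuple 'rV[R]_N => kappa [fset y in tval t]%fset).

(* rho : [0, +oo] -> [0, +oo] is represented by a function on \bar R that is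
   only constrained on [0, +oo]. *)
Record filtration_function kappa : Prop := FiltrationFunction {
  kappa_measurable : measurable_on_finite_sets kappa ;
  kappa_ge0 : forall s : {fset 'rV[R]_N}, s != fset0 -> (0 <= kappa s)%E ;
  kappa_monotone : forall s t : {fset 'rV[R]_N},
    s != fset0 -> (s `<=` t)%fset -> (kappa s <= kappa t)%E ;
  kappa_translation : forall x (s : {fset 'rV[R]_N}),
    s != fset0 -> kappa (fset_translate x s) = kappa s ;
  kappa_diameter : exists rho : \bar R -> \bar R,
    [/\ forall t, (0 <= t)%E -> (0 <= rho t)%E,
        forall t u, (0 <= t)%E -> (t <= u)%E -> (rho t <= rho u)%E,
        forall t, (0 <= t)%E -> (t < +oo)%E -> (rho t < +oo)%E &
        forall x y,
          ((euclidean_norm (x - y))%:E <= rho (kappa [fset x; y]%fset))%E] ;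
  kappa_singleton : forall x, kappa [fset x]%fset = 0%E
}.

(* Vertices are the elements of X, seen as a finite type. *)
Definition kappa_complex kappa (X : {fset 'rV[R]_N}) (t : R) : {set {set X}} :=
  [set s : {set X} |
    (s != finset.set0) && (kappa [fsetval v in s]%fset <= t%:E)%E]%SET.

Definition window (L : R) : set 'rV[R]_N :=
  [set x | forall i, - (L / 2) <= x ord0 i < L / 2].

End filtered_complex.

(* Borel measures on R^N that are finite on compact sets are automatically
   regular, hence Radon. *)
Record int_radon (R : realType) (N : nat) : Type := IntRadon {
  int_radon_measure :> {measure set 'rV[R]_N -> \bar R} ;
  int_radon_compact : forall A, compact A -> (int_radon_measure A < +oo)%E ;
  int_radon_int : forall A, measurable A ->
    int_radon_measure A = +oo%E \/ exists k : nat, int_radon_measure A = k%:R%:E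
}.

Section int_radon_measurable.
Context (R : realType) (N : nat).

Lemma int_radon_zero_compact (A : set 'rV[R]_N) :
  compact A -> ((mzero : {measure set 'rV[R]_N -> \bar R}) A < +oo)%E.
Proof. by rewrite /mzero ltry. Qed.

Lemma int_radon_zero_int (A : set 'rV[R]_N) : measurable A ->
  (mzero : {measure set 'rV[R]_N -> \bar R}) A = +oo%E \/
  exists k : nat, (mzero : {measure set 'rV[R]_N -> \bar R}) A = k%:R%:E.
Proof. by right; exists 0%N. Qed.

HB.instance Definition _ := gen_eqMixin (int_radon R N).
HB.instance Definition _ := gen_choiceMixin (int_radon R N).
HB.instance Definition _ := isPointed.Build (int_radon R N)
  (IntRadon int_radon_zero_compact int_radon_zero_int).

(* Generates the Borel sigma-algebra of the vague topology. *)
Definition int_radon_gen : set_system (int_radon R N) :=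
  \bigcup_(A in (measurable : set_system 'rV[R]_N))
    preimage_set_system [set: int_radon R N] (fun mu => mu A) measurable.

Definition int_radon_sigma : set_system (int_radon R N) := <<s int_radon_gen >>.

Let int_radon_sigma0 : int_radon_sigma set0.
Proof. exact: sigma_algebra0. Qed.

Let int_radon_sigmaC (I : set (int_radon R N)) :
  int_radon_sigma I -> int_radon_sigma (~` I).
Proof. exact: sigma_algebraC. Qed.

Let int_radon_sigmaU (I : (set (int_radon R N))^nat) :
  (forall i, int_radon_sigma (I i)) -> int_radon_sigma (\bigcup_i I i).
Proof. exact: sigma_algebra_bigcup. Qed.

HB.instance Definition _ :=
  @isMeasurable.Build (sigma_display int_radon_sigma) (int_radon R N)
    int_radon_sigma int_radon_sigma0 int_radon_sigmaC int_radon_sigmaU.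

End int_radon_measurable.

Section translation.
Context (R : realType) (N : nat).
Implicit Types (x : 'rV[R]_N) (mu : int_radon R N).

Definition shift_by x (y : 'rV[R]_N) : 'rV[R]_N := y + x.

Lemma continuous_shift_by x : continuous (shift_by x).
Proof.
move=> y; apply: (@cvgD R 'rV[R]_N _ (nbhs y) _ id (cst x)) => //.
exact: cvg_cst.
Qed.

Lemma measurable_shift_by x : measurable_fun [set: 'rV[R]_N] (shift_by x).
Proof.
apply: (@measurability _ _ 'rV[R]_N 'rV[R]_N setT (shift_by x) (@open 'rV[R]_N))
  => // _ [B oB <-].
rewrite setTI; apply: sub_sigma_algebra.
by apply: open_comp => // y _; exact: continuous_shift_by.
Qed.

(* The measure A |-> mu (A - x). *)
Definition translate_measure x mu : set 'rV[R]_N -> \bar R :=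
  pushforward mu (shift_by x).

Let translate_measure0 x mu : translate_measure x mu set0 = 0%E.
Proof. by rewrite /translate_measure /pushforward preimage_set0 measure0. Qed.

Let translate_measure_ge0 x mu A : (0 <= translate_measure x mu A)%E.
Proof. exact: (measure_ge0 mu). Qed.

Let translate_measure_sigma_additive x mu :
  semi_sigma_additive (translate_measure x mu).
Proof.
move=> A mA tA mUA; rewrite /translate_measure /pushforward preimage_bigcup.
apply: measure_semi_sigma_additive.
- by move=> n; rewrite -[X in measurable X]setTI; exact: measurable_shift_by.
- apply/trivIsetP => /= i j _ _ ij; rewrite -preimage_setI.
  by move/trivIsetP : tA => /(_ _ _ _ _ ij) ->//; rewrite preimage_set0.
- by rewrite -preimage_bigcup -[X in measurable X]setTI; exact: measurable_shift_by.
Qed.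

HB.instance Definition _ x mu :=
  isMeasure.Build _ _ _ (translate_measure x mu) (translate_measure0 x mu)
    (@translate_measure_ge0 x mu) (@translate_measure_sigma_additive x mu).

Lemma translate_compact x mu (A : set 'rV[R]_N) :
  compact A -> (translate_measure x mu A < +oo)%E.
Proof.
move=> cA; apply: int_radon_compact.
suff -> : shift_by x @^-1` A = shift_by (- x) @` A.
  by apply: continuous_compact => //; apply: continuous_subspaceT;
     exact: continuous_shift_by.
apply/seteqP; split => [y Ay|_ [y Ay <-]] /=.
  by exists (shift_by x y) => //; rewrite /shift_by addrK.
by rewrite /shift_by subrK.
Qed.

Lemma translate_int x mu (A : set 'rV[R]_N) : measurable A ->
  translate_measure x mu A = +oo%E \/
  exists k : nat, translate_measure x mu A = k%:R%:E.
Proof.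
move=> mA; apply: int_radon_int; rewrite -[X in measurable X]setTI.
exact: measurable_shift_by.
Qed.

Definition translate x mu : int_radon R N :=
  @IntRadon R N (translate_measure x mu) (@translate_compact x mu)
    (@translate_int x mu).

End translation.

Section point_process.
Context (R : realType) (N : nat) (d : measure_display) (Omega : measurableType d)
  (P : probability Omega R) (Phi : {RV P >-> int_radon R N}).

Definition simple_process : Prop :=
  {ae P, forall w, forall x : 'rV[R]_N, (Phi w [set x] <= 1)%E}.

Definition all_finite_moments : Prop :=
  forall A : set 'rV[R]_N, measurable A -> bounded_set A ->
  forall k : nat, (0 < k)%N -> (\int[P]_w (Phi w A ^+ k) < +oo)%E.

Definition stationary_process : Prop :=
  forall (x : 'rV[R]_N) (I : set (int_radon R N)), measurable I ->
    P [set w | I (translate x (Phi w))] = P [set w | I (Phi w)].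

Definition ergodic_process : Prop :=
  forall I : set (int_radon R N), measurable I ->
    (forall x : 'rV[R]_N, let Ix := translate x @` I in
       P (Phi @^-1` ((I `\` Ix) `|` (Ix `\` I))) = 0%E) ->
    P (Phi @^-1` I) = 0%E \/ P (Phi @^-1` I) = 1%E.

End point_process.

Lemma finite_atoms (R : realType) (N : nat) (mu : int_radon R N)
    (A : set 'rV[R]_N) :
  bounded_set A -> finite_set [set x | A x /\ (0 < mu [set x])%E].
Proof.
move=> [M [_ AM]].
pose C : set 'rV[R]_N := [set x | `|x| <= M + 1].
have AC : A `<=` C by move=> x; apply: AM; rewrite ltrDl.
have cC : compact C.
  apply: bounded_closed_compact; first by exists (M + 1); split; [exact: num_real|move=> r /ltW Mr x /le_trans; exact].
  by apply: (preimage_closed (f := fun x : 'rV[R]_N => `|x|) (D := [set y | y <= M + 1]));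
    [move=> x _; exact: norm_continuous|exact: closed_le].
have mclosed (D : set 'rV[R]_N) : closed D -> measurable D.
  move=> cD; rewrite -[D]setCK; apply: measurableC; apply: sub_sigma_algebra.
  exact: closed_openC.
have m1 x : measurable [set x : 'rV[R]_N].
  apply: mclosed; apply: accessible_closed_set1.
  exact/hausdorff_accessible/norm_hausdorff.
have mC : measurable C.
  by apply: mclosed; apply: compact_closed => //; exact: norm_hausdorff.
have [k muC] : exists k : nat, mu C = k%:R%:E.
  have [muC|//] := int_radon_int mu mC.
  by have := int_radon_compact mu cC; rewrite muC.
apply: contrapT => /(@infinite_set_fset _ _ k.+1)[B BA kB].
have muBC : (mu [set` B] <= mu C)%E.
  apply: le_measure; rewrite ?inE //; last by move=> x /BA [/AC].
  by rewrite -(image_id [set` B]) -bigcup_imset1; apply: fin_bigcup_measurable.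
have : (k.+1%:R%:E <= mu [set` B])%E.
  rewrite -(image_id [set` B]) -bigcup_imset1 measure_fin_bigcup //; last first.
    by move=> x y _ _ [z [/= -> ->]].
  rewrite fsbig_finite //= set_fsetK.
  apply: (@le_trans _ _ (\sum_(x <- B) 1%:E)%E).
    by rewrite sumEFin lee_fin big_const_seq count_predT iter_addr_0 ler_nat.
  rewrite !big_seq; apply: lee_sum => x /BA [_].
  have [->|[j ->]] := int_radon_int mu (m1 x); first by rewrite leey.
  by rewrite lte_fin lee_fin ltr0n ler1n.
move=> /le_trans /(_ muBC); rewrite muC lee_fin ler_nat ltnn; exact.
Qed.

(* For simple mu, the restriction of mu to A viewed as a set of points; see
   [finite_atoms] for the finiteness that [fset_set] relies on. *)
Definition points (R : realType) (N : nat) (mu : int_radon R N)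
    (A : set 'rV[R]_N) : {fset 'rV[R]_N} :=
  fset_set [set x | A x /\ (0 < mu [set x])%E].

(* Main.v *)
(* A dimension count shows that the persistent Betti number is additive over disjoint
   vertex sets without simplices between them, and that it changes by at most the
   number of new simplices of dimension q and q + 1 when simplices are added. By (K3)
   the simplices of K(Xi, s) have bounded diameter, so cutting a region into boxes
   changes it by at most the sum, over the unit cubes z near the cuts, of the cost
   2 #(points near z)^(q + 2), a stationary field with finite moments. Hence, writing
   X_i for the number of the box of side 2^i divided by its volume, the number of a
   large window divided by its volume is an average of translates of X_i up to
   O(2^-i) in mean, and the expectations converge.

   For almost sure convergence, the same estimate in L^2 and the parallelogram
   identity, applied to averages over a huge box as in the mean ergodic theorem, make
   (X_i) a Cauchy sequence in L^2. Its limit is invariant under translations, thus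
   constant, say b, when the process is ergodic. The Hardy-Littlewood maximal
   inequality on Z^N for |X_i - b|, whose mean tends to 0, and for the squared cost
   bounds the averages over all large windows simultaneously. Only the invariance of
   the law under translations is used, so these arguments take place on the space of
   integer-valued Radon measures, and a measure is replaced with its set of atoms. *)
Require Import Defs.
From HB Require Import structures.
From mathcomp Require Import all_boot all_order all_algebra.
From mathcomp Require Import finmap.
From mathcomp Require Import all_classical all_reals all_analysis measurable_realfun.
From mathcomp Require Import zify ring lra.
Set Implicit Arguments.
Unset Strict Implicit.
Unset Printing Implicit Defensive.
Import Order.TTheory GRing.Theory Num.Theory.
Import numFieldNormedType.Exports.

Local Open Scope classical_set_scope.
Local Open Scope ring_scope.

(** * Linear algebra of persistent Betti numbers *)

Section chain_spaces.
Context (F : fieldType) (T : finType).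
Implicit Types (A K : {set {set T}}) (s t : {set T}).
Local Notation chain := (chain F T).
Local Notation cell := (cell F).
Local Notation bd := (linfun (@boundary F T)).

(** In general persistent Betti numbers are neither subadditive nor superadditive over disjoint
    boxes, so subadditive limit theorems do not apply; only a two-sided error at the cuts is
    available. Dyadic boxes tile each other exactly and make the errors geometric; in particular the
    effect of a translation is summable, which yields almost sure invariance of the limit. The
    parallelogram identity works because the norms of the X_i almost decrease to a limit m:
    averaging X_l + X_k over shifts inside a huge box nearly gives twice the value of that box, so
    the norm of X_l + X_k cannot drop much below 2m. The cost is squared because bounded averages
    alone do not make its sum over a thin shell small: cost <= theta + cost^2 / theta leaves a part
    proportional to the few cubes of the shell and a part that is small for large theta. A separate
    obstacle is the measurability of the Betti number in the measure: atoms carry no canonical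
    labels, so all their enumerations are tested at once. This requires invariance under
    relabelling, although orientations depend on an enumeration of the vertices. *)

Lemma cellE s t : cell s t = (t == s)%:R.
Proof. by rewrite /Defs.cell ffunE. Qed.

Lemma chain_sum_cells (c : chain) : c = \sum_s c s *: cell s.
Proof.
apply/ffunP => t; rewrite sum_ffunE (bigD1 t) //= !ffunE eqxx.
rewrite big1 ?addr0 => [|s st]; first by rewrite /GRing.scale /= mulr1.
by rewrite !ffunE eq_sym (negPf st) scaler0.
Qed.

Lemma mem_cells A (c : chain) :
  reflect (forall s, c s != 0 -> s \in A) (c \in (\sum_(s in A) <[cell s]>)%VS).
Proof.
apply: (iffP idP) => [cA s|cA].
  apply: contra_neqT => sA.
  have [u uA ->] := memv_sumP cA.
  rewrite sum_ffunE big1 // => t tA; have /vlineP[k ->] := uA t tA.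
  by rewrite !ffunE; case: eqVneq sA => [->|_ _]; rewrite ?tA// scaler0.
rewrite [c]chain_sum_cells; apply: memv_suml => s _.
have [->|/cA sA] := eqVneq (c s) 0; first by rewrite scale0r mem0v.
by apply: (subvP (sumv_sup s _ _)) => //; rewrite ?memvZ ?memv_line.
Qed.

Lemma chainsE p K :
  chains F p K = (\sum_(s in [set s in K | #|s| == p.+1]%SET) <[cell s]>)%VS.
Proof. by apply: eq_bigl => s; rewrite inE. Qed.

Lemma mem_chains p K (c : chain) :
  reflect (forall s, c s != 0 -> (s \in K) && (#|s| == p.+1)) (c \in chains F p K).
Proof.
by rewrite chainsE; apply: (iffP (mem_cells _ _)) => cK s /cK; rewrite inE.
Qed.

Lemma dim_cells A : (\dim (\sum_(s in A) <[cell s]>) <= #|A|)%N.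
Proof.
apply: leq_trans (dimv_leq_sum _ _ _) _.
rewrite -sum1_card; apply: leq_sum => s _.
by rewrite dim_vline; case: eqP.
Qed.

Lemma dim_chains p K : (\dim (chains F p K) <= #|[set s in K | #|s| == p.+1]%SET|)%N.
Proof. by rewrite chainsE dim_cells. Qed.

Lemma boundaries_cycle q K : (boundaries F q K <= lker bd)%VS.
Proof.
apply/subvP => _ /memv_imgP[c _ ->]; rewrite memv_ker !lfunE /=.
by rewrite boundary_boundary.
Qed.

(* This writes the persistent Betti number as an alternating sum of dimensions that
   are additive over disjoint vertex sets and monotone in the complexes. *)
Lemma betti_dim q (Kr Ks : {set {set T}}) :
  (\dim (cycles F q Kr) - \dim (cycles F q Kr :&: boundaries F q Ks) +
   (\dim (bd @: chains F q Kr) + \dim (boundaries F q Ks)) =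
  \dim (chains F q Kr + boundaries F q Ks))%N.
Proof.
have capE : (cycles F q Kr :&: boundaries F q Ks = chains F q Kr :&: boundaries F q Ks)%VS.
  by rewrite /cycles -capvA (capv_idPr (boundaries_cycle q Ks)).
have h1 := limg_ker_dim bd (chains F q Kr).
have h2 := dimv_sum_cap (chains F q Kr) (boundaries F q Ks).
have h3 : (\dim (cycles F q Kr :&: boundaries F q Ks) <= \dim (cycles F q Kr))%N.
  by rewrite dimvS ?capvSl.
move: h1 h2 h3; rewrite capE /cycles.
move: (\dim (chains F q Kr)) (\dim (chains _ _ _ :&: lker _)) (\dim (bd @: _)).
move: (\dim (boundaries F q Ks)) (\dim (_ + _)) (\dim (_ :&: boundaries _ _ _)).
move=> b t u c z d h1 h2 h3.
lia.
Qed.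

(** The same number as [persistent_betti], for an arbitrary pair of complexes: the comparison
    complexes below are not members of one indexed filtration. *)
Definition pbetti q (Kr Ks : {set {set T}}) : nat :=
  (\dim (cycles F q Kr) - \dim (cycles F q Kr :&: boundaries F q Ks))%N.

Lemma chainsS p K K' : K' \subset K -> (chains F p K' <= chains F p K)%VS.
Proof.
move=> /fintype.subsetP KK'; apply/subvP => c /mem_chains cK; apply/mem_chains => s.
by move=> /cK/andP[/KK' -> ->].
Qed.

Lemma cell_chain p K s : s \in K -> #|s| == p.+1 -> cell s \in chains F p K.
Proof.
move=> sK sp; apply/mem_chains => t; rewrite cellE.
by case: (eqVneq t s) => [->|_]; rewrite ?sK ?sp// mulr0n eqxx.
Qed.

Lemma chains_split p K K' : K' \subset K ->
  (chains F p K <= chains F p K' + chains F p (K :\: K')%SET)%VS.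
Proof.
move=> KK'; apply/subvP => c /mem_chains cK; rewrite [c]chain_sum_cells.
apply: memv_suml => s _.
have [->|/cK/andP[sK sp]] := eqVneq (c s) 0; first by rewrite scale0r mem0v.
apply: memvZ; have [sK'|sK'] := boolP (s \in K').
  by apply: (subvP (addvSl _ _)); exact: cell_chain.
by apply: (subvP (addvSr _ _)); apply: cell_chain; rewrite // inE sK'.
Qed.

Lemma dim_chains_extend p K K' (U : {vspace chain}) : K' \subset K ->
  (\dim (chains F p K + U) <=
    \dim (chains F p K' + U) + #|[set s in K :\: K' | #|s| == p.+1]%SET|)%N.
Proof.
move=> KK'; have KE := chains_split p KK'.
apply: (@leq_trans (\dim ((chains F p K' + U) + chains F p (K :\: K')%SET))).
  by apply: dimvS; rewrite -addvA [(U + _)%VS]addvC addvA addvS.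
by rewrite (leq_trans (dimv_add_leqif _ _))// leq_add2l dim_chains.
Qed.

Lemma dim_img_extend p K K' : K' \subset K ->
  (\dim (bd @: chains F p K) <=
    \dim (bd @: chains F p K') + #|[set s in K :\: K' | #|s| == p.+1]%SET|)%N.
Proof.
move=> KK'; have KE := chains_split p KK'.
apply: (@leq_trans (\dim ((bd @: chains F p K') + (bd @: chains F p (K :\: K')%SET)))).
  by apply: dimvS; rewrite -limgD limgS.
rewrite (leq_trans (dimv_add_leqif _ _))// leq_add2l.
rewrite (leq_trans _ (dim_chains _ _))//.
by rewrite -(limg_ker_dim bd (chains F p (K :\: K')%SET)) leq_addl.
Qed.

(** By [betti_dim] the number is dim(C_r + B_s) - dim(bd C_r) - dim B_s. Each of these dimensions is
    monotone in the complexes, and a new simplex raises it by at most one. *)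
Lemma pbetti_diff q (Kr Ks Kr' Ks' : {set {set T}}) n :
  Kr' \subset Kr -> Ks' \subset Ks ->
  (#|[set s in Kr :\: Kr' | #|s| == q.+1]%SET| +
   #|[set s in Ks :\: Ks' | #|s| == q.+2]%SET| <= n)%N ->
  (pbetti q Kr Ks <= pbetti q Kr' Ks' + n)%N /\
  (pbetti q Kr' Ks' <= pbetti q Kr Ks + n)%N.
Proof.
move=> rr ss nle.
have e1 := betti_dim q Kr Ks; have e2 := betti_dim q Kr' Ks'.
have h1 := dim_chains_extend q (boundaries F q Ks) rr.
have h2 := dim_img_extend q.+1 ss; have h3 := dim_img_extend q rr.
have h4 : (\dim (chains F q Kr' + boundaries F q Ks') <=
    \dim (chains F q Kr + boundaries F q Ks))%N.
  by apply/dimvS/addvS; rewrite ?chainsS// limgS// chainsS.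
(* Submodularity of the dimension: enlarging B' to B raises dim(C + B') by at most dim B - dim B',
   which the term - dim B_s absorbs. *)
have h5 : (\dim (chains F q Kr' + boundaries F q Ks) + \dim (boundaries F q Ks')  <=
    \dim (chains F q Kr' + boundaries F q Ks') + \dim (boundaries F q Ks))%N.
  set C := chains F q Kr'; set B := boundaries F q Ks; set B' := boundaries F q Ks'.
  have BB' : (B' <= B)%VS by rewrite limgS// chainsS.
  have -> : (C + B = (C + B') + B)%VS.
    by rewrite -addvA; congr (_ + _)%VS; apply/esym/addv_idPr.
  have := dimv_sum_cap (C + B') B.
  have : (\dim B' <= \dim ((C + B') :&: B))%N.
    by rewrite dimvS// subv_cap BB' addvSr.
  lia.
have h6 : (\dim (bd @: chains F q Kr') <= \dim (bd @: chains F q Kr))%N.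
  by rewrite dimvS// limgS// chainsS.
have h7 : (\dim (boundaries F q Ks') <= \dim (boundaries F q Ks))%N.
  by rewrite dimvS// limgS// chainsS.
rewrite -/(pbetti q Kr Ks) in e1; rewrite -/(pbetti q Kr' Ks') in e2.
rewrite -/(boundaries F q Ks) -/(boundaries F q Ks') in h2.
move: nle e1 e2 h1 h2 h3 h4 h5 h6 h7.
move: (pbetti q Kr Ks) (pbetti q Kr' Ks') => x x'.
move: #|_| => n1; move: #|_| => n2.
move: (\dim (boundaries F q Ks)) (\dim (boundaries F q Ks')) => B B'.
move: (\dim (bd @: chains F q Kr)) (\dim (bd @: chains F q Kr')) => D D'.
move: (\dim (_ + _)) (\dim (_ + _)) (\dim (_ + _)).
lia.
Qed.

Lemma simplex_boundary_support s t : simplex_boundary F s t != 0 ->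
  (t \subset s) && (t != finset.set0).
Proof.
rewrite /simplex_boundary; case: leqP => [_|s2]; first by rewrite ffunE eqxx.
apply: contra_neqT => ts; rewrite sum_ffunE big1 // => v vs; rewrite ffunE cellE.
case: (t =P s :\ v) ts => [->|_ _]; last by rewrite scaler0.
rewrite finset.subD1set /= negbK -cards_eq0 => /eqP s0.
by rewrite (cardsD1 v s) vs s0 in s2.
Qed.

Lemma chain_support_sub p K (Y : {set T}) (c : chain) t :
    (forall s, s \in K -> s \subset Y) ->
  c \in chains F p K -> c t != 0 -> (t \subset Y) && (t != finset.set0).
Proof.
move=> KY /mem_chains cK /cK/andP[/KY -> tp].
by rewrite -cards_eq0 (eqP tp).
Qed.

Lemma img_support_sub p K (Y : {set T}) (c : chain) t : (forall s, s \in K -> s \subset Y) ->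
  c \in (bd @: chains F p K)%VS -> c t != 0 -> (t \subset Y) && (t != finset.set0).
Proof.
move=> KY /memv_imgP[{}c /mem_chains cK ->]; rewrite lfunE /=.
apply: contra_neqT => tY; rewrite /boundary sum_ffunE big1 // => s _.
rewrite ffunE; have [->|/cK/andP[/KY sY _]] := eqVneq (c s) 0; first by rewrite scale0r.
rewrite (_ : simplex_boundary F s t = 0) ?scaler0//.
apply: contraNeq tY => /simplex_boundary_support/andP[ts ->].
by rewrite (fintype.subset_trans ts sY).
Qed.

(** A nonempty simplex lies in at most one of the disjoint [Y i], so each coefficient of a vanishing
    sum comes from a single summand. The condition [t != finset.set0] matters: [chain] also has a
    basis vector for the empty set, which lies in every [Y i]. *)
Lemma directv_support (I : finType) (Y : I -> {set T}) (W : I -> {vspace chain}) :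
    (forall i j x, x \in Y i -> x \in Y j -> i = j) ->
    (forall i (c : chain) t, c \in W i -> c t != 0 ->
      (t \subset Y i) && (t != finset.set0)) ->
  \dim (\sum_i W i) = (\sum_i \dim (W i))%N.
Proof.
move=> dY WY; suff /directvP : directv (\sum_i W i)%VS by [].
apply/directv_sum_independent => u uW u0 i _; apply/ffunP => t; rewrite [RHS]ffunE.
apply: contraTeq isT => ut; have /andP[tYi tn0] := WY _ _ _ (uW i isT) ut.
move/ffunP : u0 => /(_ t); rewrite sum_ffunE [RHS]ffunE (bigD1 i) //= big1 ?addr0.
  by move=> ut0; rewrite ut0 eqxx in ut.
move=> j ji; apply/eqP; apply: contraTT isT => utj.
have /andP[tYj _] := WY _ _ _ (uW j isT) utj.
have /finset.set0Pn[x xt] := tn0.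
have := dY j i x; rewrite (fintype.subsetP tYj)// (fintype.subsetP tYi)//.
by move=> /(_ isT isT) jiE; rewrite jiE eqxx in ji.
Qed.

Definition full_subcomplex K (Y : {set T}) : {set {set T}} := [set s in K | s \subset Y]%SET.

Lemma chains_full_subcomplex (I : finType) (Y : I -> {set T}) p K :
  (chains F p [set s in K | [exists i, s \subset Y i]]%SET =
   \sum_i chains F p (full_subcomplex K (Y i)))%VS.
Proof.
apply/eqP; rewrite eqEsubv; apply/andP; split.
  rewrite [X in (X <= _)%VS]chainsE; apply/subv_sumP => s.
  rewrite !inE => /andP[/andP[sK /existsP[i si]] sp].
  apply: (subv_trans _ (sumv_sup i _ (subvv _))) => //.
  by rewrite -memvE cell_chain// inE sK.
apply/subv_sumP => i _; apply/chainsS/fintype.subsetP => s.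
by rewrite !inE => /andP[-> si]; apply/existsP; exists i.
Qed.

(** Every other term of [betti_dim] is the dimension of a space that splits as a direct sum over the
    [Y i]; cancelling them leaves additivity of [pbetti]. *)
Lemma pbetti_full_subcomplex (I : finType) (Y : I -> {set T}) q (Kr Ks : {set {set T}}) :
    (forall i j x, x \in Y i -> x \in Y j -> i = j) ->
  pbetti q [set s in Kr | [exists i, s \subset Y i]]%SET
           [set s in Ks | [exists i, s \subset Y i]]%SET =
  (\sum_i pbetti q (full_subcomplex Kr (Y i)) (full_subcomplex Ks (Y i)))%N.
Proof.
move=> dY; set K1 := [set s in Kr | _]%SET; set K2 := [set s in Ks | _]%SET.
have rY K i s : s \in full_subcomplex K (Y i) -> s \subset Y i.
  by rewrite inE => /andP[].
have := betti_dim q K1 K2.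
rewrite -[X in (X + _)%N]/(pbetti q K1 K2); move: (pbetti q K1 K2) => x.
have -> : boundaries F q K2 = (\sum_i boundaries F q (full_subcomplex Ks (Y i)))%VS.
  by rewrite /boundaries chains_full_subcomplex limg_sum.
rewrite chains_full_subcomplex limg_sum -big_split /=.
rewrite !(@directv_support _ Y)//=; first last.
- by move=> i c t; rewrite ?/boundaries => cB; exact: (img_support_sub (rY _ i) cB).
- move=> i c t cW; have [a aC [b bB ->]] := memv_addP cW; rewrite ffunE => abt.
  have [at0|at0] := eqVneq (a t) 0.
    rewrite at0 add0r in abt; move: bB; rewrite /boundaries => bB.
    exact: (img_support_sub (rY _ i) bB abt).
  exact: (chain_support_sub (rY _ i) aC at0).
- by move=> i c t; rewrite ?/boundaries => cB; exact: (img_support_sub (rY _ i) cB).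
rewrite -big_split /=.
under [RHS]eq_bigr do rewrite -betti_dim.
by rewrite [X in _ = X -> _]big_split /= => /addIn.
Qed.

End chain_spaces.

(** * Invariance of persistent Betti numbers under injective relabelling of the vertices *)

Lemma card_pred_sum (T : finType) (A : {set T}) (p : pred T) :
  #|[pred w in A | p w]| = (\sum_(w in A) p w)%N.
Proof.
rewrite -sum1_card (eq_bigl (fun w => (w \in A) && p w)) // big_mkcondr /=.
by apply: eq_bigr => w _; case: (p w).
Qed.

Section relabel.
Context (F : fieldType) (T T' : finType) (f : T -> T') (f_inj : injective f).
Implicit Types (s t : {set T}).

Let lt (a b : T) := (enum_rank a < enum_rank b)%N.
Let lt' (a b : T) := (enum_rank (f a) < enum_rank (f b))%N.

(* f need not be increasing: [relabel] corrects the orientation of the image of s. *)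
Definition inversions s : nat := (\sum_(a in s) \sum_(b in s) (lt a b && lt' b a))%N.

Definition relabel_sign s : F := (-1) ^+ inversions s.

Definition relabel (c : chain F T) : chain F T' :=
  \sum_s (c s * relabel_sign s) *: cell F (f @: s).

Lemma relabel_is_linear : linear relabel.
Proof.
move=> a c d; rewrite /relabel scaler_sumr -big_split /=.
by apply: eq_bigr => s _; rewrite !ffunE mulrDl scalerDl scalerA mulrA.
Qed.

HB.instance Definition _ :=
  GRing.isLinear.Build F (chain F T) (chain F T') *:%R relabel relabel_is_linear.

Lemma relabel_cell s : relabel (cell F s) = relabel_sign s *: cell F (f @: s).
Proof.
rewrite /relabel (bigD1 s) //= cellE eqxx mul1r big1 ?addr0// => t ts.
by rewrite cellE (negPf ts) mul0r scale0r.
Qed.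

Lemma relabel_sign_neq0 s : relabel_sign s != 0.
Proof. by rewrite /relabel_sign signr_eq0. Qed.

Lemma relabel_inj : injective relabel.
Proof.
move=> c d cd; apply/ffunP => s; move/ffunP : cd => /(_ (f @: s)).
have E (e : chain F T) : relabel e (f @: s) = e s * relabel_sign s.
  rewrite /relabel sum_ffunE (bigD1 s) //= ffunE cellE eqxx big1 => [|t ts].
    by rewrite addr0 /GRing.scale /= mulr1.
  rewrite ffunE cellE (inj_eq (imset_inj f_inj)) eq_sym (negPf ts) scaler0 //.
by rewrite !E => /(mulIf (relabel_sign_neq0 s)).
Qed.

(** Modulo 2: the number of inverted pairs containing v is the change of the position of v under f.
    The even term turns the congruence into an identity in [nat]. *)
Lemma inversionsD1 s v : v \in s ->
  (inversions s + #|[pred w in s | (enum_rank w < enum_rank v)%N]| =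
   #|[pred w in f @: s | (enum_rank w < enum_rank (f v))%N]| + inversions (s :\ v)
   + 2 * \sum_(w in s) (lt w v && lt' v w))%N.
Proof.
move=> vs.
have tri (a b : T) : a != b -> lt a b = ~~ lt b a.
  move=> ab; rewrite /lt -leqNgt ltn_neqAle.
  by rewrite (inj_eq (@ord_inj _)) (inj_eq enum_rank_inj) (negPf ab).
have tri' (a b : T) : a != b -> lt' a b = ~~ lt' b a.
  move=> ab; rewrite /lt' -leqNgt ltn_neqAle (inj_eq (@ord_inj _)) (inj_eq enum_rank_inj).
  by rewrite (inj_eq f_inj) (negPf ab).
have irr a : lt a a = false by rewrite /lt ltnn.
have irr' a : lt' a a = false by rewrite /lt' ltnn.
have -> : #|[pred w in f @: s | (enum_rank w < enum_rank (f v))%N]| =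
    (\sum_(w in s) lt' w v)%N.
  rewrite (card_pred_sum (f @: s) (fun w => enum_rank w < enum_rank (f v))%N).
  by rewrite big_imset //= => a b _ _ /f_inj.
rewrite (card_pred_sum s (fun w => enum_rank w < enum_rank v)%N).
have -> : inversions s = (inversions (s :\ v) +
    \sum_(w in s) ((lt w v && lt' v w) + (lt v w && lt' w v)))%N.
  rewrite /inversions big_split /= [LHS](big_setD1 v) //=.
  rewrite [X in (_ + X)%N = _](eq_bigr (fun a => (lt a v && lt' v a) +
     \sum_(b in s :\ v) (lt a b && lt' b a))%N); last first.
    by move=> a _; rewrite (big_setD1 v).
  rewrite big_split /= [X in _ = (_ + (X + _))%N](big_setD1 v) //= irr /= add0n.
  lia.
transitivity (inversions (s :\ v) + (\sum_(w in s) lt' w v +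
    2 * \sum_(w in s) (lt w v && lt' v w)))%N; last by lia.
rewrite -addnA; congr (_ + _)%N.
rewrite -big_split /= big_distrr /= -big_split /=; apply: eq_bigr => w _.
rewrite -/(lt w v); have [->|wv] := eqVneq w v; first by rewrite !irr !irr'.
by rewrite (tri w v)// (tri' w v)//; case: (lt v w); case: (lt' v w).
Qed.

Lemma relabel_face_sign s v : v \in s ->
  relabel_sign s * face_sign F (f @: s) (f v) = face_sign F s v * relabel_sign (s :\ v).
Proof.
move=> vs; have h := inversionsD1 vs.
rewrite /relabel_sign /face_sign -!exprD -signr_odd -[RHS]signr_odd.
move: h; move: (inversions s) (inversions _) #|_| #|_| (\sum_(_ in _) _)%N => a b c d e h.
by congr (_ ^+ nat_of_bool _); lia.
Qed.

Lemma relabel_simplex_boundary s :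
  boundary (relabel_sign s *: cell F (f @: s)) = relabel (simplex_boundary F s).
Proof.
rewrite linearZ /= boundary_cell /simplex_boundary card_imset//.
case: ifP => s1; first by rewrite scaler0 linear0.
rewrite [RHS]linear_sum scaler_sumr big_imset /=; last by move=> a b _ _ /f_inj.
apply: eq_bigr => v vs.
rewrite [RHS]linearZ /= relabel_cell !scalerA relabel_face_sign//; congr (_ *: cell F _).
apply/finset.setP => x; rewrite !inE; apply/andP/imsetP.
  move=> [xv /imsetP[y ys xy]]; exists y; rewrite // !inE ys andbT.
  by apply: contraNneq xv => yv; rewrite xy yv.
move=> [y]; rewrite !inE => /andP[yv ys] ->; rewrite (inj_eq f_inj) yv.
by rewrite imset_f.
Qed.

Lemma relabel_boundary (c : chain F T) : boundary (relabel c) = relabel (boundary c).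
Proof.
have lin (V : lmodType F) (g : {linear chain F T -> V}) (e : chain F T) :
    g e = \sum_s e s *: g (cell F s).
  by rewrite {1}[e]chain_sum_cells linear_sum; apply: eq_bigr => s _; rewrite linearZ.
rewrite (lin _ relabel c) (lin _ (@boundary F T) c) [LHS]linear_sum [RHS]linear_sum.
apply: eq_bigr => s _; rewrite [LHS]linearZ [RHS]linearZ /= relabel_cell boundary_cell.
by rewrite relabel_simplex_boundary.
Qed.

Lemma relabel_chains p (K : {set {set T}}) :
  (linfun relabel @: chains F p K = chains F p [set f @: (s : {set T}) | s in K]%SET)%VS.
Proof.
rewrite /chains limg_sum (eq_bigr (fun s => <[cell F (f @: s)]>%VS)).
  rewrite [LHS]big_mkcondr [RHS]big_mkcondr /= big_imset /=; last first.
    by move=> a b _ _; exact: imset_inj.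
  by apply: eq_bigr => s _; rewrite card_imset.
move=> s _; rewrite limg_line lfunE /= relabel_cell.
apply/eqP; rewrite eqEsubv -!memvE memvZ ?memv_line//=.
by apply/vlineP; exists (relabel_sign s)^-1; rewrite scalerA mulVf ?scale1r ?relabel_sign_neq0.
Qed.

(** An injective chain map preserves every dimension in [betti_dim]. This removes the dependence on
    the enumeration of the vertex type, so a point set can be compared with a subset of a larger
    one, a translate or a tuple. *)
Lemma pbetti_relabel q (Kr Ks : {set {set T}}) :
  pbetti F q [set f @: (s : {set T}) | s in Kr]%SET [set f @: (s : {set T}) | s in Ks]%SET =
  pbetti F q Kr Ks.
Proof.
have dimE (U : {vspace chain F T}) : \dim (linfun relabel @: U) = \dim U.
  apply: limg_dim_eq; suff -> : lker (linfun relabel) = 0%VS by rewrite capv0.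
  by apply/eqP/lker0P => c d; rewrite !lfunE => /relabel_inj.
have imgC (U : {vspace chain F T}) :
    (linfun (@boundary F T') @: (linfun relabel @: U) =
     linfun relabel @: (linfun (@boundary F T) @: U))%VS.
  rewrite -!limg_comp; congr (_ @: _)%VS; apply/lfunP => c.
  by rewrite !comp_lfunE !lfunE /= relabel_boundary.
have := betti_dim F q Kr Ks.
have := betti_dim F q [set f @: (s : {set T}) | s in Kr]%SET [set f @: (s : {set T}) | s in Ks]%SET.
rewrite -[X in (X + _)%N]/(pbetti F q _ _) -[X in _ -> (X + _)%N = _ -> _]/(pbetti F q _ _).
rewrite /boundaries -!relabel_chains !imgC -limgD !dimE => <- /eqP.
by rewrite eqn_add2r => /eqP.
Qed.

End relabel.

(** * The complexes of finite point sets: translation, restriction, near additivity *)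

Section finite_point_sets.
Context (R : realType) (N : nat) (F : fieldType) (q : nat).
Context (kappa : {fset 'rV[R]_N} -> \bar R) (kappaP : filtration_function kappa).
Local Notation V := 'rV[R]_N.
Implicit Types (X Y : {fset V}) (t : R).

(** Keeping the vertex type fixed while the positions [g] vary makes complexes of different point
    sets comparable; with T = ['I_k] there are only finitely many of them. *)
Definition labelled_complex (T : finType) (g : T -> V) t : {set {set T}} :=
  [set J : {set T} | (J != finset.set0) &&
    (kappa [fset g j | j in J]%fset <= t%:E)%E]%SET.

Lemma labelled_complex_image (T : finType) (g : T -> V) X (gX : forall j, g j \in X) t :
    injective g ->
  [set (fun j => [` gX j]%fset) @: (J : {set T}) | J in labelled_complex g t]%SET =
  full_subcomplex (kappa_complex kappa X t) [set x : X | [exists j, g j == val x]]%SET.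
Proof.
move=> ginj; pose f j : X := [` gX j]%fset.
have fE (J : {set T}) : [fset val x | x in f @: J]%fset = [fset g j | j in J]%fset.
  apply/fsetP => y; apply/imfsetP/imfsetP => -[/= x].
    by move=> /imsetP[j jJ ->] ->; exists j.
  by move=> xJ ->; exists (f x); rewrite //= imset_f.
apply/finset.setP => S; rewrite !inE; apply/imsetP/idP.
  move=> [J]; rewrite !inE => /andP[J0 Jt] ->; rewrite fE Jt andbT imset_eq0 J0 /=.
  by apply/fintype.subsetP => _ /imsetP[j _ ->]; rewrite inE; apply/existsP; exists j.
move=> /andP[/andP[S0 St] Sg].
have SE : S = f @: [set j | f j \in S]%SET.
  apply/finset.setP => x; apply/idP/imsetP => [xS|[j]]; last by rewrite inE => ? ->.
  have := fintype.subsetP Sg x xS; rewrite inE => /existsP[j /eqP jx].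
  have xE : x = f j by apply/val_inj; rewrite /= jx.
  by exists j; rewrite // inE -xE.
exists [set j | f j \in S]%SET => //; rewrite inE -fE -SE St andbT.
by apply: contraNneq S0 => S0; rewrite SE S0 imset0.
Qed.

Lemma pbetti_labelled (T : finType) (g : T -> V) X (gX : forall j, g j \in X) (r s : R) :
    injective g ->
  let im := [set x : X | [exists j, g j == val x]]%SET in
  pbetti F q (labelled_complex g r) (labelled_complex g s) =
  pbetti F q (full_subcomplex (kappa_complex kappa X r) im)
             (full_subcomplex (kappa_complex kappa X s) im).
Proof.
move=> ginj im; rewrite -!(labelled_complex_image gX)//.
by rewrite pbetti_relabel// => i j /(congr1 val) /ginj.
Qed.

Lemma full_subcomplexT (T : finType) (K : {set {set T}}) : full_subcomplex K [set: T]%SET = K.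
Proof. by apply/finset.setP => s; rewrite inE finset.subsetT andbT. Qed.

Definition finite_betti X (r s : R) : nat :=
  persistent_betti F q (kappa_complex kappa X) r s.

Lemma finite_betti_labelled (T : finType) (g : T -> V) X (r s : R) : injective g ->
    (forall j, g j \in X) -> (forall x, x \in X -> exists j, g j = x) ->
  finite_betti X r s =
  pbetti F q (labelled_complex g r) (labelled_complex g s).
Proof.
move=> ginj gX Xg.
rewrite (pbetti_labelled gX)// (_ : [set x | _]%SET = [set: _]%SET) ?full_subcomplexT//.
apply/finset.setP => x; rewrite !inE; apply/existsP.
by have [j <-] := Xg _ (valP x); exists j.
Qed.

Lemma finite_betti_translate x X (r s : R) :
  finite_betti (fset_translate x X) r s = finite_betti X r s.
Proof.
pose g (y : X) := val y + x.
have ginj : injective g by move=> y z /addIr /val_inj.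
rewrite (finite_betti_labelled (g := g)) //; first last.
- by move=> y /imfsetP[/= z zX ->]; exists [` zX]%fset.
- by move=> j; apply/imfsetP; exists (val j); rewrite //=; exact: valP.
suff gE t : labelled_complex g t = kappa_complex kappa X t by rewrite !gE.
apply/finset.setP => J; rewrite !inE; case: eqVneq => //= J0.
rewrite -(kappa_translation kappaP x (s := [fsetval v in J]%fset)).
  congr (kappa _ <= _)%E; apply/fsetP => y; apply/imfsetP/imfsetP => -[/= z].
    by move=> zJ ->; exists (val z); rewrite //= in_imfset.
  by move=> /imfsetP[/= w wJ ->] ->; exists w.
have /finset.set0Pn[v vJ] := J0.
by apply/fset0Pn; exists (val v); rewrite in_imfset.
Qed.

Lemma finite_betti_sub X Y (r s : R) : (Y `<=` X)%fset ->
  let YX := [set x : X | val x \in Y]%SET in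
  finite_betti Y r s = pbetti F q (full_subcomplex (kappa_complex kappa X r) YX)
             (full_subcomplex (kappa_complex kappa X s) YX).
Proof.
move=> YX /=; have gX (j : Y) : val j \in X by apply: (fsubsetP YX); exact: valP.
rewrite [LHS](pbetti_labelled gX); last exact: val_inj.
rewrite (_ : [set x : X | [exists j : Y, _]]%SET = [set x : X | val x \in Y]%SET)//.
apply/finset.setP => x; rewrite !inE; apply/existsP/idP.
  by move=> [j /eqP <-]; exact: valP.
by move=> xY; exists [` xY]%fset.
Qed.

(* The simplices that could enter a q-cycle or a q-boundary of the filtration up
   to s and do not have all their vertices in one of the [Y i]. *)
Definition crossing (I : finType) (Y : I -> {fset V}) X (s : R) : {set {set X}} :=
  [set J in kappa_complex kappa X s |
     ((#|J| == q.+1) || (#|J| == q.+2)) &&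
     ~~ [exists i, J \subset [set x : X | val x \in Y i]%SET]]%SET.

(** The intermediate complexes consist of the simplices contained in some [Y i]: on them the number
    is additive, and [pbetti_diff] bounds the effect of restoring the others. *)
Lemma finite_betti_near_additive (I : finType) (Y : I -> {fset V}) X (r s : R) :
    r <= s -> (forall i, (Y i `<=` X)%fset) ->
    (forall i j x, x \in Y i -> x \in Y j -> i = j) ->
  (finite_betti X r s <= \sum_i finite_betti (Y i) r s + #|crossing Y X s|)%N /\
  (\sum_i finite_betti (Y i) r s <= finite_betti X r s + #|crossing Y X s|)%N.
Proof.
move=> rs YX dY; pose YX_ i := [set x : X | val x \in Y i]%SET.
rewrite (eq_bigr (fun i => pbetti F q (full_subcomplex (kappa_complex kappa X r) (YX_ i))
             (full_subcomplex (kappa_complex kappa X s) (YX_ i)))); last first.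
  by move=> i _; exact: finite_betti_sub.
rewrite -pbetti_full_subcomplex; last first.
  by move=> i j x; rewrite !inE; exact: dY.
apply: pbetti_diff.
- by apply/fintype.subsetP => J; rewrite inE => /andP[].
- by apply/fintype.subsetP => J; rewrite inE => /andP[].
(* The cardinalities q + 1 and q + 2 make the two families disjoint, so together they count no more
   than [crossing]. *)
rewrite -cardsUI [X in (_ + X)%N](_ : _ = 0%N) ?addn0; last first.
  apply/eqP; rewrite cards_eq0; apply/eqP/finset.setP => J; rewrite !inE.
  by case: (#|J| =P q.+1) => [->|_]; rewrite ?andbF//= -[q.+1 == q.+2]/(q == q.+1) eqn_leq ltnn !andbF.
apply: subset_leq_card; apply/fintype.subsetP => J; rewrite !inE.
have [J0|//] := boolP (J != _); rewrite /=.
have [Jr|Jr] := boolP (kappa _ <= r%:E)%E; rewrite /=.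
  rewrite (le_trans Jr) ?lee_fin//=.
  by case: [exists _, _] => //=; rewrite ?andbF//= !andbT.
case: (kappa _ <= s%:E)%E => //=; case: [exists _, _]; rewrite //= ?andbF//.
by move=> ->; rewrite orbT.
Qed.

End finite_point_sets.

(** * Boxes and grids *)

Section integer_boxes.
Context (N : nat).
Local Notation Z := 'rV[int]_N.

Definition ibox_point (a : Z) n (y : {ffun 'I_N -> 'I_n}) : Z :=
  \row_i (a ord0 i + (y i)%:Z).

Definition ibox (a : Z) (n : nat) : {fset Z} :=
  [fset ibox_point a y | y in {ffun 'I_N -> 'I_n}]%fset.

Lemma in_ibox (a : Z) n (z : Z) :
  reflect (forall i, a ord0 i <= z ord0 i < a ord0 i + n%:Z) (z \in ibox a n).
Proof.
apply: (iffP (imfsetP _ _ _ _)) => /= [[y _ ->] i|H].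
  by rewrite mxE; have := ltn_ord (y i); lia.
have lt_i i : (absz (z ord0 i - a ord0 i)%R < n)%N by have := H i; lia.
exists [ffun i => Ordinal (lt_i i)] => //.
apply/rowP => i; rewrite mxE ffunE /= gez0_abs; first by rewrite addrC subrK.
by rewrite subr_ge0; case/andP: (H i).
Qed.

Let ibox_inj a n :
  injective (@ibox_point a n).
Proof.
move=> y y' /rowP e; apply/ffunP => i; apply/val_inj; have := e i.
by rewrite !mxE => /addrI [].
Qed.

Lemma card_ibox a n : #|` ibox a n| = (n ^ N)%N.
Proof.
rewrite card_imfset /=; last exact: ibox_inj.
by rewrite -cardE card_ffun !card_ord.
Qed.

Lemma ibox_translate (a b : Z) n : ibox (a + b) n = [fset (z + b)%R | z in ibox a n]%fset.
Proof.
apply/fsetP => z; apply/in_ibox/imfsetP => /= [H|[w /in_ibox H -> i]].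
  exists (z - b); last by rewrite subrK.
  apply/in_ibox => i; have := H i; rewrite !mxE. by rewrite lerBrDr ltrBlDr [_ + n%:Z + _]addrAC.
by have := H i; rewrite !mxE [_ + _ + n%:Z]addrAC lerD2r ltrD2r.
Qed.

Lemma sum_ibox_translate (M : nmodType) (f : Z -> M) (a b : Z) n :
  \sum_(z <- ibox (a + b) n) f z = \sum_(z <- ibox a n) f (z + b).
Proof.
rewrite ibox_translate big_imfset //= => x y _ _; exact: addIr.
Qed.

End integer_boxes.

Section borel_sets.
Context (R : realType) (N : nat).
Local Notation V := 'rV[R]_N.
Local Notation Z := 'rV[int]_N.

Lemma measurable_coord i : measurable_fun [set: V] (fun x : V => x ord0 i).
Proof.
apply: (@measurability _ _ V R setT _ (@RGenOInfty.G R)); first exact: RGenOInfty.measurableE.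
move=> _ [_ [a ->] <-]; rewrite setTI; apply: sub_sigma_algebra.
by apply: open_comp => [x _|]; [exact: coord_continuous|exact: interval_open].
Qed.

Lemma measurable_forall d (T : measurableType d) (I : finType) (P : I -> set T) :
  (forall i, measurable (P i)) -> measurable [set x | forall i, P i x].
Proof.
move=> mP; rewrite (_ : [set x | _] = \bigcap_(i in [set: I]) P i).
  exact: fin_bigcap_measurable.
by apply/seteqP; split => x /= Px i //; exact: (Px i).
Qed.

Lemma measurable_bool d (T : measurableType d) (p : T -> bool) :
  measurable_fun setT p -> measurable [set x | p x].
Proof.
by move=> mp; rewrite -[X in measurable X]setTI; exact: (mp measurableT [set true]).
Qed.

Lemma measurable_half_open (f g : R) i (c : R) :
  measurable [set x : V | f <= c * x ord0 i < g].
Proof.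
apply: measurable_bool; apply: measurable_and.
  apply: measurable_fun_ler => //; apply: measurable_funM => //.
  exact: measurable_coord.
apply: measurable_fun_ltr => //; apply: measurable_funM => //.
exact: measurable_coord.
Qed.

Definition rbox (a : V) (l : R) : set V :=
  [set x | forall i, a ord0 i <= x ord0 i < a ord0 i + l].

Lemma measurable_rbox a l : measurable (rbox a l).
Proof.
apply: measurable_forall => i.
have := measurable_half_open (a ord0 i) (a ord0 i + l) i 1.
by congr (measurable _); apply/seteqP; split => x /=; rewrite mul1r.
Qed.

Definition coord_bounded (A : set V) :=
  exists m : nat, forall x, A x -> forall i, `|x ord0 i| <= m%:R.

Lemma coord_bounded_bounded A : coord_bounded A -> bounded_set A.
Proof.
move=> [m Am]; exists m%:R; split; first exact: num_real.
move=> y my x /Am xm; apply: le_trans (ltW my).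
rewrite -[leLHS]/(mx_norm x) mx_normrE; apply/bigmax_leP; split => // -[i j] _ /=.
by rewrite ord1.
Qed.

Lemma rbox_coord_bounded a l : coord_bounded (rbox a l).
Proof.
exists (Num.truncn (\sum_i `|a ord0 i| + `|l|)).+1 => x ax i; apply: ltW.
apply: le_lt_trans (truncnS_gt _).
have := ax i; have : `|a ord0 i| <= \sum_i `|a ord0 i|.
  by rewrite (bigD1 i) //= lerDl sumr_ge0.
set S := \sum_i _; move=> aS /andP[h1 h2].
have := ler_norm l; have := ler_norm (a ord0 i); have := ler_norm (- a ord0 i).
rewrite normrN ler_norml; lra.
Qed.

Lemma coord_boundedS A B : A `<=` B -> coord_bounded B -> coord_bounded A.
Proof. by move=> AB [m Bm]; exists m => x /AB /Bm. Qed.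

(** The mesh is 1/(n+1), so [cell 0 z] is the unit cube at z and every n gives a genuine grid.
    Half-open cells make the index of a point unique. *)
Definition cell n (z : Z) : set V :=
  [set x | forall i, (z ord0 i)%:~R <= n.+1%:R * x ord0 i < (z ord0 i + 1)%:~R].

Definition cell_index n (x : V) : Z := \row_i Num.floor (n.+1%:R * x ord0 i).

Lemma cell_indexP n x z : reflect (cell n z x) (z == cell_index n x).
Proof.
apply: (iffP eqP) => [-> i|zx]; first by rewrite mxE floor_itv.
by apply/rowP => i; rewrite mxE; apply/esym/eqP; rewrite floor_eq.
Qed.

Lemma measurable_cell n z : measurable (cell n z).
Proof. by apply: measurable_forall => i; exact: measurable_half_open. Qed.

Lemma cell_near n z x y : cell n z x -> cell n z y ->
  forall i, `|x ord0 i - y ord0 i| < n.+1%:R^-1.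
Proof.
move=> zx zy i; have /andP[x1 x2] := zx i; have /andP[y1 y2] := zy i.
have n0 : 0 < n.+1%:R :> R by rewrite ltr0n.
rewrite -(ltr_pM2l n0) divff ?gt_eqF// -{1}(ger0_norm (ltW n0)) -normrM mulrBr.
by rewrite ltr_norml; move: x1 x2 y1 y2; rewrite rmorphD /=; lra.
Qed.

Lemma coord_bounded_cells A n : coord_bounded A ->
  exists J : {fset Z}, forall x, A x -> cell_index n x \in J.
Proof.
move=> [m Am]; exists (ibox (const_mx (- (n.+1 * m)%N%:Z)) (2 * (n.+1 * m)).+1).
move=> x /Am xm; apply/in_ibox => i; rewrite !mxE; have := xm i.
rewrite ler_norml => /andP[m1 m2]; rewrite floor_ge_int floor_lt_int.
have n0 : 0 <= n.+1%:R :> R by rewrite ler0n.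
have h1 := ler_wpM2l n0 m1; have h2 := ler_wpM2l n0 m2.
have E : (n.+1 * m)%N%:Z%:~R = n.+1%:R * m%:R :> R by rewrite -natrM.
rewrite rmorphN /= E; apply/andP; split; first by rewrite -mulrN.
rewrite rmorphD rmorphN /= E -[X in _ + X]/((2 * (n.+1 * m)).+1%:R).
have E2 : (2 * (n.+1 * m)).+1%:R = 2 * (n.+1%:R * m%:R) + 1 :> R by rewrite -[LHS]natr1 !natrM.
rewrite E2; move: h1 h2; set u := _ * x ord0 i; set v := n.+1%:R * m%:R; lra.
Qed.

End borel_sets.

(** * Measurability of functions of the atoms *)

Section atoms.
Context (R : realType) (N : nat).
Local Notation V := 'rV[R]_N.
Local Notation Z := 'rV[int]_N.
Local Notation M := (int_radon R N).
Implicit Types (mu : M) (A B : set V).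

Lemma measurable_eval A : measurable A ->
  measurable_fun [set: M] (fun mu : M => mu A : \bar R).
Proof.
move=> mA _ Y mY; rewrite setTI; apply: sub_sigma_algebra.
by exists A => //; exists Y => //; rewrite setTI.
Qed.

Lemma measurable_row1 (x : V) : measurable [set x].
Proof.
have -> : [set x] = [set y : V | forall i, y ord0 i == x ord0 i].
  apply/seteqP; split => [y -> //|y /= yx]; apply/rowP => i.
  exact/eqP/yx.
apply: measurable_forall => i; apply: measurable_bool; apply: measurable_fun_eqr => //.
exact: measurable_coord.
Qed.

Lemma int_radon_ge1 mu A : measurable A -> (0 < mu A)%E -> (1 <= mu A)%E.
Proof.
move=> mA; have [->|[k ->]] := int_radon_int mu mA; first by rewrite leey.
by rewrite lte_fin lee_fin ltr0n ler1n.
Qed.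

Lemma int_radon_fin mu A : measurable A -> coord_bounded A -> (mu A < +oo)%E.
Proof.
move=> mA [m Am]; pose C : set V := [set x | `|x| <= m%:R].
have cC : compact C.
  apply: bounded_closed_compact.
    by exists m%:R; split; [exact: num_real|move=> r /ltW mr x /le_trans; exact].
  by apply: (preimage_closed (f := fun x : V => `|x|) (D := [set y | y <= m%:R]));
    [move=> x _; exact: norm_continuous|exact: closed_le].
have mC : measurable C.
  rewrite -[C]setCK; apply: measurableC; apply: sub_sigma_algebra.
  by apply: closed_openC; apply: compact_closed => //; exact: norm_hausdorff.
apply: le_lt_trans (int_radon_compact mu cC).
apply: le_measure; rewrite ?inE// => x /Am xm.
rewrite /C /= -[leLHS]/(mx_norm x) mx_normrE; apply/bigmax_leP; split => // -[i j] _ /=.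
by rewrite ord1.
Qed.

Let cell_step mu B n : measurable B -> coord_bounded B -> (0 < mu B)%E ->
  exists z, (0 < mu (B `&` cell n z))%E.
Proof.
move=> mB bB; apply: contraPP => /forallNP H.
have {}H z : mu (B `&` cell n z) = 0%E.
  by apply/eqP; rewrite eq_le measure_ge0 andbT leNgt; exact/negP/H.
have [J BJ] := coord_bounded_cells n bB.
apply/negP; rewrite -leNgt.
apply: (@le_trans _ _ (\sum_(z \in [set` J]) mu (B `&` cell n z))%E).
  apply: content_sub_fsum => //.
    by move=> z _; apply: measurableI => //; exact: measurable_cell.
  by move=> x Bx; exists (cell_index n x); [exact: BJ|split => //; apply/cell_indexP].
by rewrite fsbig1.
Qed.

(** Integrality excludes diffuse mass: a nested sequence of charged cells has masses at least 1,
    hence so has its intersection by continuity from above, and shrinking meshes leave a single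
    point there. *)
Lemma atom_exists mu A : measurable A -> coord_bounded A -> (0 < mu A)%E ->
  exists2 x, A x & (0 < mu [set x])%E.
Proof.
move=> mA bA muA.
pose next n B := B `&` cell n (xget 0 [set z | (0 < mu (B `&` cell n z))%E]).
pose B_ := fix F n := if n is n'.+1 then next n' (F n') else A.
have sub n : B_ n `<=` A by elim: n => // n IH x [/IH].
have mB n : measurable (B_ n).
  by elim: n => // n IH; apply: measurableI => //; exact: measurable_cell.
have B0 n : (0 < mu (B_ n))%E.
  elim: n => // n IH; rewrite /= /next; case: xgetP => [z -> //|nex].
  have [z zB] := cell_step n (mB n) (coord_boundedS (sub n) bA) IH.
  by have := nex z.
have noninc : nonincreasing_seq B_.
  by apply/nonincreasing_seqP => n; apply/subsetPset => x [].
have mC : measurable (\bigcap_n B_ n) by exact: bigcapT_measurable.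
have cvgB := nonincreasing_cvg_mu (int_radon_fin mu mA bA) mB mC noninc.
have muC : (1 <= mu (\bigcap_n B_ n))%E.
  rewrite -(cvg_lim _ cvgB)//; apply: lime_ge; first by apply/cvg_ex; eexists; exact: cvgB.
  by apply: nearW => n; apply: int_radon_ge1.
have [x Cx] : exists x, (\bigcap_n B_ n) x.
  apply: contrapT => /forallNP nC; move: muC.
  rewrite (_ : \bigcap_n B_ n = set0) ?measure0 ?lee_fin ?ler10//.
  by apply/seteqP; split => // x /nC.
exists x; first exact: (Cx 0%N).
rewrite -(_ : \bigcap_n B_ n = [set x]) ?(lt_le_trans _ muC)//.
apply/seteqP; split => [y Cy|_ ->//]; apply/rowP => i; apply/eqP.
rewrite -subr_eq0 -normr_le0; apply/ler_addgt0Pl => e e0; rewrite addr0.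
have [n ne] : exists n, n.+1%:R^-1 < e.
  exists (Num.truncn e^-1); rewrite -[ltRHS]invrK ltf_pV2 ?posrE ?invr_gt0 ?ltr0n//.
  exact: truncnS_gt.
apply: ltW (lt_trans _ ne).
by have [_ xn] := Cx n.+1 I; have [_ yn] := Cy n.+1 I; exact: cell_near yn xn i.
Qed.

Lemma in_points mu A x : coord_bounded A ->
  reflect (A x /\ (0 < mu [set x])%E) (x \in points mu A).
Proof.
move=> bA; rewrite /points in_fset_set ?inE; first exact: asboolP.
exact/finite_atoms/coord_bounded_bounded.
Qed.

(** Each atom has mass at least 1. This is how the moments of the process control the number of
    points. *)
Lemma card_points_le mu A : measurable A -> coord_bounded A ->
  ((#|` points mu A|%:R)%:E <= mu A)%E.
Proof.
move=> mA bA; set X := points mu A.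
have Xmu x : x \in X -> (1 <= mu [set x])%E.
  by move=> /(in_points _ _ bA)[_ x0]; apply: int_radon_ge1 => //; exact: measurable_row1.
have muX : mu [set` X] = (\sum_(x <- X) mu [set x])%E.
  rewrite -(image_id [set` X]) -bigcup_imset1 measure_fin_bigcup //; last first.
  - by move=> x _; exact: measurable_row1.
  - by move=> x y _ _ [z [/= -> ->]].
  by rewrite fsbig_finite //= set_fsetK.
have mX : measurable [set` X].
  rewrite -(image_id [set` X]) -bigcup_imset1.
  by apply: fin_bigcup_measurable => // x _; exact: measurable_row1.
apply: (@le_trans _ _ (mu [set` X])); last first.
  by apply: le_measure; rewrite ?inE// => x /= /(in_points _ _ bA)[].
rewrite muX; apply: (@le_trans _ _ (\sum_(x <- X) 1%:E)%E).
  by rewrite sumEFin lee_fin big_const_seq count_predT iter_addr_0.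
by rewrite !big_seq; apply: lee_sum => x xX; exact: Xmu.
Qed.

Let separating (X : {fset V}) : exists n, {in X &, injective (@cell_index R N n)}.
Proof.
have [m Hm] : exists m : nat, forall x y, x \in X -> y \in X -> x != y ->
    exists i, m.+1%:R^-1 <= `|x ord0 i - y ord0 i|.
  pose S := \sum_(x <- X) \sum_(y <- X) (\sum_(i < N) (`|x ord0 i - y ord0 i|)^-1) : R.
  exists (Num.truncn S) => x y xX yX xy.
  have [i xyi] : exists i, x ord0 i != y ord0 i.
    apply/existsP; apply: contraNT xy => /existsPn H; apply/eqP/rowP => i.
    by apply/eqP; rewrite -[_ == _]negbK; exact: H.
  exists i; rewrite -[leRHS]invrK lef_pV2 ?posrE ?ltr0n//; last first.
    by rewrite invr_gt0 normr_gt0 subr_eq0.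
  apply: ltW (le_lt_trans _ (truncnS_gt _)).
  rewrite /S (big_fsetD1 x) //= (big_fsetD1 y yX) /= (bigD1 i) //= -!addrA lerDl.
  by rewrite !addr_ge0// ?sumr_ge0// => *; rewrite ?sumr_ge0// => *; rewrite ?sumr_ge0// ?invr_ge0.
exists m => x y xX yX xy; apply: contrapT => /eqP /(Hm _ _ xX yX)[i].
rewrite leNgt; apply/negP; rewrite negbK.
by apply: (@cell_near _ _ _ (cell_index m x)); apply/cell_indexP => //; rewrite xy.
Qed.

Lemma measurable_sumn d (T : measurableType d) (I : Type) (s : seq I) (f : I -> T -> nat) :
  (forall i, measurable_fun setT (f i)) ->
  measurable_fun setT (fun x => (\sum_(i <- s) f i x)%N).
Proof.
move=> mf; elim: s => [|i s IH].
  by under eq_fun do rewrite big_nil; exact: measurable_cst.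
by under eq_fun do rewrite big_cons; exact: measurable_fun_addn.
Qed.

Lemma measurable_nat_of_bool d (T : measurableType d) (p : T -> bool) :
  measurable_fun setT p -> measurable_fun setT (fun x => p x : nat).
Proof. by move=> mp; apply: (measurableT_comp (f := nat_of_bool)) => //. Qed.

(* The number of atoms in A is the supremum over the grids of the number of grid
   cells charged by mu inside A. *)
Lemma measurable_card_points A : measurable A -> coord_bounded A ->
  measurable_fun [set: M] (fun mu => #|` points mu A|).
Proof.
move=> mA bA; have /choice[J AJ] n := coord_bounded_cells n bA.
pose occ n mu := (\sum_(z <- J n) (0 < mu (A `&` cell n z))%E)%N.
have occE n mu : occ n mu = size [seq z <- J n | (0 < mu (A `&` cell n z))%E].
  rewrite size_filter -sum1_count [RHS]big_mkcond /=; apply: eq_bigr => z _.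
  by case: (0 < _)%E.
have mcell n z : measurable (A `&` cell n z) by apply: measurableI => //; exact: measurable_cell.
have occ_le n mu : (occ n mu <= #|` points mu A|)%N.
  rewrite occE -(size_map (cell_index n)); apply: uniq_leq_size.
    by rewrite filter_uniq ?fset_uniq.
  move=> z; rewrite mem_filter => /andP[z0 _].
  have [x [Ax zx] x0] := atom_exists (mcell n z) (coord_boundedS (@subIsetl _ _ _) bA) z0.
  apply/mapP; exists x; last by apply/eqP/cell_indexP.
  exact/in_points.
have occ_ge mu : exists n, (#|` points mu A| <= occ n mu)%N.
  have [n ninj] := separating (points mu A); exists n.
  rewrite occE -(size_map (cell_index n)); apply: uniq_leq_size.
    by rewrite map_inj_in_uniq ?fset_uniq.
  move=> _ /mapP[x /(in_points _ _ bA)[Ax x0] ->]; rewrite mem_filter AJ// andbT.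
  apply: (lt_le_trans x0); apply: le_measure; rewrite ?inE//; first exact: measurable_row1.
  by move=> _ ->; split => //; apply/cell_indexP.
have mocc n : measurable_fun [set: M] (occ n).
  apply: measurable_sumn => z; apply: measurable_nat_of_bool.
  by apply: measurable_fun_lte => //; exact: measurable_eval.
have H k : measurable [set mu | (k <= #|` points mu A|)%N].
  rewrite (_ : [set _ | _] = \bigcup_n [set mu | (k <= occ n mu)%N]).
    by apply: bigcupT_measurable => n; apply: measurable_bool; exact: measurable_fun_leq.
  apply/seteqP; split => [mu /= kA|mu [n _ /= kn]]; last exact: leq_trans kn (occ_le n mu).
  by have [n nA] := occ_ge mu; exists n => //=; exact: leq_trans nA.
move=> _ Y _; rewrite setTI.
rewrite (_ : _ @^-1` Y = \bigcup_(k in Y) ([set mu | (k <= #|` points mu A|)%N] `\`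
    [set mu | (k.+1 <= #|` points mu A|)%N])); last first.
  apply/seteqP; split => [mu /= muY|mu [k Yk [/= k1 /negP]]].
    by exists #|` points mu A| => //=; split => //; rewrite ltnn.
  by rewrite -leqNgt => k2; rewrite (_ : #|` _| = k)//; apply/eqP; rewrite eqn_leq k1 k2.
by apply: bigcup_measurable => k _; apply: measurableD.
Qed.

End atoms.

Lemma cvg_sumr (R : realType) T (H : set_system T) (FH : Filter H) (I : Type) (r : seq I)
    (f : I -> T -> R) (l : I -> R) : (forall i, f i x @[x --> H] --> l i) ->
  \sum_(i <- r) f i x @[x --> H] --> \sum_(i <- r) l i.
Proof.
move=> fl; elim: r => [|i r IH].
  by under eq_fun do rewrite big_nil; rewrite big_nil; exact: cvg_cst.
by under eq_fun do rewrite big_cons; rewrite big_cons; exact: cvgD.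
Qed.

Section measurable_betti.
Context (R : realType) (N : nat) (F : fieldType) (q : nat).
Context (kappa : {fset 'rV[R]_N} -> \bar R) (kappaP : filtration_function kappa).
Local Notation V := 'rV[R]_N.
Local Notation M := (int_radon R N).
Context (A : set V) (mA : measurable A) (bA : coord_bounded A).

Definition rectangles k : set_system (k.-tuple V) :=
  [set G | exists2 B : 'I_k -> set V, (forall i, measurable (B i)) &
    G = [set t | forall i, B i (tnth t i)]].

Lemma measurable_rectangles k : @measurable _ (k.-tuple V) = <<s @rectangles k>>.
Proof.
apply/seteqP; split.
  apply: smallest_sub; first exact: smallest_sigma_algebra.
  case: k => [|k]; first by rewrite big_ord0.
  rewrite -bigcup_mkord_ord => _ [i /= _ [B mB <-]]; apply: sub_sigma_algebra.
  exists (fun j => if j == inord i then B else setT) => [j|]; first by case: ifP.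
  rewrite setTI; apply/seteqP; split => [t Bt j /=|t /(_ (inord i))]; last by rewrite eqxx.
  by case: eqP => // ->.
apply: smallest_sub; first exact: sigma_algebra_measurable.
move=> _ [B mB ->]; apply: measurable_forall => i.
by rewrite -[X in measurable X]setTI; exact: measurable_tnth.
Qed.

Definition point_tuple mu k (u : {ffun 'I_k -> points mu A}) : k.-tuple V :=
  [tuple val (u i) | i < k].

(** Tuples may repeat atoms, so the count of a rectangle is the product of the counts of its sides.
    Real values allow the differences and limits of a Dynkin argument. *)
Definition tuple_count k (G : set (k.-tuple V)) (mu : M) : R :=
  \sum_(u : {ffun 'I_k -> points mu A}) (point_tuple u \in G)%:R.

Lemma tuple_count_rectangle k (B : 'I_k -> set V) mu :
  (forall i, measurable (B i)) ->
  tuple_count [set t | forall i, B i (tnth t i)] mu =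
  \prod_(i < k) #|` points mu (A `&` B i)|%:R.
Proof.
move=> mB; rewrite /tuple_count.
have E i : #|` points mu (A `&` B i)|%:R = \sum_(x : points mu A) (val x \in B i)%:R :> R.
  transitivity (\sum_(x <- points mu A) (x \in B i)%:R : R); last by rewrite big_seq_fsetE.
  rewrite -natr_sum; congr _%:R.
  transitivity (size [seq x <- points mu A | x \in B i]); last first.
    rewrite size_filter -sum1_count big_mkcond /=; apply: eq_bigr => x _.
    by case: (x \in B i).
  apply/perm_size/uniq_perm; rewrite ?filter_uniq ?fset_uniq// => x.
  rewrite mem_filter; apply/in_points/idP.
  - exact: coord_boundedS (@subIsetl _ _ _) bA.
  - by move=> [[Ax Bx] x0]; rewrite mem_set//=; exact/in_points.
  - by move=> /andP[/set_mem Bx /(in_points _ _ bA)[Ax x0]].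
under [RHS]eq_bigr do rewrite E.
rewrite bigA_distr_bigA /=; apply: eq_bigr => u _.
have [H|/existsNP[i H]] := pselect (forall i, B i (val (u i))).
  rewrite mem_set /=; last by move=> i; rewrite tnth_mktuple; exact: H.
  by rewrite big1// => i _; rewrite mem_set//; exact: H.
rewrite (bigD1 i)//= (memNset H) mul0r memNset //= => /(_ i).
by rewrite tnth_mktuple; exact: H.
Qed.

(** Dynkin's theorem: rectangles are stable under intersection and generate the product
    sigma-algebra. Complements are differences from the finite total; for disjoint unions the
    partial sums become constant for each measure. *)
Lemma measurable_tuple_count k G : measurable G ->
  measurable_fun [set: M] (@tuple_count k G).
Proof.
have mtT : measurable_fun [set: M] (@tuple_count k setT).
  have := @tuple_count_rectangle k (fun=> setT).
  rewrite (_ : [set t | _] = setT); last by apply/seteqP.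
  move=> H; rewrite (_ : @tuple_count k setT =
    (fun mu => \prod_(i < k) #|` points mu (A `&` setT)|%:R)); last by apply/funext => mu; exact: H.
  apply: measurable_prod => i _; apply: (measurableT_comp (f := fun n : nat => n%:R : R)) => //.
  by apply: measurable_card_points; [exact: measurableI|exact: coord_boundedS (@subIsetl _ _ _) bA].
rewrite measurable_rectangles; move: G.
apply: (@dynkin_induction _ _ (@rectangles k)
  (fun G => measurable_fun [set: M] (@tuple_count k G))).
- exact: measurable_rectangles.
- move=> _ _ [B mB ->] [C mC ->]; exists (fun i => B i `&` C i).
    by move=> i; exact: measurableI.
  by apply/seteqP; split => [t [Bt Ct] i|t BCt]; [split|split => i; case: (BCt i)].
- exact: mtT.
- move=> _ [B mB ->]; rewrite (_ : @tuple_count k _ =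
    (fun mu => \prod_(i < k) #|` points mu (A `&` B i)|%:R)); last first.
    by apply/funext => mu; exact: tuple_count_rectangle.
  apply: measurable_prod => i _; apply: (measurableT_comp (f := fun n : nat => n%:R : R)) => //.
  by apply: measurable_card_points; [exact: measurableI|exact: coord_boundedS (@subIsetl _ _ _) bA].
- move=> S mS PS; have -> : @tuple_count k (~` S) =
      (fun mu => tuple_count [set: k.-tuple V] mu - tuple_count S mu).
    apply/funext => mu; rewrite /tuple_count -sumrB; apply: eq_bigr => u _.
    rewrite in_setC in_setT; case: (_ \in S); rewrite ?subrr ?subr0//.
  by apply: measurable_funB => //; exact: mtT.
- move=> S mS tS PS.
  apply: (measurable_fun_cvg (h := fun n mu => \sum_(i < n) tuple_count (S i) mu)).
    by move=> n; apply: measurable_sum.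
  move=> mu _; rewrite /tuple_count.
  under eq_fun do rewrite exchange_big /=.
  apply: cvg_sumr => u; have [[i _ Si]|nS] := pselect ((\bigcup_i S i) (point_tuple u)).
    rewrite mem_set; last by exists i.
    apply: cvg_near_cst; exists i.+1 => // n /= ni.
    rewrite (bigD1 (Ordinal ni)) //= mem_set// big1 ?addr0// => j ji.
    rewrite memNset// => Sj; move/trivIsetP : tS => /(_ i j I I).
    rewrite eq_sym; have -> : (val j != i) = true.
      by apply: contraNneq ji => ji; apply/eqP/val_inj.
    by move=> /(_ isT)/seteqP[/(_ (point_tuple u)) + _]; apply.
  rewrite memNset//; apply: cvg_near_cst; apply: nearW => n.
  by rewrite big1// => i _; rewrite memNset// => Si; apply: nS; exists i.
Qed.

Lemma measurable_labelled_complex k t (K : {set {set 'I_k}}) :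
  measurable [set p : k.-tuple V | labelled_complex kappa (tnth p) t == K].
Proof.
have mJ (J : {set 'I_k}) :
    measurable_fun setT (fun p : k.-tuple V => J \in labelled_complex kappa (tnth p) t).
  have [->|J0] := eqVneq J finset.set0.
    by under eq_fun do rewrite inE eqxx; exact: measurable_cst.
  under eq_fun do rewrite inE J0 /=.
  apply: measurable_fun_lee => //.
  pose sub (p : k.-tuple V) : #|J|.-tuple V := map_tuple (tnth p) (enum_tuple J).
  rewrite (_ : (fun p => _) = (fun p : #|J|.-tuple V => kappa [fset y in tval p]%fset) \o sub).
    apply: measurableT_comp.
      by apply: (kappa_measurable kappaP); rewrite card_gt0.
    apply/measurable_fun_tnthP => i.
    rewrite (_ : _ \o _ = (fun p => tnth p (tnth (enum_tuple J) i))).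
      exact: measurable_tnth.
    by apply/funext => p; rewrite /= tnth_map.
  apply/funext => p /=; congr kappa; apply/fsetP => y; apply/imfsetP/imfsetP => /=.
    by move=> [j jJ ->]; exists (tnth p j) => //; rewrite /sub /= map_f// mem_enum.
  by move=> [_ /mapP[j jJ ->] ->]; exists j => //; rewrite -mem_enum.
rewrite (_ : [set p | _] = [set p : k.-tuple V | forall J : {set 'I_k},
    (J \in labelled_complex kappa (tnth p) t) == (J \in K)]).
  apply: measurable_forall => J; apply: measurable_bool.
  by apply: (measurableT_comp (f := fun b : bool => b == (J \in K))) => //; exact: mJ.
apply/seteqP; split => [p /= /eqP -> //|p /= H].
by apply/eqP/finset.setP => J; apply/eqP.
Qed.

Definition labelled_pbetti (r s : R) k (p : k.-tuple V) : nat :=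
  pbetti F q (labelled_complex kappa (tnth p) r) (labelled_complex kappa (tnth p) s).

(** There are finitely many pairs of complexes on ['I_k], and each is attained on a measurable set
    of tuples. *)
Lemma measurable_labelled_pbetti r s k j :
  measurable [set p : k.-tuple V | uniq p /\ labelled_pbetti r s p = j].
Proof.
have mu : measurable [set p : k.-tuple V | uniq p].
  rewrite (_ : [set p | _] = [set p : k.-tuple V | forall x : 'I_k * 'I_k,
     (x.1 != x.2) ==> [exists i, tnth p x.1 ord0 i != tnth p x.2 ord0 i]]).
    apply: measurable_forall => x; apply: measurable_bool.
    case: (x.1 != x.2) => /=; last exact: measurable_cst.
    have m i l : measurable_fun setT (fun p : k.-tuple V => tnth p l ord0 i).
      apply: (measurableT_comp (measurable_coord i)).
      exact: measurable_tnth.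
    apply: (measurable_fun_bool false); rewrite setTI.
    rewrite (_ : _ @^-1` _ = [set p : k.-tuple V | forall i, tnth p x.1 ord0 i == tnth p x.2 ord0 i]).
      by apply: measurable_forall => i; apply: measurable_bool; exact: measurable_fun_eqr.
    apply/seteqP; split => p /=.
      by move=> /negbT/existsPn H i; have := H i; rewrite negbK.
    by move=> H; apply/negbTE/existsPn => i; rewrite negbK; exact: H.
  apply/seteqP; split => p /=.
    move=> /tuple_uniqP pinj [i l] /=; apply/implyP; apply: contraNT => /existsPn H.
    by apply/eqP/pinj/rowP => m; have := H m; rewrite negbK => /eqP.
  move=> H; apply/tuple_uniqP => i l il; apply/eqP; apply: contraT => nil.
  by have /= := H (i, l); rewrite nil /= il => /existsP[m]; rewrite eqxx.
rewrite (_ : [set p | _] = \bigcup_(K in [set K : {set {set 'I_k}} * {set {set 'I_k}} |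
    pbetti F q K.1 K.2 = j]) ([set p : k.-tuple V | uniq p] `&`
     ([set p | labelled_complex kappa (tnth p) r == K.1] `&`
      [set p | labelled_complex kappa (tnth p) s == K.2]))); last first.
  apply/seteqP; split => [p [/= up pj]|p [[K1 K2] /= Kj [/= up [/eqP e1 /eqP e2]]]].
    exists (labelled_complex kappa (tnth p) r, labelled_complex kappa (tnth p) s) => //=.
  by split => //; rewrite /labelled_pbetti e1 e2.
apply: fin_bigcup_measurable; first exact: finite_finset.
move=> K _; apply: measurableI => //.
by apply: measurableI; exact: measurable_labelled_complex.
Qed.

(** When A contains k atoms, a k-tuple of distinct atoms enumerates all of them, and by relabelling
    invariance any such tuple computes the number. Thus the event is that, for k the number of
    atoms, some tuple counted by [tuple_count (G k)] exists. *)
Lemma measurable_finite_betti (r s : R) :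
  measurable_fun [set: M] (fun mu => finite_betti F q kappa (points mu A) r s).
Proof.
move=> _ Y _; rewrite setTI.
pose G k := [set p : k.-tuple V | uniq p /\ Y (labelled_pbetti r s p)].
have mG k : measurable (G k).
  rewrite (_ : G k = \bigcup_(j in Y) [set p : k.-tuple V | uniq p /\ labelled_pbetti r s p = j]).
    by apply: bigcup_measurable => j _; exact: measurable_labelled_pbetti.
  apply/seteqP; split => [p [up Yp]|p [j Yj [up pj]]]; last by split => //; rewrite pj.
  by exists (labelled_pbetti r s p).
rewrite (_ : _ @^-1` Y = \bigcup_k ([set mu | #|` points mu A| == k] `&`
    [set mu | 0 < tuple_count (G k) mu])).
  apply: bigcupT_measurable => k; apply: measurableI; apply: measurable_bool.
    by apply: measurable_fun_eqn => //; exact: measurable_card_points.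
  by apply: measurable_fun_ltr => //; exact: measurable_tuple_count.
apply/seteqP; split => [mu /= Ymu|mu [k _ [/= /eqP muk count0]]].
  pose k := #|` points mu A|; exists k => //; split => //=.
  have card_k : #|{: points mu A}| = k by rewrite -cardfE.
  pose u := [ffun i : 'I_k => enum_val (cast_ord (esym card_k) i) : points mu A].
  have uinj : injective u.
    by move=> i l; rewrite !ffunE => /enum_val_inj/cast_ord_inj.
  rewrite /tuple_count (bigD1 u) //= ltr_wpDr ?sumr_ge0// mem_set// /G /=.
  have pinj : injective (tnth (point_tuple u)).
    by move=> i l; rewrite !tnth_mktuple => /val_inj/uinj.
  split; first by apply/(tuple_uniqP (point_tuple u)).
  rewrite /labelled_pbetti -(finite_betti_labelled _ _ _ (X := points mu A)) //.
    by move=> i; rewrite tnth_mktuple; exact: valP.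
  move=> x xA; exists (cast_ord card_k (enum_rank [` xA]%fset)).
  by rewrite tnth_mktuple ffunE cast_ordK enum_rankK.
have [u] : exists u : {ffun 'I_k -> points mu A}, G k (point_tuple u).
  apply: contrapT => /forallNP H; move: count0; rewrite /tuple_count big1 ?ltxx// => u _.
  by rewrite memNset.
move=> [up]; have pinj : injective (tnth (point_tuple u)) by apply/tuple_uniqP.
rewrite /labelled_pbetti -(finite_betti_labelled _ _ _ (X := points mu A)) //.
  by move=> i; rewrite tnth_mktuple; exact: valP.
move=> x xA.
have uinj : injective u.
  by move=> i l il; apply: pinj; rewrite !tnth_mktuple il.
have /codomP[i xi] : [` xA]%fset \in codom u.
  by apply: inj_card_onto => //; rewrite card_ord -muk cardfE.
by exists i; rewrite tnth_mktuple -xi.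
Qed.

End measurable_betti.

(** * Translations of measures and of their atoms *)

Section translated_point_sets.
Context (R : realType) (N : nat).
Local Notation V := 'rV[R]_N.
Local Notation Z := 'rV[int]_N.
Local Notation M := (int_radon R N).
Implicit Types (mu : M) (A B : set V).

(** The sign makes observing [tau x mu] in A the same as observing mu in A + x, so averages over
    moved boxes become averages along orbits of [tau]. *)
Definition tau (x : V) (mu : M) : M := translate (- x) mu.

Definition shift_set (x : V) A : set V := [set y | A (y - x)].

Lemma tauE x mu A : tau x mu A = mu (shift_set x A).
Proof. by []. Qed.

Lemma shift_rbox x a (l : R) : shift_set x (rbox a l) = rbox (a + x) l.
Proof.
apply/seteqP; split => y H i; have := H i; rewrite !mxE; lra.
Qed.

Lemma coord_bounded_shift x A : coord_bounded A -> coord_bounded (shift_set x A).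
Proof.
move=> [m Am]; exists (m + (Num.truncn (\sum_i `|x ord0 i|)).+1)%N => y yA i.
have := Am _ yA i; rewrite !mxE natrD => yx.
rewrite -[y ord0 i](subrK (x ord0 i)) (le_trans (ler_normD _ _))// lerD//.
apply: ltW (le_lt_trans _ (truncnS_gt _)).
by rewrite (bigD1 i) //= lerDl sumr_ge0.
Qed.

Lemma shift_set1 x y : shift_set x [set y] = [set y + x].
Proof.
apply/seteqP; split => z; rewrite /shift_set /=; first by move=> <-; rewrite subrK.
by move=> ->; rewrite addrK.
Qed.

Lemma points_tau x mu A : coord_bounded A ->
  points (tau x mu) A = fset_translate (- x) (points mu (shift_set x A)).
Proof.
move=> bA; have bA' := coord_bounded_shift x bA.
apply/fsetP => y; apply/in_points/imfsetP => //=.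
  rewrite tauE shift_set1 => -[Ay y0]; exists (y + x); last by rewrite addrK.
  by apply/in_points => //; rewrite /shift_set /= addrK.
move=> [z /(in_points _ _ bA')[Az z0] ->]; split; first exact: Az.
by rewrite tauE shift_set1 subrK.
Qed.

Lemma card_points_tau x mu A : coord_bounded A ->
  #|` points (tau x mu) A| = #|` points mu (shift_set x A)|.
Proof.
move=> bA; rewrite points_tau// /fset_translate card_imfset //=; exact: addIr.
Qed.

Lemma int_radon_eq mu mu' : (forall A, mu A = mu' A) -> mu = mu'.
Proof.
case: mu mu' => [m c i] [m' c' i'] /= mm'.
have E : m = m' by apply: eq_measure; apply/funext.
by subst m'; congr IntRadon; exact: Prop_irrelevance.
Qed.

Lemma tau0 mu : tau 0 mu = mu.
Proof.
apply: int_radon_eq => A; rewrite tauE; congr (mu _).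
by apply/seteqP; split => y; rewrite /shift_set /= subr0.
Qed.

Lemma tauD x y mu : tau x (tau y mu) = tau (x + y) mu.
Proof.
apply: int_radon_eq => A; rewrite !tauE; congr (mu _).
by apply/seteqP; split => z; rewrite /shift_set /= opprD addrA addrAC.
Qed.

(** Translations are invertible, so the image in the definition of ergodicity is a preimage under
    [tau], to which invariance of the law applies. *)
Lemma translate_image x (I : set M) : translate x @` I = [set mu | I (tau x mu)].
Proof.
apply/seteqP; split => [_ [mu Imu <-]|mu Imu] /=.
  by rewrite -[translate x mu]/(translate x mu) -{2}[x]opprK -/(tau (- x) mu) tauD subrr tau0.
exists (tau x mu) => //.
by rewrite -{1}[x]opprK -/(tau (- x) _) tauD addNr tau0.
Qed.

Lemma measurable_tau x : measurable_fun [set: M] (tau x).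
Proof.
apply: (@measurability _ _ M M setT _ (@int_radon_gen R N)) => //.
move=> _ [_ [A mA [Y mY <-]] <-]; rewrite !setTI.
have := measurable_eval (measurable_shift_by (- x) measurableT mA).
by rewrite setTI => /(_ measurableT Y mY); rewrite setTI.
Qed.

End translated_point_sets.

(** * Near additivity *)

Section near_additivity.
Context (R : realType) (N : nat) (F : fieldType) (q : nat).
Context (kappa : {fset 'rV[R]_N} -> \bar R) (kappaP : filtration_function kappa).
Local Notation V := 'rV[R]_N.
Local Notation Z := 'rV[int]_N.
Local Notation M := (int_radon R N).
Implicit Types (mu : M) (A B : set V).
Context (r s : R) (rs : r <= s).

Definition betti mu A : R := (finite_betti F q kappa (points mu A) r s)%:R.

Lemma betti_ge0 mu A : 0 <= betti mu A.
Proof. exact: ler0n. Qed.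

Lemma betti_tau x mu A : coord_bounded A -> betti (tau x mu) A = betti mu (shift_set x A).
Proof. by move=> bA; rewrite /betti points_tau// finite_betti_translate. Qed.

Lemma measurable_betti A : measurable A -> coord_bounded A ->
  measurable_fun [set: M] (betti ^~ A).
Proof.
move=> mA bA; apply: (measurableT_comp (f := fun n : nat => n%:R : R)) => //.
exact: measurable_finite_betti.
Qed.

(** The Euclidean norm dominates each coordinate. A positive integer range fits the unit cubes and
    lets [2 * R0 <= m] imply that m is positive. *)
Lemma kappa_range : 0 <= s -> exists R0 : nat, (0 < R0)%N /\
  forall x y : V, (kappa [fset x; y]%fset <= s%:E)%E -> forall i, `|x ord0 i - y ord0 i| <= R0%:R.
Proof.
move=> s0; have [rho [_ rho_mono rho_fin rhoP]] := kappa_diameter kappaP.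
have [c rhoc] : exists c : R, (rho s%:E <= c%:E)%E.
  have := rho_fin s%:E; rewrite lee_fin s0 ltry => /(_ isT isT).
  by case: (rho s%:E) => [c _|//|_]; [exists c|exists 0; rewrite leNye].
exists (Num.truncn c).+1; split => // x y xys i.
have := rhoP x y; have k0 : (0 <= kappa [fset x; y]%fset)%E.
  by apply: (kappa_ge0 kappaP); apply/fset0Pn; exists x; rewrite !inE eqxx.
move=> /le_trans /(_ (rho_mono _ _ k0 xys)) /le_trans /(_ rhoc); rewrite lee_fin => nc.
apply: ltW (le_lt_trans _ (truncnS_gt _)); apply: le_trans nc.
rewrite /euclidean_norm -sqrtr_sqr ler_sqrt ?sumr_ge0//; last first.
  by move=> j _; exact: sqr_ge0.
by rewrite (bigD1 i) //= !mxE lerDl sumr_ge0// => j _; exact: sqr_ge0.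
Qed.

Context (R0 : nat) (R0_gt0 : (0 < R0)%N).
Context (R0P : forall x y : V, (kappa [fset x; y]%fset <= s%:E)%E ->
  forall i, `|x ord0 i - y ord0 i| <= R0%:R).

Definition real_row (z : Z) : V := map_mx intr z.

(* The R0-neighbourhood of the unit cube [z, z + 1)^N. *)
Definition block (z : Z) : set V := rbox (real_row z - const_mx R0%:R) (2 * R0 + 1)%:R.

(* Bounds the number of simplices in the degrees q and q + 1 with a vertex in
   the unit cube at z. *)
Definition cost mu (z : Z) : R := 2 * (#|` points mu (block z)|)%:R ^+ q.+2.

Lemma cost_tau mu z : cost mu z = cost (tau (real_row z) mu) 0.
Proof.
rewrite /cost card_points_tau; last exact: rbox_coord_bounded.
suff -> : shift_set (real_row z) (block 0) = block z by [].
rewrite /block shift_rbox; apply: (f_equal (fun a => rbox a _)).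
by apply/rowP => i; rewrite !mxE rmorph0 add0r addrC.
Qed.

Let card_small_subsets (T : finType) (A : {set T}) :
  (#|[set J : {set T} | (J \subset A) && ((#|J| == q.+1) || (#|J| == q.+2))]%SET|
   <= 2 * #|A| ^ q.+2)%N.
Proof.
have [/eqP A0|A0] := posnP #|A|.
  rewrite (_ : [set J | _]%SET = finset.set0) ?cards0//; apply/finset.setP => J; rewrite !inE.
  apply/negbTE/negP => /andP[/subset_leq_card]; rewrite (eqP A0) leqn0 => /eqP -> /orP[] //.
have le_bin k : (#|[set J : {set T} | (J \subset A) && (#|J| == k)]%SET| <= #|A| ^ k)%N.
  rewrite cards_draws; apply: leq_trans (_ : 'C(#|A|, k) * k`! <= _)%N.
    by rewrite leq_pmulr// fact_gt0.
  rewrite bin_ffact; elim: k #|A| => // k IH [|n]; first by rewrite ffact0n.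
  rewrite ffactnS expnS /= leq_mul// (leq_trans (IH n))//.
  by case: (k) => // k'; rewrite leq_exp2r.
(* As A is nonempty here, both counts are at most [#|A| ^ q.+2]; hence the factor 2 in [cost]. *)
rewrite mul2n -addnn; apply: (@leq_trans (#|A| ^ q.+1 + #|A| ^ q.+2)); last first.
  by rewrite leq_add2r leq_pexp2l.
apply: leq_trans (leq_add (le_bin q.+1) (le_bin q.+2)).
rewrite -cardsUI (leq_trans _ (leq_addr _ _))//; apply: subset_leq_card.
by apply/fintype.subsetP => J; rewrite !inE => /andP[->].
Qed.

(** Charge a crossing simplex to the unit cube of one of its vertices. All its vertices lie in the
    block of that cube; if the cube were not in S, they would all lie in one [B i] and the simplex
    would not cross. *)
Lemma near_additive mu A (I : finType) (B : I -> set V) (S : {fset Z}) :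
    coord_bounded A -> (forall i, B i `<=` A) ->
    (forall i j x, B i x -> B j x -> i = j) ->
    (forall x, A x -> cell_index 0 x \in S \/
       exists i, forall y, A y -> block (cell_index 0 x) y -> B i y) ->
  `|betti mu A - \sum_i betti mu (B i)| <= \sum_(z <- S) cost mu z.
Proof.
move=> bA BA dB AS; set X := points mu A.
have bB i := coord_boundedS (BA i) bA.
pose Y i := points mu (B i).
have YX i : (Y i `<=` X)%fset.
  by apply/fsubsetP => x /(in_points _ _ (bB i))[/BA Ax x0]; exact/in_points.
have dY i j x : x \in Y i -> x \in Y j -> i = j.
  by move=> /(in_points _ _ (bB i))[+ _] /(in_points _ _ (bB j))[+ _]; exact: dB.
have [h1 h2] := finite_betti_near_additive F q kappa rs YX dY.
suff : (#|crossing q kappa Y X s|%:R : R) <= \sum_(z <- S) cost mu z.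
  apply: le_trans; rewrite /betti -natr_sum -/X.
  move: h1 h2; rewrite -!(ler_nat R) !natrD ler_norml => h1 h2.
  by rewrite lerBlDl h1 lerBrDl lerBlDr h2.
pose Xz (z : Z) := [set x : X | val x \in points mu (block z)]%SET.
pose D (z : Z) := [set J : {set X} | (J \subset Xz z) &&
   ((#|J| == q.+1) || (#|J| == q.+2))]%SET.
have cardD z : (#|D z|%:R : R) <= cost mu z.
  rewrite /cost -natrX -natrM ler_nat (leq_trans (card_small_subsets _))//.
  rewrite leq_mul2l leq_exp2r//=.
  rewrite cardE -(size_map val) uniq_leq_size//.
    by rewrite map_inj_uniq ?enum_uniq//; exact: val_inj.
  by move=> _ /mapP[x + ->]; rewrite mem_enum inE.
apply: (@le_trans _ _ (\sum_(z <- S) #|D z|%:R)); last by apply: ler_sum => z _.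
rewrite -natr_sum ler_nat -sum1_card.
apply: (@leq_trans (\sum_(J in crossing q kappa Y X s) \sum_(z <- S) (J \in D z))).
  apply: leq_sum => J; rewrite !inE => /andP[/andP[J0 Js] /andP[Jq nJ]].
  have [z zS zJ] : exists2 z, z \in S & J \in D z.
    have /finset.set0Pn[v vJ] := J0.
    have /(in_points _ _ bA)[Av _] : val v \in X by exact: valP.
    have near y : y \in J -> A (val y) /\ block (cell_index 0 (val v)) (val y).
      move=> yJ; have /(in_points _ _ bA)[Ay _] : val y \in X by exact: valP.
      split => // i; rewrite !mxE.
      have /R0P/(_ i) : (kappa [fset val v; val y]%fset <= s%:E)%E.
        apply: le_trans Js; apply: (kappa_monotone kappaP).
          by apply/fset0Pn; exists (val v); rewrite !inE eqxx.
        by apply/fsubsetP => w; rewrite !inE => /orP[]/eqP ->; rewrite in_imfset.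
      have /andP[] := floor_itv (1%:R * val v ord0 i).
      rewrite !mul1r ler_norml rmorphD /=.
      set f := (Num.floor _)%:~R; set a := val v ord0 i; set b := val y ord0 i.
      by rewrite natrD natrM => f1 f2 /andP[g1 g2]; lra.
    have [zS|[i Bi]] := AS _ Av; last first.
      case/negP: nJ; apply/existsP; exists i; apply/fintype.subsetP => y yJ; rewrite inE.
      have [Ay By] := near _ yJ; apply/in_points => //; split; first exact: Bi.
      by have /(in_points _ _ bA)[] : val y \in X by exact: valP.
    exists (cell_index 0 (val v)) => //; rewrite inE Jq andbT.
    apply/fintype.subsetP => y yJ; rewrite inE; have [Ay By] := near _ yJ.
    apply/in_points; first exact: rbox_coord_bounded.
    by split => //; have /(in_points _ _ bA)[] : val y \in X by exact: valP.
  by rewrite (big_fsetD1 z) //= zJ.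
rewrite exchange_big /=; apply: leq_sum => z _.
rewrite -big_mkcondr /= sum1dep_card; apply: subset_leq_card.
by apply/fintype.subsetP => J; rewrite inE => /andP[].
Qed.

End near_additivity.

Section grids.
Context (R : realType) (N : nat) (F : fieldType) (q : nat).
Context (kappa : {fset 'rV[R]_N} -> \bar R) (kappaP : filtration_function kappa).
Local Notation V := 'rV[R]_N.
Local Notation Z := 'rV[int]_N.
Context (r s : R) (rs : r <= s) (R0 : nat) (R0_gt0 : (0 < R0)%N).
Context (R0P : forall x y : V, (kappa [fset x; y]%fset <= s%:E)%E ->
  forall i, `|x ord0 i - y ord0 i| <= R0%:R).
Local Notation betti := (betti F q kappa r s).
Local Notation cost := (cost q R0).

Definition grid_box (m : nat) (g : Z) : set V := rbox (real_row R (m%:Z *: g)) m%:R.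

(** The unit cubes whose R0-neighbourhood stays inside one grid box: per coordinate, R0 cubes are
    dropped at both ends. The natural subtraction is truncated, whence the hypothesis [2 * R0 <= m]
    below. *)
Definition deep_cubes (c : Z) k m : seq Z :=
  [seq m%:Z *: g + const_mx R0%:Z + w | g <- ibox c k, w <- ibox (0 : Z) (m - 2 * R0)].

(* The unit cubes of [e, e + t)^N that are at distance less than R0 from the
   complement of all the boxes of the m-grid indexed by [c, c + k)^N. *)
Definition shell c k m e t : {fset Z} :=
  [fset z in ibox e t | z \notin deep_cubes c k m]%fset.

Lemma grid_inj (m : nat) (g g' u : Z) (lo : int) : (0 <= lo) ->
  (forall i, m%:Z * g ord0 i + lo <= u ord0 i < m%:Z * g ord0 i + m%:Z) ->
  (forall i, m%:Z * g' ord0 i + lo <= u ord0 i < m%:Z * g' ord0 i + m%:Z) -> g = g'.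
Proof.
move=> lo0 H H'; apply/rowP => i; have := H i; have := H' i.
move: (g ord0 i) (g' ord0 i) (u ord0 i) => a b x; nia.
Qed.

Lemma deep_cubesP (c : Z) k m z : (2 * R0 <= m)%N -> z \in deep_cubes c k m ->
  exists2 g, g \in ibox c k & forall i,
    m%:Z * g ord0 i + R0%:Z <= z ord0 i < m%:Z * g ord0 i + m%:Z - R0%:Z.
Proof.
move=> Rm /allpairsP[[g w] /= [gc /in_ibox wm ->]]; exists g => // i.
have := wm i; rewrite !mxE; move: (g ord0 i) (w ord0 i) => a b; nia.
Qed.

Lemma size_deep_cubes c k m : size (deep_cubes c k m) = (k ^ N * (m - 2 * R0) ^ N)%N.
Proof. by rewrite size_allpairs; congr (_ * _)%N; exact: card_ibox. Qed.

Lemma uniq_deep_cubes c k m : (2 * R0 <= m)%N -> uniq (deep_cubes c k m).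
Proof.
move=> Rm; apply: allpairs_uniq; rewrite ?fset_uniq// => -[g w] [g' w'].
move=> /allpairsP[[a b] /= [_ /in_ibox H] [-> ->]] /allpairsP[[a' b'] /= [_ /in_ibox H'] [-> ->]] E.
have aa' : a = a'.
  apply: (@grid_inj m _ _ (m%:Z *: a + const_mx R0%:Z + b) 0) => // i.
    have := H i; rewrite !mxE; move: (a ord0 i) (b ord0 i) => x y; nia.
  have := H' i; rewrite E !mxE; move: (a' ord0 i) (b' ord0 i) => x y; nia.
by move: E; rewrite aa' => /addrI ->.
Qed.

Lemma mem_real_box_cell (a : Z) (n : nat) (x : V) :
  rbox (real_row R a) n%:R x <-> forall i, a ord0 i <= (cell_index 0 x) ord0 i < a ord0 i + n%:Z.
Proof.
split=> H i; have := H i; rewrite !mxE mul1r floor_ge_int floor_lt_int rmorphD//=.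
Qed.

Lemma near_additive_grid mu A (c e : Z) (k m t : nat) : (2 * R0 <= m)%N ->
    coord_bounded A ->
    (forall g, g \in ibox c k -> grid_box m g `<=` A) ->
    (forall x, A x -> cell_index 0 x \in ibox e t) ->
  `|betti mu A - \sum_(g <- ibox c k) betti mu (grid_box m g)| <=
    \sum_(z <- shell c k m e t) cost mu z.
Proof.
move=> Rm bA gA At.
rewrite big_seq_fsetE /=; apply: near_additive => //.
- by move=> i; apply: gA; exact: valP.
- move=> g g' x /mem_real_box_cell H /mem_real_box_cell H'; apply/val_inj.
  apply: (@grid_inj m _ _ (cell_index 0 x) 0) => // i; rewrite addr0.
    by have := H i; rewrite !mxE.
  by have := H' i; rewrite !mxE.
move=> x Ax; rewrite /shell !inE /= At//=.
have [/(deep_cubesP Rm)[g gc gz]|] := boolP (_ \in _); last by left.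
right; exists [` gc]%fset => y Ay yx i /=; have := yx i; have := gz i.
rewrite !mxE; set f := Num.floor _; rewrite -[f < _]lezD1 -!(ler_int R).
rewrite !(rmorphD, rmorphB, rmorphM) /= mulrNz -!pmulrn.
set a : R := (g ord0 i)%:~R; set b : R := f%:~R; move=> /andP[h1 h2] /andP[h3 h4].
by apply/andP; split; lra.
Qed.

Lemma card_shell (c e : Z) (k m t : nat) A : (2 * R0 <= m)%N ->
    (forall g, g \in ibox c k -> grid_box m g `<=` A) ->
    (forall x, A x -> cell_index 0 x \in ibox e t) ->
  (#|` shell c k m e t|)%:R = t%:R ^+ N - (k%:R * (m%:R - 2 * R0%:R)) ^+ N :> R.
Proof.
move=> Rm gA At.
(* The corner of a deep cube is a point of a grid box, hence of A, so its index is in the ambient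
   box; the shell is then the exact complement of the deep cubes. *)
have sub : {subset deep_cubes c k m <= ibox e t}.
  move=> z /(deep_cubesP Rm)[g gc gz].
  have := At (real_row R z); rewrite (_ : cell_index _ _ = z); last first.
    by apply/rowP => i; rewrite !mxE mul1r intrKfloor.
  apply; apply: (gA g gc); apply/mem_real_box_cell => i.
  rewrite !mxE mul1r intrKfloor; have := gz i; move: (g ord0 i) (z ord0 i) => a b; lia.
have -> : (t%:R ^+ N = (#|` shell c k m e t| + size (deep_cubes c k m))%:R :> R).
  rewrite -natrX -(card_ibox e t); congr _%:R.
  rewrite -(count_predC (fun z => z \notin deep_cubes c k m)) -!size_filter; congr (_ + _)%N.
    apply/perm_size/uniq_perm; rewrite ?filter_uniq ?fset_uniq// => z.
    by rewrite mem_filter !inE /= andbC.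
  apply/perm_size/uniq_perm; rewrite ?filter_uniq ?fset_uniq ?uniq_deep_cubes// => z.
  rewrite mem_filter /= negbK; case: (boolP (z \in deep_cubes c k m)) => //= /sub ->//.
rewrite natrD size_deep_cubes natrM !natrX natrB// natrM -exprMn addrK//.
Qed.

End grids.

Lemma cvg_geometric0 (R : realType) (C : R) : (C * 2^-1 ^+ j) @[j --> \oo] --> (0 : R).
Proof.
rewrite -[X in _ --> X](mulr0 C); apply: cvgMr; apply: cvg_expr.
by rewrite ger0_norm ?invr_ge0// invf_lt1// ltr1n.
Qed.

(** Used with W the value of a window, X the sum over its grid boxes, Y that sum with every density
    replaced by b, v the volume of the window and rho the fraction covered by the grid. *)
Lemma quotient_deviation (R : realFieldType) (W X Y b A C t rho v : R) :
    0 < v -> `|W - X| <= A * v ->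
  `|X - Y| <= C * v -> Y = rho * v * b -> 1 - t <= rho <= 1 -> `|W / v - b| <= A + C + t * `|b|.
Proof.
move=> v0 WX XY YE /andP[rt r1].
have -> : W / v - b = (W - X) / v + (X - Y) / v + (rho - 1) * b.
  by rewrite YE; field; rewrite gt_eqF.
apply: le_trans (ler_normD _ _) _; apply: lerD.
  apply: le_trans (ler_normD _ _) _; rewrite !normrM normfV (ger0_norm (ltW v0)).
  by apply: lerD; rewrite ler_pdivrMr.
rewrite normrM; apply: ler_wpM2r => //.
by rewrite ler0_norm ?subr_le0// opprB lerBlDr addrC -lerBlDr.
Qed.

Lemma half_diff_le (R : realFieldType) (a b c e : R) :
  `|a - c| <= e -> `|b - c| <= e -> `|2^-1 * (a - b)| <= e.
Proof.
rewrite !ler_norml => /andP[a1 a2] /andP[b1 b2]; apply/andP; split; lra.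
Qed.

Lemma ler_sum_fsubset (R : numDomainType) (I : choiceType) (A B : {fset I}) (f : I -> R) :
  (forall i, 0 <= f i) -> {subset A <= B} -> \sum_(i <- A) f i <= \sum_(i <- B) f i.
Proof.
move=> f0 AB; rewrite [leRHS](big_fsetID _ (mem A)) /=.
have -> : [fset i in B | i \in A]%fset = A.
  by apply/fsetP => i; rewrite !inE /= andb_idl//; exact: AB.
by rewrite lerDl sumr_ge0.
Qed.

Lemma lee_expe (R : realDomainType) (x y : \bar R) k :
  (0 <= x)%E -> (x <= y)%E -> (x ^+ k <= y ^+ k)%E.
Proof.
move=> x0 xy; elim: k => [|k IH]; first by rewrite !expe0.
by rewrite !expeS lee_pmul// expe_ge0.
Qed.

Lemma measurable_expe d (T : measurableType d) (R : realType) (f : T -> \bar R) k :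
  measurable_fun setT f -> measurable_fun setT (fun w => (f w ^+ k)%E).
Proof.
move=> mf; elim: k => [|k IH]; first by under eq_fun do rewrite expe0; exact: measurable_cst.
by under eq_fun do rewrite expeS; exact: emeasurable_funM.
Qed.

(** * Square integrable functions *)

Section square_integrable.
Context d (T : measurableType d) (R : realType) (Q : probability T R).
Implicit Types f g h : T -> R.

(** A real-valued integral is 0 when the integral is infinite, hence the integrability hypotheses
    below. *)
Definition mean f : R := \int[Q]_x f x.

Definition integrableR f := Q.-integrable [set: T] (EFin \o f).

Definition L2 f := measurable_fun [set: T] f /\ integrableR (fun x => f x ^+ 2).

Lemma integrableR_le f g : measurable_fun [set: T] f ->
  integrableR g -> (forall x, `|f x| <= g x) -> integrableR f.
Proof.
move=> mf ig fg; apply: le_integrable ig => //; first exact/measurable_EFinP.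
by move=> x _ /=; rewrite lee_fin (le_trans (fg x))// ler_norm.
Qed.

Lemma integrableRD f g : integrableR f -> integrableR g -> integrableR (fun x => f x + g x).
Proof. by move=> If Ig; rewrite /integrableR; exact: (integrableD measurableT If Ig). Qed.

Lemma integrableRZ c f : integrableR f -> integrableR (fun x => c * f x).
Proof. by move=> If; exact: (integrableZl measurableT c If). Qed.

Lemma integrableR_cst c : integrableR (fun=> c).
Proof. exact: finite_measure_integrable_cst. Qed.

Lemma integrableR_sum (I : Type) (s : seq I) (f : I -> T -> R) :
  (forall i, integrableR (f i)) -> integrableR (fun x => \sum_(i <- s) f i x).
Proof.
move=> If; elim: s => [|i s IH].
  by under eq_fun do rewrite big_nil; exact: integrableR_cst.
by under eq_fun do rewrite big_cons; exact: integrableRD.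
Qed.

Lemma integrableR_measurable f : integrableR f -> measurable_fun [set: T] f.
Proof. by move=> /integrableP[/measurable_EFinP]. Qed.

Lemma meanD f g : integrableR f -> integrableR g ->
  mean (fun x => f x + g x) = mean f + mean g.
Proof. by move=> If Ig; rewrite /mean RintegralD. Qed.

Lemma integrableRB f g : integrableR f -> integrableR g -> integrableR (fun x => f x - g x).
Proof. by move=> If Ig; rewrite /integrableR; exact: (integrableB measurableT If Ig). Qed.

Lemma meanB f g : integrableR f -> integrableR g ->
  mean (fun x => f x - g x) = mean f - mean g.
Proof. by move=> If Ig; rewrite /mean RintegralB. Qed.

Lemma meanZ c f : integrableR f -> mean (fun x => c * f x) = c * mean f.
Proof. by move=> If; rewrite /mean RintegralZl. Qed.

Lemma mean_cst c : mean (fun=> c) = c.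
Proof.
rewrite /mean Rintegral_cst//; transitivity (c * fine (1%E : \bar R)); last by rewrite mulr1.
by congr (_ * fine _); exact: probability_setT.
Qed.

Lemma mean_sum (I : Type) (s : seq I) (f : I -> T -> R) : (forall i, integrableR (f i)) ->
  mean (fun x => \sum_(i <- s) f i x) = \sum_(i <- s) mean (f i).
Proof.
move=> If; elim: s => [|i s IH].
  by under eq_fun do rewrite big_nil; rewrite big_nil mean_cst.
under eq_fun do rewrite big_cons.
by rewrite big_cons meanD ?IH//; exact: integrableR_sum.
Qed.

Lemma le_mean f g : integrableR f -> integrableR g -> (forall x, f x <= g x) ->
  mean f <= mean g.
Proof. by move=> If Ig fg; apply: le_Rintegral. Qed.

Lemma mean_ge0 f : (forall x, 0 <= f x) -> 0 <= mean f.
Proof. by move=> f0; apply: Rintegral_ge0. Qed.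

Lemma norm_mean f : integrableR f -> `|mean f| <= mean (fun x => `|f x|).
Proof. by move=> If; exact: le_normr_Rintegral. Qed.

Lemma integrableR_norm f : integrableR f -> integrableR (fun x => `|f x|).
Proof. by move=> If; exact: (integrable_abse If). Qed.

Lemma mean_EFin f : integrableR f -> (\int[Q]_x (f x)%:E)%E = (mean f)%:E.
Proof.
by move=> If; rewrite /mean /Rintegral fineK//; exact: integrable_fin_num.
Qed.

Lemma L2_mul f g : L2 f -> L2 g -> integrableR (fun x => f x * g x).
Proof.
move=> [mf If] [mg Ig]; apply: integrableR_le (integrableRD If Ig) _.
  exact: measurable_funM.
move=> x; rewrite normrM -(real_normK (num_real (f x))) -(real_normK (num_real (g x))).
move: `|f x| `|g x| (normr_ge0 (f x)) (normr_ge0 (g x)) => a b a0 b0; nra.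
Qed.

Lemma L2_cst c : L2 (fun=> c).
Proof. by split; [exact: measurable_cst|exact: integrableR_cst]. Qed.

Lemma L2_integrable f : L2 f -> integrableR f.
Proof.
move=> Lf; rewrite (_ : f = fun x => f x * 1); last by apply/funext => x; rewrite mulr1.
exact: L2_mul (L2_cst 1).
Qed.

Lemma L2D f g : L2 f -> L2 g -> L2 (fun x => f x + g x).
Proof.
move=> Lf Lg; have [mf If] := Lf; have [mg Ig] := Lg.
split; first exact: measurable_funD.
rewrite (_ : (fun x => _) = (fun x => (f x ^+ 2 + g x ^+ 2) + 2 * (f x * g x))); last first.
  by apply/funext => x; ring.
by apply: integrableRD; [exact: integrableRD|apply: integrableRZ; exact: L2_mul].
Qed.

Lemma L2Z c f : L2 f -> L2 (fun x => c * f x).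
Proof.
move=> [mf If]; split; first exact: measurable_funM.
rewrite (_ : (fun x => _) = (fun x => c ^+ 2 * f x ^+ 2)); last first.
  by apply/funext => x; rewrite exprMn.
exact: integrableRZ.
Qed.

Lemma L2B f g : L2 f -> L2 g -> L2 (fun x => f x - g x).
Proof.
move=> Lf Lg; rewrite (_ : (fun x => _) = (fun x => f x + -1 * g x)); last first.
  by apply/funext => x; rewrite mulN1r.
by apply: L2D => //; exact: L2Z.
Qed.

Lemma L2_sum (I : Type) (s : seq I) (f : I -> T -> R) :
  (forall i, L2 (f i)) -> L2 (fun x => \sum_(i <- s) f i x).
Proof.
move=> Lf; elim: s => [|i s IH].
  by under eq_fun do rewrite big_nil; exact: L2_cst.
by under eq_fun do rewrite big_cons; exact: L2D.
Qed.

Lemma L2_le f g : measurable_fun [set: T] f -> L2 g -> (forall x, `|f x| <= g x) -> L2 f.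
Proof.
move=> mf [mg Ig] fg; split => //; apply: integrableR_le Ig _.
  exact: measurable_funX.
move=> x; rewrite normrX lerXn2r ?nnegrE//; exact: le_trans (fg x).
Qed.

Definition norm2 f : R := Num.sqrt (mean (fun x => f x ^+ 2)).

Lemma norm2_ge0 f : 0 <= norm2 f.
Proof. exact: sqrtr_ge0. Qed.

Lemma norm2_sqr f : norm2 f ^+ 2 = mean (fun x => f x ^+ 2).
Proof. by rewrite sqr_sqrtr// mean_ge0// => x; exact: sqr_ge0. Qed.

Lemma norm2_0 : norm2 (fun=> 0) = 0.
Proof. by rewrite /norm2; under eq_fun do rewrite expr0n; rewrite mean_cst sqrtr0. Qed.

(** As a nonnegative quadratic polynomial in c this gives Cauchy-Schwarz; c = 1 and c = -1 give the
    triangle inequality and the parallelogram identity. *)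
Lemma mean_sqrD f g c : L2 f -> L2 g ->
  mean (fun x => (f x + c * g x) ^+ 2) =
  norm2 f ^+ 2 + 2 * c * mean (fun x => f x * g x) + c ^+ 2 * norm2 g ^+ 2.
Proof.
move=> Lf Lg; have If := Lf.2; have Ig := Lg.2; have Ifg := L2_mul Lf Lg.
rewrite (_ : (fun x => _) = (fun x => (f x ^+ 2 + (2 * c) * (f x * g x)) + c ^+ 2 * g x ^+ 2)); last first.
  by apply/funext => x; ring.
rewrite meanD; [|by apply: integrableRD => //; exact: integrableRZ|exact: integrableRZ].
by rewrite meanD//; [rewrite !meanZ// !norm2_sqr|exact: integrableRZ].
Qed.

Lemma cauchy_schwarz f g : L2 f -> L2 g -> mean (fun x => f x * g x) <= norm2 f * norm2 g.
Proof.
move=> Lf Lg; set m := mean _.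
have H c : 0 <= norm2 f ^+ 2 + 2 * c * m + c ^+ 2 * norm2 g ^+ 2.
  by rewrite -mean_sqrD// mean_ge0// => x; exact: sqr_ge0.
have := norm2_ge0 f; have := norm2_ge0 g; move: H.
move: (norm2 f) (norm2 g) => a b H b0 a0.
have [b0E|bn0] := eqVneq b 0.
  rewrite b0E mulr0 leNgt; apply/negP => m0.
  (* With b = 0 the polynomial is affine in c; this c gives it the value - a^2 - 2. *)
  have := H (- (a ^+ 2 + 1) / m); rewrite b0E expr0n mulr0 addr0 mulrA.
  by rewrite -[2 * _ / m * m]mulrA mulVf ?gt_eqF// mulr1; have := sqr_ge0 a; lra.
have {}b0 : 0 < b by rewrite lt_neqAle eq_sym bn0.
(* The minimiser of the quadratic polynomial. *)
have := H (- m / b ^+ 2).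
rewrite (_ : _ + _ + _ = a ^+ 2 - m ^+ 2 / b ^+ 2); last by field.
rewrite subr_ge0 ler_pdivrMr ?exprn_gt0// -exprMn => h.
have := ler_norm m; move/le_trans; apply.
by rewrite -(@ler_pXn2r _ 2) ?nnegrE ?mulr_ge0 ?(ltW b0)// real_normK ?num_real.
Qed.

Lemma norm2_triangle f g : L2 f -> L2 g -> norm2 (fun x => f x + g x) <= norm2 f + norm2 g.
Proof.
move=> Lf Lg; have := cauchy_schwarz Lf Lg; have := mean_sqrD 1 Lf Lg.
under eq_fun do rewrite mul1r; rewrite -norm2_sqr => e cs.
rewrite -(@ler_pXn2r _ 2) ?nnegrE ?addr_ge0 ?norm2_ge0// e; move: cs.
by move: (mean _) (norm2 f) (norm2 g) => m a b; lra.
Qed.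

Lemma norm2Z c f : L2 f -> norm2 (fun x => c * f x) = `|c| * norm2 f.
Proof.
move=> Lf; rewrite /norm2; under eq_fun do rewrite exprMn.
by rewrite meanZ ?(Lf.2)// sqrtrM ?sqr_ge0// sqrtr_sqr.
Qed.

Lemma norm2_le f g : L2 f -> L2 g -> (forall x, `|f x| <= g x) -> norm2 f <= norm2 g.
Proof.
move=> Lf Lg fg; rewrite /norm2 ler_wsqrtr// le_mean//; [exact: Lf.2|exact: Lg.2|move=> x].
rewrite -(real_normK (num_real (f x))) lerXn2r ?nnegrE//; exact: le_trans (fg x).
Qed.

Lemma norm2_average (I : eqType) (s : seq I) (f : I -> T -> R) B : (0 < size s)%N ->
    (forall i, L2 (f i)) -> (forall i, i \in s -> norm2 (f i) <= B) ->
  norm2 (fun x => (size s)%:R^-1 * \sum_(i <- s) f i x) <= B.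
Proof.
move=> s0 Lf fB; rewrite norm2Z; last exact: L2_sum.
rewrite ger0_norm ?invr_ge0// mulrC ler_pdivrMr ?ltr0n//.
elim: s {s0} fB => [|i s IH] fB.
  rewrite mulr0; under eq_fun do rewrite big_nil.
  by rewrite /norm2; under eq_fun do rewrite expr0n; rewrite mean_cst sqrtr0.
under eq_fun do rewrite big_cons.
apply: le_trans (norm2_triangle (Lf i) (L2_sum s Lf)) _.
rewrite /= -natr1 mulrDr mulr1 addrC lerD ?fB ?mem_head// IH// => k ks.
by rewrite fB// inE ks orbT.
Qed.

Lemma norm2_parallelogram f g : L2 f -> L2 g ->
  norm2 (fun x => f x - g x) ^+ 2 =
  2 * norm2 f ^+ 2 + 2 * norm2 g ^+ 2 - 4 * norm2 (fun x => 2^-1 * (f x + g x)) ^+ 2.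
Proof.
move=> Lf Lg; rewrite norm2Z ?exprMn; last exact: L2D.
have e1 := mean_sqrD (-1) Lf Lg; have e2 := mean_sqrD 1 Lf Lg.
rewrite (norm2_sqr (fun x => f x - g x)) (norm2_sqr (fun x => f x + g x)).
rewrite (_ : (fun x => (f x - g x) ^+ 2) = (fun x => (f x + -1 * g x) ^+ 2)); last first.
  by apply/funext => x; ring.
rewrite (_ : (fun x => (f x + g x) ^+ 2) = (fun x => (f x + 1 * g x) ^+ 2)); last first.
  by apply/funext => x; ring.
rewrite e1 e2 (ger0_norm (_ : 0 <= 2^-1)) ?invr_ge0 ?ler0n//; by field.
Qed.

Lemma mean_le_norm2 f : L2 f -> mean (fun x => `|f x|) <= norm2 f.
Proof.
move=> Lf; have Lf' : L2 (fun x => `|f x|).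
  split; first by apply: measurableT_comp => //; exact: Lf.1.
  rewrite (_ : (fun x => _) = (fun x => f x ^+ 2)); first exact: Lf.2.
  by apply/funext => x; rewrite real_normK// num_real.
have := cauchy_schwarz Lf' (L2_cst 1); under eq_fun do rewrite mulr1.
rewrite {2}/norm2 expr1n mean_cst sqrtr1 mulr1 => /le_trans; apply.
rewrite /norm2 (_ : (fun x => `|f x| ^+ 2) = (fun x => f x ^+ 2))//.
by apply/funext => x; rewrite real_normK// num_real.
Qed.

End square_integrable.

(** * The maximal inequality on the lattice *)

Section covering.
Context (N : nat) (R : realType).
Local Notation Z := 'rV[int]_N.

Definition zcube (x : Z) (n : nat) : {fset Z} := ibox (x - const_mx n%:Z) (2 * n).+1.

Lemma in_zcube (x : Z) n (y : Z) :
  reflect (forall i, `|y ord0 i - x ord0 i| <= n%:Z) (y \in zcube x n).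
Proof.
by apply: (iffP (in_ibox _ _ _)) => H i; have := H i; rewrite !mxE;
  move: (x ord0 i) (y ord0 i) => a b; lia.
Qed.

Lemma sum_zcube_translate (f : Z -> R) (x : Z) n :
  \sum_(z <- zcube x n) f z = \sum_(z <- zcube 0 n) f (z + x).
Proof.
by rewrite -(sum_ibox_translate f) /zcube sub0r addrC.
Qed.

(* A finite Vitali covering argument: keep the largest cube, discard the centres
   close to it, and repeat. *)
Lemma vitali_count (h : Z -> R) (r : Z -> nat) (lam : R) (S U : {fset Z}) :
    (forall z, 0 <= h z) -> 0 <= lam ->
    (forall x, x \in S -> (zcube x (r x) `<=` U)%fset) ->
    (forall x, x \in S -> lam * ((2 * r x).+1%:R) ^+ N <= \sum_(z <- zcube x (r x)) h z) ->
  lam * #|` S|%:R <= 2 ^+ N * \sum_(z <- U) h z.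
Proof.
move=> h0 lam0; have [m] := ubnP #|` S|; elim: m S U => // m IH S U Sm SU Slam.
have [->|S0] := eqVneq S fset0.
  by rewrite cardfs0 mulr0 mulr_ge0 ?exprn_ge0// sumr_ge0.
have [x xS xmax] : exists2 x, x \in S & forall y, y \in S -> (r y <= r x)%N.
  have [x0 x0S] := fset0Pn _ S0.
  have [x _ xmax] := @arg_maxnP S [` x0S]%fset predT (fun y => r (val y)) isT.
  by exists (val x); [exact: valP|move=> y yS; exact: (xmax [` yS]%fset)].
pose C := zcube x (r x); pose S1 := (S `&` zcube x (2 * r x))%fset.
pose S2 := (S `\` zcube x (2 * r x))%fset.
have cardS : #|` S| = (#|` S1| + #|` S2|)%N by rewrite cardfsID.
(* The discarded centres lie in a cube of radius 2r, and 4r + 1 <= 2 (2r + 1); this is the origin of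
   2^N. *)
have S1le : #|` S1|%:R <= 2 ^+ N * ((2 * r x).+1%:R) ^+ N :> R.
  rewrite -exprMn -natrM -natrX ler_nat.
  apply: leq_trans (fsubset_leq_card (fsubsetIr _ _)) _.
  have mono a b k : (a <= b)%N -> (a ^ k <= b ^ k)%N.
    by move=> ab; case: k => // k; rewrite leq_exp2r.
  by rewrite card_ibox mono//; lia.
have S2m : (#|` S2| < m)%N.
  rewrite -ltnS (leq_trans _ Sm)// ltnS; apply: fproper_ltn_card.
  rewrite fproperE fsubsetDl /=; apply/negP => /fsubsetP/(_ x xS).
  rewrite inE => /andP[/negP + _]; apply; apply/in_zcube => i.
  by rewrite subrr normr0.
have CU : (C `<=` U)%fset by exact: SU.
(* A remaining centre is farther than 2r from x in some coordinate and its radius is at most r, so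
   its cube misses C. *)
have S2U y : y \in S2 -> (zcube y (r y) `<=` U `\` C)%fset.
  rewrite inE => /andP[yx yS]; apply/fsubsetP => z zy; rewrite inE.
  rewrite (fsubsetP (SU _ yS))// andbT; apply: contra yx => zx.
  apply/in_zcube => i; have /in_zcube/(_ i) := zy; have /in_zcube/(_ i) := zx.
  have := xmax _ yS; move: (x ord0 i) (y ord0 i) (z ord0 i) (r x) (r y) => a b c k l; lia.
have := IH S2 _ S2m S2U (fun y yS2 => Slam y (fsubsetP (fsubsetDl _ _) y yS2)).
rewrite cardS natrD mulrDr (big_fsetID _ (mem C) U) /=.
have -> : [fset z in U | z \in C]%fset = C.
  by apply/fsetP => z; rewrite !inE /= andb_idl// => /(fsubsetP CU).
have -> : [fset z in U | z \notin C]%fset = (U `\` C)%fset.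
  by apply/fsetP => z; rewrite !inE /= andbC.
move=> H2; rewrite mulrDr lerD//.
apply: le_trans (ler_wpM2l lam0 S1le) _.
by rewrite mulrCA ler_wpM2l ?exprn_ge0//; exact: Slam.
Qed.

End covering.

Section measure_preserving.
Context d (T : measurableType d) (R : realType) (Q : probability T R).
Context (G : zmodType) (tau : G -> T -> T).
Context (mtau : forall x, measurable_fun [set: T] (tau x)).
Context (Qtau : forall x I, measurable I -> Q (tau x @^-1` I) = Q I).
Context (tauD : forall x y t, tau x (tau y t) = tau (x + y) t).

Lemma measurable_comp_tau d' (T' : measurableType d') (f : T -> T') x :
  measurable_fun setT f -> measurable_fun setT (fun t => f (tau x t)).
Proof. by move=> mf; exact: (measurableT_comp mf (mtau x)). Qed.

Lemma integral_tau x (f : T -> \bar R) : measurable_fun setT f -> (forall t, 0 <= f t)%E ->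
  (\int[Q]_t f (tau x t) = \int[Q]_t f t)%E.
Proof.
move=> mf f0; have := @ge0_integral_pushforward _ _ T T R (tau x) (mtau x) Q setT f measurableT mf.
rewrite preimage_setT => <- //.
by apply: eq_measure_integral => A mA _; exact: Qtau.
Qed.

Lemma integrableR_tau x (f : T -> R) : integrableR Q f -> integrableR Q (fun t => f (tau x t)).
Proof.
move=> /integrableP[/measurable_EFinP mf If]; apply/integrableP; split.
  by apply/measurable_EFinP; exact: measurable_comp_tau.
rewrite (integral_tau x (f := fun t => `|(f t)%:E|%E))//.
by apply: measurableT_comp => //; exact/measurable_EFinP.
Qed.

Lemma mean_tau x (f : T -> R) : integrableR Q f -> mean Q (fun t => f (tau x t)) = mean Q f.
Proof.
move=> If; have mf := integrableR_measurable If.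
have If' := integrableR_tau x If.
rewrite /mean /Rintegral; congr fine.
have := @integral_pushforward _ _ T T R (tau x) (mtau x) Q setT (EFin \o f).
rewrite preimage_setT => <- //; last exact/measurable_EFinP.
by apply: eq_measure_integral => A mA _; exact: Qtau.
Qed.

Lemma L2_tau x (f : T -> R) : L2 Q f -> L2 Q (fun t => f (tau x t)).
Proof.
move=> [mf If]; split; first exact: measurable_comp_tau.
exact: (integrableR_tau x If).
Qed.

Lemma norm2_tau x (f : T -> R) : L2 Q f -> norm2 Q (fun t => f (tau x t)) = norm2 Q f.
Proof.
by move=> [mf If]; rewrite /norm2 (mean_tau x If).
Qed.

End measure_preserving.

Section maximal_inequality.
Context d (T : measurableType d) (R : realType) (Q : probability T R).
Context (G : zmodType) (tau : G -> T -> T).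
Context (mtau : forall x, measurable_fun [set: T] (tau x)).
Context (Qtau : forall x I, measurable I -> Q (tau x @^-1` I) = Q I).
Context (tauD : forall x y t, tau x (tau y t) = tau (x + y) t).
Context (N : nat) (e : 'rV[int]_N -> G) (eD : forall z w, e (z + w) = e z + e w).
Context (H : T -> R) (H_ge0 : forall t, 0 <= H t) (H_int : integrableR Q H).
Context (lam : R) (lam_gt0 : 0 < lam).

Let mH : measurable_fun [set: T] H := integrableR_measurable H_int.

(** A superlevel set of the Hardy-Littlewood maximal function of H along the lattice orbit. *)
Definition large_average : set T :=
  [set t | exists n, lam * ((2 * n).+1%:R) ^+ N <= \sum_(z <- zcube 0 n) H (tau (e z) t)].

Let large (n : nat) : set T :=
  [set t | lam * ((2 * n).+1%:R) ^+ N <= \sum_(z <- zcube 0 n) H (tau (e z) t)].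

Let large_upto (n0 : nat) : set T := \bigcup_(n in [set n | (n <= n0)%N]) large n.

Let measurable_large n : measurable (large n).
Proof.
apply: measurable_bool; apply: measurable_fun_ler => //.
by apply: measurable_sum => z; exact: (measurable_comp_tau mtau _ mH).
Qed.

Let measurable_large_upto n0 : measurable (large_upto n0).
Proof. by apply: bigcup_measurable => n _; exact: measurable_large. Qed.

Lemma measurable_large_average : measurable large_average.
Proof.
rewrite (_ : large_average = \bigcup_n large n); first exact: bigcupT_measurable.
by apply/seteqP; split => [t [n tn]|t [n _ tn]]; exists n.
Qed.

(** Transference: the covering bound is applied to the values of H along one orbit in a box of side
    K, then integrated using invariance. The cubes stick out into a box of side K + 2 n0, and K = 2
    n0 + 1 keeps this below 2K; this second factor 2^N makes 4^N. *)
Let large_upto_le n0 : lam * fine (Q (large_upto n0)) <= 4 ^+ N * mean Q H.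
Proof.
pose K := (2 * n0).+1; pose B := large_upto n0.
pose U := ibox (const_mx (- n0%:Z) : 'rV[int]_N) (K + 2 * n0).
pose I := ibox (0 : 'rV[int]_N) K.
have mB : measurable B by exact: measurable_large_upto.
have iB : integrableR Q (\1_B : T -> R).
  by apply: integrable_indic => //; rewrite ?setIT// ?fin_num_measure// -ge0_fin_numE ?fin_num_measure.
have meanB : mean Q (\1_B : T -> R) = fine (Q B).
  by rewrite /mean /Rintegral integral_indic// setIT.
have key t : lam * \sum_(x <- I) \1_B (tau (e x) t) <= 2 ^+ N * \sum_(w <- U) H (tau (e w) t).
  pose S := [fset x in I | tau (e x) t \in B]%fset.
  have -> : \sum_(x <- I) \1_B (tau (e x) t) = #|` S|%:R :> R.
    rewrite card_fset_sum1 natr_sum /S -big_fset_condE [RHS]big_mkcond /=; apply: eq_bigr => x _.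
    by rewrite indicE; case: (_ \in B).
  have rS x : exists n, x \in S -> (n <= n0)%N /\ large n (tau (e x) t).
    have [xS|xS] := boolP (x \in S); last by exists 0%N.
    move: xS; rewrite !inE /= => /andP[_ /set_mem [n nn0 xn]].
    by exists n.
  have [r rP] := choice rS.
  apply: (vitali_count (h := fun w => H (tau (e w) t)) (r := r)).
  - by move=> z; exact: H_ge0.
  - exact: ltW.
  - move=> x xS; have [rn0 _] := rP _ xS; apply/fsubsetP => y /in_zcube yx.
    apply/in_ibox => i; move: xS; rewrite !inE /= => /andP[/in_ibox /(_ i) + _].
    have := yx i; rewrite !mxE /K; move: (x ord0 i) (y ord0 i) (r x) rn0 => a b k; lia.
  - move=> x xS; have [_ rL] := rP _ xS; rewrite sum_zcube_translate.
    apply: le_trans rL _; apply: ler_sum => z _; by rewrite tauD eD.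
have h1 : lam * (K%:R ^+ N * fine (Q B)) <= 2 ^+ N * ((K + 2 * n0)%:R ^+ N * mean Q H).
  have IB x : integrableR Q (fun t => (\1_B : T -> R) (tau (e x) t)).
    exact: (integrableR_tau mtau Qtau _ iB).
  have IH w : integrableR Q (fun t => H (tau (e w) t)).
    exact: (integrableR_tau mtau Qtau _ H_int).
  have := @le_mean _ _ _ Q _ _ (integrableRZ lam (integrableR_sum I IB))
     (integrableRZ (2 ^+ N) (integrableR_sum U IH)) key.
  rewrite !meanZ; [|exact: integrableR_sum|exact: integrableR_sum].
  rewrite !mean_sum//.
  rewrite (eq_bigr (fun=> fine (Q B))); last first.
    by move=> x _; rewrite (mean_tau mtau Qtau _ iB).
  rewrite [in leRHS](eq_bigr (fun=> mean Q H)); last first.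
    by move=> x _; rewrite (mean_tau mtau Qtau _ H_int).
  rewrite !big_const_seq !count_predT !iter_addr_0.
  have cI : size I = (K ^ N)%N by exact: card_ibox.
  have cU : size U = ((K + 2 * n0) ^ N)%N by exact: card_ibox.
  by rewrite cI cU -(mulr_natl (fine _)) -(mulr_natl (mean Q H)) !natrX.
have K0 : 0 < K%:R ^+ N :> R by rewrite exprn_gt0// ltr0n.
rewrite -(ler_pM2l K0) mulrCA; apply: le_trans h1 _.
rewrite [leLHS](_ : _ = (2 * (K + 2 * n0)%:R) ^+ N * mean Q H); last by rewrite mulrA -exprMn.
rewrite mulrA -exprMn ler_wpM2r ?mean_ge0// lerXn2r ?nnegrE ?mulr_ge0//.
have : (K + 2 * n0)%:R <= 2 * K%:R :> R by rewrite -natrM ler_nat /K; lia.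
by move: (_%:R) (K%:R) => a b; lra.
Qed.

Lemma lattice_maximal_inequality :
  (Q large_average <= (4 ^+ N * mean Q H / lam)%:E)%E.
Proof.
have E : large_average = \bigcup_n large_upto n.
  apply/seteqP; split => [t [n tn]|t [n _ [m _ tm]]]; last by exists m.
  by exists n => //; exists n => /=.
have nd : nondecreasing_seq large_upto.
  move=> m n mn; apply/subsetPset => t [k /= km tk].
  by exists k => //=; exact: leq_trans km _.
have mE : measurable (\bigcup_n large_upto n).
  by rewrite -E; exact: measurable_large_average.
have cv := @nondecreasing_cvg_mu _ _ _ Q _ measurable_large_upto mE nd.
rewrite E -(cvg_lim _ cv)//; apply: lime_le; first by apply/cvg_ex; eexists; exact: cv.
apply: nearW => n /=; rewrite -[leLHS]fineK ?fin_num_measure// lee_fin.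
by rewrite ler_pdivlMr// mulrC.
Qed.

End maximal_inequality.

(** * Convergence of sequences of near averages *)

Section near_averages.
Context d (T : measurableType d) (R : realType) (Q : probability T R) (N : nat).
Local Notation V := 'rV[R]_N.
Local Notation Z := 'rV[int]_N.
Context (tau : V -> T -> T).
Context (mtau : forall x, measurable_fun [set: T] (tau x)).
Context (Qtau : forall x I, measurable I -> Q (tau x @^-1` I) = Q I).
Context (tauD : forall x y t, tau x (tau y t) = tau (x + y) t).
Context (al : nat -> T -> R) (Lal : forall j, L2 Q (al j)).
Context (eps : nat -> R) (eps_ge0 : forall i, 0 <= eps i) (eps0 : eps @ \oo --> 0) (i0 : nat).

Definition dyadic_row (i : nat) (p : Z) : V := real_row R ((2 ^ i)%N%:Z *: p).

(* The mean of [al i] over the boxes of side [2 ^ i] that tile the one of side [2 ^ j]. *)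
Definition tiling_mean i j t : R := (size (ibox (0 : Z) (2 ^ (j - i))))%:R^-1 *
  \sum_(p <- ibox (0 : Z) (2 ^ (j - i))) al i (tau (dyadic_row i p) t).

Context (al_tiling : forall i j, (i0 <= i)%N -> (i <= j)%N ->
  norm2 Q (fun t => al j t - tiling_mean i j t) <= eps i).
Context (al_shift : forall x, norm2 Q (fun t => al j t - al j (tau x t)) @[j --> \oo] --> 0).

Let Ltau x j : L2 Q (fun t => al j (tau x t)).
Proof. exact: (L2_tau mtau Qtau). Qed.

Let Ltiling i j : L2 Q (tiling_mean i j).
Proof. by apply: L2Z; apply: L2_sum. Qed.

Let ibox_size n : (0 < size (ibox (0 : Z) (2 ^ n)))%N.
Proof. by rewrite card_ibox expn_gt0 expn_gt0. Qed.

Let norm_nearly_decreasing i j : (i0 <= i)%N -> (i <= j)%N ->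
  norm2 Q (al j) <= norm2 Q (al i) + eps i.
Proof.
move=> i0i ij.
have -> : norm2 Q (al j) = norm2 Q (fun t => tiling_mean i j t + (al j t - tiling_mean i j t)).
  by congr norm2; apply/funext => t; rewrite addrC subrK.
apply: le_trans (norm2_triangle (Ltiling i j) (L2B (Lal j) (Ltiling i j))) _.
rewrite lerD ?al_tiling// norm2_average// => p _.
by rewrite (norm2_tau mtau Qtau).
Qed.

(** The norms decrease only up to [eps], so m is the infimum of [norm2 + eps]; it is the limit of
    the norms as [eps] vanishes. *)
Let norm_limit : exists m, 0 <= m /\ (forall j, (i0 <= j)%N -> m <= norm2 Q (al j) + eps j) /\
  (forall e, 0 < e -> exists J, forall j, (J <= j)%N -> norm2 Q (al j) <= m + e).
Proof.
pose A := [set x | exists2 j, (i0 <= j)%N & x = norm2 Q (al j) + eps j].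
have A0 : A !=set0 by exists (norm2 Q (al i0) + eps i0), i0.
have lbA : lbound A 0 by move=> _ [j _ ->]; rewrite addr_ge0// norm2_ge0.
have hA : has_inf A by split => //; exists 0.
exists (inf A); split; first exact: lb_le_inf.
split=> [j i0j|e e0]; first by apply: ge_inf; [exists 0|exists j].
have [_ [j i0j ->] je] := inf_adherent e0 hA.
exists j => k jk; apply: le_trans (norm_nearly_decreasing i0j jk) _; exact: ltW.
Qed.

Let cvg0_lt (u : nat -> R) e : u @ \oo --> 0 -> 0 < e -> exists J, forall j, (J <= j)%N -> `|u j| < e.
Proof.
move=> /cvgr0Pnorm_lt/(_ e) u0 e0; have [J _ HJ] := u0 e0.
by exists J => j /HJ.
Qed.

(* The average of [al l + al k] over the shifts [2^l p + 2^k g] inside a huge box is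
   close to twice the value [al k'] of that box. *)
Let norm_half_sum m l k : (forall j, (i0 <= j)%N -> m <= norm2 Q (al j) + eps j) ->
    (i0 <= l)%N -> (l <= k)%N ->
  2 * m - 2 * eps k - eps l <= norm2 Q (fun t => al l t + al k t).
Proof.
move=> mP i0l lk; apply/ler_addgt0Pr => e e0.
pose P := ibox (0 : Z) (2 ^ (k - l)).
have shiftP : \sum_(p <- P) norm2 Q (fun t => al j t - al j (tau (dyadic_row l p) t)) @[j --> \oo] --> 0.
  have := @cvg_sumr R nat (nbhs \oo) _ Z P (fun p j =>
    norm2 Q (fun t => al j t - al j (tau (dyadic_row l p) t))) (fun=> 0)
    (fun p => al_shift (dyadic_row l p)).
  by rewrite big1//; apply.
have e40 : 0 < e / 4 by rewrite divr_gt0.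
have [J1 J1P] := cvg0_lt shiftP e40; have [J2 J2P] := cvg0_lt eps0 e40.
(* So large that [eps k'] and the effect of every shift in P on [al k'] are below e/4. *)
pose k' := maxn k (maxn J1 J2).
have kk' : (k <= k')%N by exact: leq_maxl.
have J1k : (J1 <= k')%N by rewrite /k' !leq_max leqnn orbT.
have J2k : (J2 <= k')%N by rewrite /k' !leq_max leqnn !orbT.
have {}J1P p : p \in P -> norm2 Q (fun t => al k' t - al k' (tau (dyadic_row l p) t)) <= e / 4.
  move=> pP; apply: ltW (le_lt_trans _ (J1P _ J1k)).
  rewrite (big_fsetD1 p) //= ger0_norm ?addr_ge0 ?norm2_ge0 ?sumr_ge0//; last first.
    by move=> *; exact: norm2_ge0.
  by rewrite lerDl sumr_ge0// => *; exact: norm2_ge0.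
have {}J2P : eps k' <= e / 4.
  by apply: ltW; rewrite -[ltLHS]ger0_norm ?J2P.
pose Gr := ibox (0 : Z) (2 ^ (k' - k)).
pose c p := dyadic_row l p; pose b g := dyadic_row k g.
pose f1 t := al k' t - tiling_mean k k' t.
pose f2 t := (size Gr)%:R^-1 * \sum_(g <- Gr) (al k (tau (b g) t) - tiling_mean l k (tau (b g) t)).
pose f3 t := (size P)%:R^-1 * \sum_(p <- P) (al k' t - al k' (tau (c p) t)).
pose f4 t := (size P)%:R^-1 * \sum_(p <- P) (al k' (tau (c p) t) - tiling_mean k k' (tau (c p) t)).
pose f5 t := (size P)%:R^-1 * \sum_(p <- P) ((size Gr)%:R^-1 *
   \sum_(g <- Gr) (al l (tau (c p + b g) t) + al k (tau (c p + b g) t))).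
have Gr0 : (size Gr)%:R != 0 :> R by rewrite pnatr_eq0 -lt0n ibox_size.
have P0 : (size P)%:R != 0 :> R by rewrite pnatr_eq0 -lt0n ibox_size.
(* One copy of [al k'] is tiled by k-boxes and these by l-boxes ([f1], [f2]). The other is first
   moved by the l-grid points of one k-box ([f3]), then tiled by k-boxes ([f4]). Both leave averages
   over the same shifts [c p + b g], collected in [f5]. *)
have E t : 2 * al k' t = f1 t + f2 t + (f3 t + f4 t) + f5 t.
  have -> : f5 t = (size Gr)%:R^-1 * \sum_(g <- Gr) tiling_mean l k (tau (b g) t)
     + (size P)%:R^-1 * \sum_(p <- P) tiling_mean k k' (tau (c p) t).
    rewrite /f5 /tiling_mean -!mulr_sumr -/P -/Gr.
    under eq_bigr do rewrite big_split /=.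
    rewrite big_split /= exchange_big /= !mulrDr; congr (_ + _).
      rewrite mulrCA; congr (_ * (_ * _)); apply: eq_bigr => g _; apply: eq_bigr => p _.
      by rewrite tauD.
    congr (_ * (_ * _)); apply: eq_bigr => p _; apply: eq_bigr => g _.
    by rewrite tauD addrC.
  rewrite /f1 /f2 /f3 /f4 !sumrB [\sum_(p <- P) al k' t]big_const_seq count_predT iter_addr_0.
  rewrite -mulr_natl -/P.
  have -> : tiling_mean k k' t = (size Gr)%:R^-1 * \sum_(g <- Gr) al k (tau (b g) t) by [].
  move: (al k' t) (\sum_(g <- Gr) al k _) (\sum_(g <- Gr) tiling_mean _ _ _).
  move: (\sum_(p <- P) al k' _) (\sum_(p <- P) tiling_mean _ _ _).
  by move=> x y z u v; field; rewrite Gr0 P0.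
have Ltil x i j : L2 Q (fun t => tiling_mean i j (tau x t)) by exact: (L2_tau mtau Qtau).
have L1 : L2 Q f1 by exact: L2B.
have L2' : L2 Q f2 by apply/L2Z/L2_sum => g; exact: L2B.
have L3 : L2 Q f3 by apply/L2Z/L2_sum => p; exact: L2B.
have L4 : L2 Q f4 by apply/L2Z/L2_sum => p; exact: L2B.
have L5 : L2 Q f5 by apply/L2Z/L2_sum => p; apply/L2Z/L2_sum => g; exact: L2D.
have n1 : norm2 Q f1 <= eps k by apply: al_tiling => //; exact: leq_trans lk.
have n2 : norm2 Q f2 <= eps l.
  apply: norm2_average => [|g|g _]; [exact: ibox_size|exact: L2B|].
  rewrite (norm2_tau mtau Qtau (b g) (f := fun t => al k t - tiling_mean l k t)); last exact: L2B.
  exact: al_tiling.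
have n4 : norm2 Q f4 <= eps k.
  apply: norm2_average => [|g|g _]; [exact: ibox_size|exact: L2B|].
  rewrite (norm2_tau mtau Qtau (c g) (f := fun t => al k' t - tiling_mean k k' t)); last exact: L2B.
  by apply: al_tiling => //; exact: leq_trans lk.
have n3 : norm2 Q f3 <= e / 4.
  by apply: norm2_average => [|p|p pP]; [exact: ibox_size|exact: L2B|exact: J1P].
have n5 : norm2 Q f5 <= norm2 Q (fun t => al l t + al k t).
  apply: norm2_average => [|p|p _]; [exact: ibox_size|by apply/L2Z/L2_sum => g; exact: L2D|].
  apply: norm2_average => [|g|g _]; [exact: ibox_size|exact: L2D|].
  by rewrite (norm2_tau mtau Qtau _ (f := fun t => al l t + al k t))//; exact: L2D.
have := mP k' (leq_trans i0l (leq_trans lk kk')).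
have : 2 * norm2 Q (al k') <= norm2 Q f1 + norm2 Q f2 + (norm2 Q f3 + norm2 Q f4) + norm2 Q f5.
  have -> : 2 * norm2 Q (al k') = norm2 Q (fun t => 2 * al k' t).
    by rewrite norm2Z// ger0_norm.
  under eq_fun do rewrite E.
  apply: le_trans (norm2_triangle (L2D (L2D L1 L2') (L2D L3 L4)) L5) _.
  rewrite lerD2r; apply: le_trans (norm2_triangle (L2D L1 L2') (L2D L3 L4)) _.
  by apply: lerD; exact: norm2_triangle.
lra.
Qed.

Lemma near_averages_cauchy e : 0 < e -> exists J, forall l k, (J <= l)%N -> (J <= k)%N ->
  norm2 Q (fun t => al l t - al k t) <= e.
Proof.
move=> e0; have [m [m0 [mle mge]]] := norm_limit.
(* With all errors below h <= 1, the parallelogram identity bounds the squared distance by 20 m h +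
   4 h^2, which is at most h (24 m + 4). *)
pose h := Num.min 1 (e ^+ 2 / (24 * m + 4)).
have d0 : 0 < 24 * m + 4 by rewrite ltr_wpDl// mulr_ge0.
have h0 : 0 < h by rewrite lt_min ltr01 divr_gt0// exprn_gt0.
have h1 : h <= 1 by rewrite ge_min lexx.
have he : h * (24 * m + 4) <= e ^+ 2.
  by rewrite -ler_pdivlMr// ge_min lexx orbT.
have [J1 J1P] := mge _ h0; have h20 : 0 < h by [].
have [J2 J2P] := cvg0_lt eps0 h20.
exists (maxn i0 (maxn J1 J2)).
suff H l k : (l <= k)%N -> (maxn i0 (maxn J1 J2) <= l)%N -> norm2 Q (fun t => al l t - al k t) <= e.
  move=> l k Jl Jk; have [lk|/ltnW kl] := leqP l k; first exact: H.
  have -> : norm2 Q (fun t => al l t - al k t) = norm2 Q (fun t => al k t - al l t).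
    by rewrite /norm2; congr (Num.sqrt (mean Q _)); apply/funext => t; rewrite -sqrrN opprB.
  exact: H.
move=> lk; rewrite !geq_max => /andP[i0l /andP[J1l J2l]].
have epsl := J2P _ J2l; have epsk := J2P _ (leq_trans J2l lk).
rewrite !ger0_norm// in epsl epsk.
have nl := J1P _ J1l; have nk := J1P _ (leq_trans J1l lk).
have half := norm_half_sum mle i0l lk.
have nl0 := norm2_ge0 Q (al l); have nk0 := norm2_ge0 Q (al k).
rewrite -(@ler_pXn2r _ 2) ?nnegrE ?norm2_ge0 ?(ltW e0)//.
rewrite norm2_parallelogram// norm2Z ?ger0_norm//; last exact: L2D.
have s0 := norm2_ge0 Q (fun t => al l t + al k t).
move: half nl nk nl0 nk0 s0.
move: (norm2 Q (fun t => al l t + al k t)) (norm2 Q (al l)) (norm2 Q (al k)) =>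
  s a b half nl nk a0 b0 s0.
have sh : 2 * m - 3 * h <= s by lra.
have s2 : 4 * m ^+ 2 - 12 * m * h <= s ^+ 2.
  (* The lower bound [sh] can be squared only if it is nonnegative; otherwise the claim has a
     nonpositive left side. *)
  have [mh|mh] := leP (2 * m) (3 * h); first by nra.
  have : (2 * m - 3 * h) ^+ 2 <= s ^+ 2 by rewrite lerXn2r ?nnegrE//; lra.
  by have := sqr_ge0 h; nra.
have a2 : a ^+ 2 <= (m + h) ^+ 2 by rewrite lerXn2r ?nnegrE//; lra.
have b2 : b ^+ 2 <= (m + h) ^+ 2 by rewrite lerXn2r ?nnegrE//; lra.
rewrite exprMn; apply: le_trans he.
have : 2 * a ^+ 2 + 2 * b ^+ 2 - 4 * (2^-1 ^+ 2 * s ^+ 2) = 2 * a ^+ 2 + 2 * b ^+ 2 - s ^+ 2.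
  by field.
move=> ->; nra.
Qed.

End near_averages.

(** * Almost everywhere limits and their constancy under ergodicity *)

Section almost_everywhere_limits.
Context d (T : measurableType d) (R : realType) (Q : probability T R).

Lemma ae_summable (f : nat -> T -> R) (C : R) : 0 <= C -> (forall i, integrableR Q (f i)) ->
  (forall i, mean Q (fun t => `|f i t|) <= C * 2^-1 ^+ i) ->
  {ae Q, forall t, cvgn (series (f ^~ t))}.
Proof.
move=> C0 If fC.
have mf i : measurable_fun setT (fun t => (`|f i t|)%:E).
  by apply/measurable_EFinP; exact: integrableR_measurable (integrableR_norm (If i)).
pose g t : \bar R := (\sum_(i <oo) (`|f i t|)%:E)%E.
have mg : measurable_fun setT g.
  by apply: ge0_emeasurable_sum => // i t _ _; rewrite lee_fin.
have Ig : Q.-integrable setT g.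
  apply/integrableP; split => //.
  under eq_integral do rewrite gee0_abs ?nneseries_ge0//.
  rewrite integral_nneseries//.
  apply: (@le_lt_trans _ _ (C * (1 - 2^-1)^-1)%:E); last exact: ltry.
  apply: lime_le; first by apply: is_cvg_nneseries => i _ _; exact: integral_ge0.
  apply: nearW => n.
  have E i := mean_EFin (integrableR_norm (If i)).
  under eq_bigr do rewrite E.
  rewrite sumEFin lee_fin.
  apply: le_trans (_ : series (geometric C 2^-1) n <= _); last first.
    by apply: geometric_le_lim => //; rewrite ger0_norm ?invf_lt1 ?ltr1n.
  by rewrite /series /=; apply: ler_sum => i _; exact: fC.
apply: filterS (integrable_ae measurableT Ig) => t /(_ I) gt.
apply: normed_cvg; apply: nondecreasing_is_cvgn.
  by apply: nondecreasing_series => i _ _; exact: normr_ge0.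
exists (fine (g t)) => _ [n _ <-] /=; rewrite -lee_fin fineK// -sumEFin.
exact: nneseries_lim_ge.
Qed.

Lemma ae_cvg0 (f : nat -> T -> R) (C : R) J : 0 <= C -> (forall i, integrableR Q (f i)) ->
  (forall i, (J <= i)%N -> mean Q (fun t => `|f i t|) <= C * 2^-1 ^+ i) ->
  {ae Q, forall t, f i t @[i --> \oo] --> 0}.
Proof.
move=> C0 If fC.
have H := @ae_summable (fun i => f (i + J)%N) C C0 (fun i => If _).
apply: filterS (H _) => [t /cvg_series_cvg_0|i]; first by move=> h; rewrite -(cvg_shiftn J).
apply: le_trans (fC _ (leq_addl _ _)) _.
rewrite ler_wpM2l// exprD ler_piMr ?exprn_ge0 ?invr_ge0//.
by rewrite exprn_ile1 ?invr_ge0// invf_le1 ?ler1n.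
Qed.

Lemma ae_not (I : set T) : measurable I -> Q I = 0%E -> {ae Q, forall t, ~ I t}.
Proof.
by move=> mI QI; exists I; split => // t /= /contrapT.
Qed.

Lemma ae_in (I : set T) : measurable I -> Q I = 1%E -> {ae Q, forall t, I t}.
Proof.
move=> mI QI; exists (~` I); split => //; first exact: measurableC.
have := probability_setC Q mI; rewrite QI => ->.
by rewrite subee.
Qed.

Lemma ae_exists (I : set T) : {ae Q, forall t, I t} -> exists t, I t.
Proof.
move=> aeI; have Q0 : (0 < Q [set: T])%E by rewrite probability_setT lte01.
have PF := ae_properfilter_algebraOfSetsType Q0.
exact: (@filter_ex _ _ PF _ aeI).
Qed.

(** The distribution function of h only takes the values 0 and 1, so it jumps once, at the infimum
    of A. Finiteness almost everywhere makes A nonempty and bounded below. *)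
Lemma zero_one_const (h : T -> \bar R) : measurable_fun setT h ->
  {ae Q, forall t, h t \is a fin_num} ->
  (forall c : R, Q [set t | (h t <= c%:E)%E] = 0%E \/ Q [set t | (h t <= c%:E)%E] = 1%E) ->
  exists c : R, {ae Q, forall t, h t = c%:E}.
Proof.
move=> mh hfin h01.
have mI c : measurable [set t | (h t <= c%:E)%E].
  by apply: measurable_bool; exact: measurable_fun_lee.
pose A := [set c : R | Q [set t | (h t <= c%:E)%E] = 1%E].
have AS c c' : c <= c' -> A c -> A c'.
  move=> cc' Ac; have [h0|//] := h01 c'.
  have : (Q [set t | (h t <= c%:E)%E] <= Q [set t | (h t <= c'%:E)%E])%E.
    by apply: le_measure; rewrite ?inE// => t /= /le_trans; apply; rewrite lee_fin.
  by rewrite Ac h0 lee_fin ler10.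
have A0 : A !=set0.
  apply: contrapT => /forallNP nA.
  have : {ae Q, forall t, forall n : nat, ~ (h t <= n%:R%:E)%E}.
    apply: ae_foralln => n; apply: (ae_not (mI n%:R)).
    by have [//|h1] := h01 n%:R; case: (nA _ h1).
  move=> ae1; have [t [ht nt]] := ae_exists (filterI hfin ae1).
  apply: (nt (Num.truncn (fine (h t))).+1); rewrite -(fineK ht) lee_fin ltW//.
  exact: truncnS_gt.
have [b Ab] : exists b, ~ A b.
  apply: contrapT => /forallNP nA.
  have : {ae Q, forall t, forall n : nat, (h t <= (- n%:R)%:E)%E}.
    by apply: ae_foralln => n; apply: (ae_in (mI (- n%:R))); apply: contrapT; exact: (nA (- n%:R)).
  move=> ae1; have [t [ht nt]] := ae_exists (filterI hfin ae1).
  have := nt (Num.truncn (- fine (h t))).+1; rewrite -(fineK ht) lee_fin lerNr leNgt.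
  by rewrite truncnS_gt.
have hA : has_inf A.
  split => //; exists b => c Ac; rewrite leNgt; apply/negP => cb.
  by apply: Ab; apply: AS Ac; exact: ltW.
exists (inf A).
have e0 n : 0 < n.+1%:R^-1 :> R by rewrite invr_gt0 ltr0n.
have up n : {ae Q, forall t, (h t <= (inf A + n.+1%:R^-1)%:E)%E}.
  apply: (ae_in (mI _)); have [c Ac cn] := inf_adherent (e0 n) hA.
  by apply: AS Ac; exact: ltW.
have lo n : {ae Q, forall t, ~ (h t <= (inf A - n.+1%:R^-1)%:E)%E}.
  apply: (ae_not (mI _)); have [//|An] := h01 (inf A - n.+1%:R^-1).
  have : inf A <= inf A - n.+1%:R^-1 by apply: ge_inf An; case: hA.
  by rewrite lerBrDr gerDl leNgt e0.
apply: filterS (filterI hfin (filterI (ae_foralln up) (ae_foralln lo))) => t [ht [hu hl]].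
rewrite -(fineK ht); congr EFin; apply/eqP; rewrite eq_le; apply/andP; split.
  apply/ler_addgt0Pr => e ee; have [n ne] : exists n, n.+1%:R^-1 < e.
    exists (Num.truncn e^-1); rewrite -[ltRHS]invrK ltf_pV2 ?posrE ?invr_gt0 ?ltr0n//.
    exact: truncnS_gt.
  have := hu n; rewrite -{1}(fineK ht) lee_fin => /le_trans; apply.
  by rewrite lerD2l ltW.
apply/ler_addgt0Pr => e ee; have [n ne] : exists n, n.+1%:R^-1 < e.
  exists (Num.truncn e^-1); rewrite -[ltRHS]invrK ltf_pV2 ?posrE ?invr_gt0 ?ltr0n//.
  exact: truncnS_gt.
have := hl n; rewrite -{1}(fineK ht) lee_fin => /negP; rewrite -ltNge ltrBlDr => /ltW /le_trans.
by apply; rewrite lerD2l ltW.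
Qed.

End almost_everywhere_limits.

Section ergodic_limit.
Context d (T : measurableType d) (R : realType) (Q : probability T R).
Context (G : zmodType) (tau : G -> T -> T).
Context (mtau : forall x, measurable_fun [set: T] (tau x)).
Context (Qtau : forall x I, measurable I -> Q (tau x @^-1` I) = Q I).
Context (al : nat -> T -> R) (Lal : forall j, L2 Q (al j)).
Context (al_cauchy : forall e, 0 < e -> exists J, forall l k, (J <= l)%N -> (J <= k)%N ->
  norm2 Q (fun t => al l t - al k t) <= e).
Context (al_shift : forall x, exists C J, 0 <= C /\ forall j, (J <= j)%N ->
  mean Q (fun t => `|al j t - al j (tau x t)|) <= C * 2^-1 ^+ j).
Context (ergodic : forall I, measurable I ->
  (forall x, Q ((I `\` tau x @^-1` I) `|` (tau x @^-1` I `\` I)) = 0%E) ->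
  Q I = 0%E \/ Q I = 1%E).

Let half_gt0 i : 0 < 2^-1 ^+ i :> R.
Proof. by rewrite exprn_gt0// invr_gt0. Qed.

(** A fast subsequence converges almost everywhere; its limit is invariant because the shift errors
    are summable, hence constant by ergodicity. Fatou's lemma returns to the whole sequence. *)
Lemma cauchy_ergodic_limit : exists c : R,
  mean Q (fun t => `|al j t - c|) @[j --> \oo] --> 0.
Proof.
have [J JP] := choice (fun i : nat => al_cauchy (half_gt0 i)).
(* The sum puts both [phi i] and [phi i.+1] beyond [J i]; the term i makes [phi] tend to
   infinity. *)
pose phi i := (\sum_(k < i.+1) J k + i)%N.
have phiJ i : (J i <= phi i)%N by rewrite /phi big_ord_recr /=; lia.
have phiJS i : (J i <= phi i.+1)%N by rewrite /phi !big_ord_recr /=; lia.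
have phi_ge i : (i <= phi i)%N by rewrite /phi leq_addl.
pose u i := al (phi i).
have Iu i : integrableR Q (u i) by exact: (L2_integrable (Lal _)).
have IB f g : L2 Q f -> L2 Q g -> integrableR Q (fun t => f t - g t).
  by move=> Lf Lg; exact/L2_integrable/L2B.
have mu i : measurable_fun setT (u i) by exact: integrableR_measurable.
have Idu i : integrableR Q (fun t => u i.+1 t - u i t) by exact: (IB _ _ (Lal _) (Lal _)).
have cvgu : {ae Q, forall t, cvgn (u ^~ t)}.
  apply: filterS (ae_summable (C := 1) _ Idu _) => //; last first.
    move=> i; rewrite mul1r; apply: le_trans (mean_le_norm2 _) _; first exact: (L2B (Lal _) (Lal _)).
    exact: JP.
  move=> t cs; have E : u ^~ t = (fun n => u 0%N t + series (telescope (u ^~ t)) n).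
    by apply/funext => n; exact: eq_sum_telescope.
  by rewrite E; apply: is_cvgD; [exact: is_cvg_cst|exact: cs].
(* The upper limit is defined and measurable everywhere, and equals the limit wherever the latter
   exists. *)
pose h t := limn_esup (fun i => (u i t)%:E).
have mh : measurable_fun setT h.
  by apply: measurable_fun_limn_esup => i; exact/measurable_EFinP.
have h_lim t l : u i t @[i --> \oo] --> l -> h t = l%:E.
  move=> ul; have ul' : (u i t)%:E @[i --> \oo] --> l%:E by apply: cvg_EFin => //; exact: nearW.
  by have [_ e] := cvg_limn_einf_sup ul'; exact: e.
have h_inv x : {ae Q, forall t, h (tau x t) = h t}.
  have [C [J' [C0 CJ]]] := al_shift x.
  have Ish i : integrableR Q (fun t => al i t - al i (tau x t)).
    apply: (IB _ _ (Lal _)); split; first exact: (measurableT_comp (Lal i).1 (mtau x)).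
    exact: (integrableR_tau mtau Qtau x (Lal i).2).
  have := @ae_cvg0 _ _ _ Q (fun i t => u i t - u i (tau x t)) C J' C0 (fun i => Ish _).
  have rate i : (J' <= i)%N -> mean Q (fun t => `|u i t - u i (tau x t)|) <= C * 2^-1 ^+ i.
    move=> J'i; apply: le_trans (CJ _ (leq_trans J'i (phi_ge i))) _.
    rewrite ler_wpM2l// -(subnK (phi_ge i)) exprD ler_piMl ?(ltW (half_gt0 _))//.
    by rewrite exprn_ile1 ?invr_ge0// invf_le1 ?ler1n.
  move=> /(_ rate) cvg_diff.
  apply: filterS (filterI cvgu cvg_diff) => t [/cvg_ex[l ul] dl].
  rewrite (h_lim t l ul); apply: h_lim.
  have -> : (fun i => u i (tau x t)) = (fun i => u i t - (u i t - u i (tau x t))).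
    by apply/funext => i; rewrite subKr.
  by rewrite -[l]subr0; exact: cvgB.
have hfin : {ae Q, forall t, h t \is a fin_num}.
  by apply: filterS cvgu => t /cvg_ex[l ul]; rewrite (h_lim t l ul).
have h01 (c : R) : Q [set t | (h t <= c%:E)%E] = 0%E \/ Q [set t | (h t <= c%:E)%E] = 1%E.
  apply: ergodic; first by apply: measurable_bool; exact: measurable_fun_lee.
  move=> x; have [A [mA QA hA]] := h_inv x; apply/eqP; rewrite -measure_le0 -QA.
  have mI : measurable [set t | (h t <= c%:E)%E] by apply: measurable_bool; exact: measurable_fun_lee.
  have mIx : measurable (tau x @^-1` [set t | (h t <= c%:E)%E]).
    by rewrite -[X in measurable X]setTI; exact: mtau.
  apply: le_measure; rewrite ?inE//; first by apply: measurableU; exact: measurableD.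
  by move=> t ht; apply: hA => /= e; case: ht => -[] /=; rewrite e.
have [c hc] := zero_one_const mh hfin h01.
have Lc l : L2 Q (fun t => al l t - c) by apply: L2B => //; exact: L2_cst.
exists c; apply/cvgr0Pnorm_le => e e0.
have [K KP] := al_cauchy e0; exists K => // l /= Kl.
rewrite ger0_norm ?mean_ge0//.
(* Almost everywhere |al l - c| is the lower limit of |al l - u i|, and these have mean at most e
   once both indices exceed K. *)
have fatou_l := @fatou _ _ _ Q setT measurableT (fun i t => (`|al l t - u i t|)%:E).
have mlu i : measurable_fun setT (fun t => (`|al l t - u i t|)%:E).
  by apply/measurable_EFinP; apply: measurableT_comp => //; exact: integrableR_measurable (IB _ _ (Lal l) (Lal _)).
have {}fatou_l := fatou_l mlu (fun n x _ => normr_ge0 _).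
have Elc : (\int[Q]_t (`|al l t - c|)%:E = \int[Q]_t limn_einf (fun i => (`|al l t - u i t|)%:E))%E.
  apply: ge0_ae_eq_integral => //.
  - apply/measurable_EFinP; apply: measurableT_comp => //.
    exact: integrableR_measurable (L2_integrable (Lc l)).
  - rewrite (_ : (fun t => _) = (fun t => - limn_esup (fun i => - (`|al l t - u i t|)%:E))%E).
      apply: measurableT_comp => //; apply: measurable_fun_limn_esup => i.
      by apply: measurableT_comp => //; exact: mlu.
    by apply/funext => t; rewrite limn_esupN oppeK.
  - move=> t _; rewrite limn_einf_lim; apply: lime_ge; first exact: is_cvg_einfs.
    apply: nearW => n; apply: le_ereal_inf_tmp => _ [k _ <-].
    by rewrite lee_fin.
  apply: filterS (filterI cvgu hc) => t [/cvg_ex[m um] htc] _.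
  have cm : c = m by apply: EFin_inj; rewrite -htc (h_lim t m um).
  have lim : (`|al l t - u i t|)%:E @[i --> \oo] --> (`|al l t - c|)%:E.
    apply: cvg_EFin; first exact: nearW.
    by apply: cvg_norm; apply: cvgB; [exact: cvg_cst|rewrite cm].
  by have [-> _] := cvg_limn_einf_sup lim.
rewrite -lee_fin -mean_EFin; last exact: integrableR_norm (L2_integrable (Lc l)).
rewrite Elc; apply: le_trans fatou_l _.
rewrite limn_einf_lim; apply: lime_le; first exact: is_cvg_einfs.
apply: nearW => n; apply: (@le_trans _ _ (\int[Q]_t (`|al l t - u (maxn n K) t|)%:E)%E).
  by apply: ereal_inf_lbound; exists (maxn n K) => //=; exact: leq_maxl.
rewrite mean_EFin; last by apply: integrableR_norm; exact: (IB _ _ (Lal _) (Lal _)).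
rewrite lee_fin; apply: le_trans (mean_le_norm2 (L2B (Lal l) (Lal _))) _.
by apply: KP => //; apply: leq_trans (phi_ge _); exact: leq_maxr.
Qed.

End ergodic_limit.

(** A crude mean value bound on [0, 2], an interval containing the ratios of side lengths below. It
    is the source of [volume_const]. *)
Lemma expr_sub_le (R : realDomainType) (x y : R) n : 0 <= y -> y <= x -> x <= 2 ->
  x ^+ n - y ^+ n <= (n%:R * 2 ^+ n) * (x - y).
Proof.
move=> y0 yx x2; elim: n => [|n IH]; first by rewrite subrr !mul0r.
have x0 : 0 <= x by exact: le_trans yx.
have y2 : y <= 2 by exact: le_trans x2.
have -> : x ^+ n.+1 - y ^+ n.+1 = x * (x ^+ n - y ^+ n) + y ^+ n * (x - y).
  by rewrite !exprS; ring.
have h1 : x * (x ^+ n - y ^+ n) <= 2 * (n%:R * 2 ^+ n * (x - y)).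
  apply: le_trans (ler_wpM2l x0 IH) _; apply: ler_wpM2r => //.
  by rewrite mulr_ge0 ?subr_ge0// mulr_ge0// exprn_ge0.
have h2 : y ^+ n * (x - y) <= 2 ^+ n * (x - y).
  by apply: ler_wpM2r; rewrite ?subr_ge0// lerXn2r ?nnegrE.
have h3 : 0 <= 2 ^+ n * (x - y) by rewrite mulr_ge0 ?exprn_ge0// subr_ge0.
apply: le_trans (lerD h1 h2) _.
have -> : n.+1%:R * 2 ^+ n.+1 * (x - y) =
    2 * (n%:R * 2 ^+ n * (x - y)) + 2 * (2 ^+ n * (x - y)).
  by rewrite -natr1 exprS; ring.
by rewrite lerD2l; lra.
Qed.

(** * Comparison of windows with grids *)

Section windows.
Context (R : realType) (N : nat) (F : fieldType) (q : nat).
Context (kappa : {fset 'rV[R]_N} -> \bar R) (kappaP : filtration_function kappa).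
Local Notation V := 'rV[R]_N.
Local Notation Z := 'rV[int]_N.
Context (r s : R) (rs : r <= s) (R0 : nat) (R0_gt0 : (0 < R0)%N).
Context (R0P : forall x y : V, (kappa [fset x; y]%fset <= s%:E)%E ->
  forall i, `|x ord0 i - y ord0 i| <= R0%:R).
Local Notation betti := (betti F q kappa r s).
Local Notation cost := (cost q R0).
Implicit Types (L : R) (m : nat).

(** The number of whole m-boxes that fit between the origin and a face of the window. *)
Definition grid_radius m L := Num.truncn (L / (2 * m%:R)).
Definition window_radius L := (Num.truncn (L / 2)).+1.

Definition window_grid m L : {fset Z} :=
  ibox (const_mx (- (grid_radius m L)%:Z)) (2 * grid_radius m L).

(** The ambient box is [zcube 0 (window_radius L)] unfolded: the maximal inequality controls sums
    over centred cubes. *)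
Definition window_shell m L : {fset Z} :=
  shell R0 (const_mx (- (grid_radius m L)%:Z)) (2 * grid_radius m L) m
    (0 - const_mx (window_radius L)%:Z) (2 * window_radius L).+1.

Lemma window_grid_sub m L : {subset window_grid m L <= zcube 0 (grid_radius m L)}.
Proof.
move=> g /in_ibox gP; apply/in_zcube => k; have := gP k; rewrite !mxE.
by move: (g ord0 k) (grid_radius m L) => a n; clear; lia.
Qed.

Lemma coord_bounded_window L : coord_bounded (window L : set V).
Proof.
apply: coord_boundedS (rbox_coord_bounded (const_mx (- (L / 2))) L) => x xL i.
by have := xL i; rewrite !mxE; lra.
Qed.

Lemma measurable_window L : measurable (window L : set V).
Proof.
rewrite (_ : window L = rbox (const_mx (- (L / 2))) L); first exact: measurable_rbox.
by apply/seteqP; split => x xL i; have := xL i; rewrite !mxE; lra.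
Qed.

Section fixed_window.
Context (m : nat) (L : R) (Rm : (2 * R0 <= m)%N) (L_ge0 : 0 <= L).

Let m_gt0 : 0 < m%:R :> R.
Proof. by rewrite ltr0n; lia. Qed.

Let grid_radius_le : m%:R * (grid_radius m L)%:R <= L / 2.
Proof.
have : (grid_radius m L)%:R <= L / (2 * m%:R) by rewrite truncn_le// divr_ge0// mulr_ge0.
by rewrite ler_pdivlMr ?mulr_gt0//; lra.
Qed.

Let grid_radius_gt : L / 2 - m%:R < m%:R * (grid_radius m L)%:R.
Proof.
have := truncnS_gt (L / (2 * m%:R)).
rewrite ltr_pdivrMr ?mulr_gt0// -natr1 -/(grid_radius m L); lra.
Qed.

Let grid_sub g : g \in window_grid m L -> grid_box m g `<=` window L.
Proof.
move=> /in_ibox gk x xg i; have := gk i; have := xg i; rewrite !mxE.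
rewrite -(ler_int R) -lezD1 -(ler_int R) !(rmorphD, rmorphN, rmorphM) /= -!pmulrn.
have := grid_radius_le; set k := (grid_radius m L)%:R; set a := (g ord0 i)%:~R.
move=> mk /andP[h1 h2] /andP[h3 h4].
have h5 : m%:R * - k <= m%:R * a by rewrite ler_pM2l.
have h6 : m%:R * (a + 1) <= m%:R * k by rewrite ler_pM2l//; lra.
by apply/andP; split; lra.
Qed.

Let cells_sub (x : V) : window L x ->
  cell_index 0 x \in ibox (0 - const_mx (window_radius L)%:Z : Z) (2 * window_radius L).+1.
Proof.
move=> xL; apply/in_ibox => i; have := xL i; rewrite !mxE !mul1r.
rewrite floor_ge_int floor_lt_int !(rmorphD, rmorphN) /= -!pmulrn.
have : L / 2 < (window_radius L)%:R by exact: truncnS_gt.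
by set k := (window_radius L)%:R; move=> h1 /andP[h2 h3]; apply/andP; split; lra.
Qed.

Lemma window_near_additive mu :
  `|betti mu (window L) - \sum_(g <- window_grid m L) betti mu (grid_box m g)| <=
    \sum_(z <- window_shell m L) cost mu z.
Proof. by apply: near_additive_grid => //; exact: coord_bounded_window. Qed.

Lemma window_shell_sub : {subset window_shell m L <= zcube 0 (window_radius L)}.
Proof. by move=> z; rewrite /window_shell !inE /= => /andP[]. Qed.

(** Rounding costs at most 2m in the side of the grid and 3 in that of the ambient cube; the
    threshold on L makes (2m + 3) / L at most 1/m. The collar of width R0 in each box of side m adds
    2 R0 / m, whence (2 R0 + 1) / m. *)
Lemma window_sizes : m%:R * (2 * m%:R + 3) + 3 <= L ->
  [/\ (2 * window_radius L).+1%:R <= 2 * L,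
      m%:R * (2 * grid_radius m L).+1%:R <= 2 * L,
      (#|` window_shell m L|)%:R <= (N%:R * 2 ^+ N * (2 * R0 + 1)%:R / m%:R) * L ^+ N &
      1 - N%:R * 2 ^+ N * (2 * R0 + 1)%:R / m%:R <=
        (m%:R * (2 * grid_radius m L)%:R / L) ^+ N <= 1].
Proof.
move=> Lbig.
have m1 : 1 <= m%:R :> R by rewrite ler1n; lia.
have mm : 0 <= m%:R * (2 * m%:R) :> R by rewrite !mulr_ge0.
have L0 : 0 < L by move: Lbig; rewrite mulrDr; lra.
have L3 : 3 <= L by move: Lbig; rewrite mulrDr; lra.
have Lm : m%:R * (2 * m%:R + 3) <= L by lra.
set n := (2 * window_radius L).+1%:R; set k := (2 * grid_radius m L)%:R.
have nL : L <= n /\ n <= L + 3.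
  have h1 : (Num.truncn (L / 2))%:R <= L / 2 by rewrite truncn_le// divr_ge0.
  have h2 : L / 2 < (window_radius L)%:R by exact: truncnS_gt.
  have e1 : n = (2 * window_radius L)%N%:R + 1 by rewrite /n natr1.
  have e2 : (window_radius L)%:R = (Num.truncn (L / 2))%:R + 1 :> R.
    by rewrite /window_radius natr1.
  by rewrite e1 natrM; move: h1 h2; rewrite e2; split; lra.
have kL : m%:R * k <= L /\ L - 2 * m%:R <= m%:R * k.
  have := grid_radius_le; have := grid_radius_gt; rewrite /k natrM; split; lra.
have k0 : 0 <= k by rewrite ler0n.
have mLL : 2 * m%:R <= L by move: Lm; rewrite mulrDr; nra.
have RM : 2 * R0%:R <= m%:R :> R by rewrite -natrM ler_nat.
have E : N%:R * 2 ^+ N * (2 * R0 + 1)%:R / m%:R = N%:R * 2 ^+ N * ((2 * R0 + 1)%:R / m%:R) :> R.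
  by rewrite mulrA.
have c0 : 0 <= N%:R * 2 ^+ N :> R by rewrite mulr_ge0// exprn_ge0.
have inv : (2 * m%:R + 3) / L <= m%:R^-1.
  by rewrite ler_pdivrMr// ler_pdivlMl.
split.
- by case: nL => _ nL; lra.
- by rewrite -natr1 -/k mulrDr mulr1; lra.
- rewrite (card_shell rs R0_gt0 (A := window L))// -/n -/k.
  rewrite E -ler_pdivrMr ?exprn_gt0// mulrBl -!expr_div_n.
  apply: le_trans (expr_sub_le N _ _ _) _.
  + by rewrite divr_ge0 ?mulr_ge0 ?subr_ge0// ltW.
  + rewrite ler_pM2r ?invr_gt0//; apply: le_trans nL.1; apply: le_trans kL.1.
    by rewrite mulrC; apply: ler_wpM2r => //; rewrite gerBl mulr_ge0.
  + by rewrite ler_pdivrMr//; case: nL => _ nL; lra.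
  apply: ler_wpM2l => //; rewrite -mulrBl ler_pdivrMr//.
  have : (2 * m%:R + 3) <= m%:R^-1 * L by rewrite -ler_pdivrMr.
  have h : k * (2 * R0%:R) <= L / m%:R * (2 * R0%:R).
    by apply: ler_wpM2r; rewrite ?mulr_ge0// ler_pdivlMr// mulrC kL.1.
  rewrite natrD natrM; move: nL.2 kL.2 h; rewrite mulrBr (mulrC k m%:R).
  set u := L / m%:R; rewrite (mulrC _^-1 L) -/u => a1 a2 a3 a4.
  rewrite (_ : (2 * R0%:R + 1) / m%:R * L = 2 * R0%:R * u + u); last by rewrite /u; field; rewrite gt_eqF.
  by rewrite -/u; move: a3; rewrite (mulrC u); lra.
set b := m%:R * k / L.
have b1 : b <= 1 by rewrite ler_pdivrMr// mul1r kL.1.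
have b0 : 0 <= b by rewrite divr_ge0 ?mulr_ge0// ltW.
rewrite exprn_ile1// andbT lerBlDr -lerBlDl.
have := expr_sub_le N b0 b1 (ler1n _ 2); rewrite expr1n => /le_trans; apply.
rewrite E; apply: ler_wpM2l => //.
have -> : 1 - b = (L - m%:R * k) / L by rewrite /b mulrBl divff ?gt_eqF.
apply: le_trans (_ : (2 * m%:R + 3) / L <= _).
  by rewrite ler_pM2r ?invr_gt0//; have := kL.2; lra.
apply: le_trans inv _; rewrite -[leLHS]mul1r ler_pM2r ?invr_gt0//.
by rewrite ler1n addn1.
Qed.

End fixed_window.

End windows.

(** * Almost everywhere control of the averages over all centred cubes *)

Section exceptional_averages.
Context d (T : measurableType d) (R : realType) (Q : probability T R).

Lemma ae_exists_notin (I : nat -> set T) : (forall i, measurable (I i)) ->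
  (forall e : R, 0 < e -> exists i, (Q (I i) <= e%:E)%E) ->
  {ae Q, forall t, exists i, ~ I i t}.
Proof.
move=> mI QI.
have mcap : measurable (\bigcap_i I i) by exact: bigcap_measurable.
have Q0 : Q (\bigcap_i I i) = 0%E.
  apply/eqP; rewrite eq_le measure_ge0 andbT; apply/lee_addgt0Pr => e e0.
  have [i Qi] := QI e e0; rewrite add0e; apply: le_trans Qi.
  by apply: le_measure; rewrite ?inE// => t; apply.
by apply: filterS (ae_not mcap Q0) => t /existsNP[i /not_implyP[_ nI]]; exists i.
Qed.

Context (G : zmodType) (tau : G -> T -> T).
Context (mtau : forall x, measurable_fun [set: T] (tau x)).
Context (Qtau : forall x I, measurable I -> Q (tau x @^-1` I) = Q I).
Context (tauD : forall x y t, tau x (tau y t) = tau (x + y) t).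
Context (N : nat).

(** By the maximal inequality the exceptional set at level k + 1 has measure O(1/(k+1)), so almost
    every point avoids one of them. *)
Lemma ae_average_bounded (e : 'rV[int]_N -> G) (H : T -> R) :
    (forall z w, e (z + w) = e z + e w) -> (forall t, 0 <= H t) -> integrableR Q H ->
  {ae Q, forall t, exists B : R, 0 <= B /\
    forall n, \sum_(z <- zcube 0 n) H (tau (e z) t) <= B * (2 * n).+1%:R ^+ N}.
Proof.
move=> eD H0 IH; pose I (k : nat) := large_average tau e H (k.+1%:R).
have k0 (k : nat) : 0 < k.+1%:R :> R by [].
have mI k : measurable (I k) by exact: (measurable_large_average mtau _ IH).
apply: filterS (ae_exists_notin mI _).
  move=> t [k nI]; exists k.+1%:R; split => // n; rewrite leNgt; apply/negP => /ltW large.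
  by apply: nI; exists n.
move=> u u0; pose c := 4 ^+ N * mean Q H.
have c0 : 0 <= c by rewrite mulr_ge0 ?mean_ge0// exprn_ge0.
exists (Num.truncn (c / u)).
apply: le_trans (lattice_maximal_inequality mtau Qtau tauD eD H0 IH (k0 _)) _.
rewrite lee_fin ler_pdivrMr// [leRHS]mulrC -ler_pdivrMr//.
by apply: ltW; exact: truncnS_gt.
Qed.

(** Here the level is fixed and the means tend to 0. The index i may depend on t; this is enough, as
    the grid is chosen after the measure. *)
Lemma ae_average_small (e : nat -> 'rV[int]_N -> G) (H : nat -> T -> R) lam :
    (forall i z w, e i (z + w) = e i z + e i w) -> (forall i t, 0 <= H i t) ->
    (forall i, integrableR Q (H i)) -> mean Q (H i) @[i --> \oo] --> 0 -> 0 < lam ->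
  {ae Q, forall t, forall J, exists i, (J <= i)%N /\
    forall n, \sum_(z <- zcube 0 n) H i (tau (e i z) t) <= lam * (2 * n).+1%:R ^+ N}.
Proof.
move=> eD H0 IH Hcvg lam0; apply: ae_foralln => J.
have mI i : measurable (large_average tau (e (i + J)%N) (H (i + J)%N) lam).
  exact: (measurable_large_average mtau _ (IH _)).
apply: filterS (ae_exists_notin mI _).
  move=> t [i nI]; exists (i + J)%N; split; first exact: leq_addl.
  by move=> n; rewrite leNgt; apply/negP => /ltW large; apply: nI; exists n.
move=> u u0; have u' : 0 < u * lam / 4 ^+ N by rewrite divr_gt0 ?mulr_gt0// exprn_gt0.
move/cvgr0Pnorm_le : Hcvg => /(_ _ u')[i _ iP].
exists i; apply: le_trans (lattice_maximal_inequality mtau Qtau tauD (eD _) (H0 _) (IH _) lam0) _.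
have := iP (i + J)%N (leq_addr J i).
rewrite ger0_norm ?mean_ge0// ler_pdivlMr ?exprn_gt0// => h.
by rewrite lee_fin ler_pdivrMr// mulrC.
Qed.

End exceptional_averages.

(** * Stationary point processes *)

Section stationary_betti.
Context (R : realType) (N : nat) (F : fieldType) (q : nat).
Context (kappa : {fset 'rV[R]_N} -> \bar R) (kappaP : filtration_function kappa).
Local Notation V := 'rV[R]_N.
Local Notation Z := 'rV[int]_N.
Local Notation M := (int_radon R N).
Context (r s : R) (rs : r <= s) (R0 : nat) (R0_gt0 : (0 < R0)%N).
Context (R0P : forall x y : V, (kappa [fset x; y]%fset <= s%:E)%E ->
  forall i, `|x ord0 i - y ord0 i| <= R0%:R).
Context (Q : probability M R).
Context (Qtau : forall x I, measurable I -> Q (tau x @^-1` I) = Q I).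
Context (card_moments : forall A : set V, measurable A -> coord_bounded A ->
  forall k, (0 < k)%N -> (\int[Q]_mu ((#|` points mu A|)%:R ^+ k : R)%:E < +oo)%E).
Local Notation betti := (betti F q kappa r s).
Local Notation cost := (cost q R0).
Local Notation L2 := (L2 Q).
Local Notation norm2 := (norm2 Q).
Local Notation mean := (mean Q).
Implicit Types (mu : M) (A : set V) (S : {fset Z}).

Let tauM := @measurable_tau R N.

Lemma measurable_card_pow A k : measurable A -> coord_bounded A ->
  measurable_fun [set: M] (fun mu => #|` points mu A|%:R ^+ k : R).
Proof.
move=> mA bA; apply: measurable_funX.
exact: (measurableT_comp (f := fun n : nat => n%:R : R) _ (measurable_card_points mA bA)).
Qed.

Let mblock z : measurable (block R0 z : set V).
Proof. exact: measurable_rbox. Qed.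

Let bblock z : coord_bounded (block R0 z : set V).
Proof. exact: rbox_coord_bounded. Qed.

Lemma measurable_cost z : measurable_fun [set: M] (cost ^~ z).
Proof.
by apply: measurable_funM; [exact: measurable_cst|exact: measurable_card_pow].
Qed.

Lemma L2_cost z : L2 (cost ^~ z).
Proof.
split; first exact: measurable_cost.
have k0 : (0 < q.+2 * 2)%N by [].
rewrite (_ : (fun _ => _) = (fun mu => 4 * (#|` points mu (block R0 z)|%:R ^+ (q.+2 * 2)))); last first.
  apply/funext => mu; rewrite /(cost _ _) exprMn exprM; congr (_ * _).
  by rewrite expr2 -natrM.
have mk := measurable_card_pow (q.+2 * 2) (mblock z) (bblock z).
apply: integrableRZ; apply/integrableP; split; first exact/measurable_EFinP.
apply: le_lt_trans (card_moments (mblock z) (bblock z) k0).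
rewrite le_eqVlt; apply/orP; left; apply/eqP; apply: eq_integral => mu _.
by rewrite gee0_abs// lee_fin exprn_ge0.
Qed.

Definition cost_norm := norm2 (cost ^~ 0).
Definition cost_mean := mean (cost ^~ 0).

Lemma cost_norm_ge0 : 0 <= cost_norm. Proof. exact: norm2_ge0. Qed.

Lemma norm2_cost z : norm2 (cost ^~ z) = cost_norm.
Proof.
rewrite /cost_norm -(norm2_tau tauM Qtau (real_row R z) (L2_cost 0)).
by congr norm2; apply/funext => mu; rewrite cost_tau.
Qed.

Lemma mean_cost z : mean (cost ^~ z) = cost_mean.
Proof.
rewrite /cost_mean -(mean_tau tauM Qtau (real_row R z) (L2_integrable (L2_cost 0))).
by congr mean; apply/funext => mu; rewrite cost_tau.
Qed.

Lemma L2_cost_sum S : L2 (fun mu => \sum_(z <- S) cost mu z).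
Proof. by apply: L2_sum => z; exact: L2_cost. Qed.

Lemma norm2_cost_sum S : norm2 (fun mu => \sum_(z <- S) cost mu z) <= #|` S|%:R * cost_norm.
Proof.
suff H (l : seq Z) : norm2 (fun mu => \sum_(z <- l) cost mu z) <= (size l)%:R * cost_norm.
  exact: (H S).
elim: l => [|z l IH].
  rewrite mul0r; under eq_fun do rewrite big_nil.
  by rewrite norm2_0.
under eq_fun do rewrite big_cons.
apply: le_trans (norm2_triangle (L2_cost z) (L2_sum l L2_cost)) _.
by rewrite /= -natr1 mulrDl mul1r addrC norm2_cost lerD.
Qed.

Lemma mean_cost_sum S : mean (fun mu => \sum_(z <- S) cost mu z) = #|` S|%:R * cost_mean.
Proof.
rewrite mean_sum; last by move=> z; exact: L2_integrable (L2_cost z).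
under eq_bigr do rewrite mean_cost.
by rewrite big_const_seq count_predT iter_addr_0 mulr_natl.
Qed.

(** Near additivity over an empty family of boxes. *)
Lemma betti_le_cost mu A S : coord_bounded A -> (forall x, A x -> cell_index 0 x \in S) ->
  betti mu A <= \sum_(z <- S) cost mu z.
Proof.
move=> bA AS.
have := @near_additive R N F q kappa kappaP r s rs R0 R0P mu A void (fun=> set0) S bA.
rewrite big1 ?subr0; last by case.
rewrite ger0_norm ?betti_ge0//; apply => //.
by move=> x Ax; left; exact: AS.
Qed.

Lemma L2_betti A : measurable A -> coord_bounded A -> L2 (betti ^~ A).
Proof.
move=> mA bA; have [S AS] := coord_bounded_cells 0 bA.
apply: L2_le (L2_cost_sum S) _; first exact: measurable_betti.
by move=> mu; rewrite ger0_norm ?betti_ge0//; exact: betti_le_cost.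
Qed.

Lemma norm2_le_cost S (f : M -> R) : measurable_fun setT f ->
  (forall mu, `|f mu| <= \sum_(z <- S) cost mu z) -> L2 f /\ norm2 f <= #|` S|%:R * cost_norm.
Proof.
move=> mf fS; have Lf := L2_le mf (L2_cost_sum S) fS; split => //.
by apply: le_trans (norm2_cost_sum S); apply: norm2_le => //; exact: L2_cost_sum.
Qed.

Lemma shift_grid_box m (p : Z) :
  shift_set (real_row R (m%:Z *: p)) (grid_box m 0) = grid_box m p :> set V.
Proof.
rewrite /grid_box shift_rbox; apply: (f_equal (fun a => rbox a _)).
by rewrite scaler0; apply/rowP => i; rewrite !mxE rmorph0 add0r.
Qed.

Lemma grid_box_coord_bounded m (p : Z) : coord_bounded (grid_box m p : set V).
Proof. exact: rbox_coord_bounded. Qed.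

Lemma measurable_grid_box m (p : Z) : measurable (grid_box m p : set V).
Proof. exact: measurable_rbox. Qed.

(** The box has a corner at the origin instead of its centre, so that dyadic boxes tile each other
    exactly. *)
Definition density j mu : R := ((2 ^ j)%:R ^+ N)^-1 * betti mu (grid_box (2 ^ j) 0).

Lemma L2_density j : L2 (density j).
Proof.
by apply: L2Z; apply: L2_betti; [exact: measurable_grid_box|exact: grid_box_coord_bounded].
Qed.

Lemma density_ge0 j mu : 0 <= density j mu.
Proof. by rewrite mulr_ge0 ?betti_ge0// invr_ge0 exprn_ge0. Qed.

Lemma density_tau j x mu :
  density j (tau x mu) = ((2 ^ j)%:R ^+ N)^-1 * betti mu (shift_set x (grid_box (2 ^ j) 0)).
Proof. by rewrite /density betti_tau//; exact: grid_box_coord_bounded. Qed.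

Lemma density_dyadic i (p : Z) mu : density i (tau (dyadic_row R i p) mu) =
  ((2 ^ i)%:R ^+ N)^-1 * betti mu (grid_box (2 ^ i) p).
Proof. by rewrite density_tau shift_grid_box. Qed.

Lemma cells_grid_box n (x : V) : grid_box n 0 x -> cell_index 0 x \in ibox (0 : Z) n.
Proof. by rewrite /grid_box scaler0 => /mem_real_box_cell H; apply/in_ibox. Qed.

Lemma mean_density_le j : mean (density j) <= cost_mean.
Proof.
have L := L2_integrable (L2_betti (measurable_grid_box (2 ^ j) 0) (grid_box_coord_bounded (2 ^ j) 0)).
rewrite /density meanZ// mulrC ler_pdivrMr ?exprn_gt0 ?ltr0n ?expn_gt0//.
apply: le_trans (le_mean L (L2_integrable (L2_cost_sum (ibox 0 (2 ^ j)))) _) _.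
  by move=> mu; apply: betti_le_cost; [exact: grid_box_coord_bounded|exact: cells_grid_box].
by rewrite mean_cost_sum card_ibox natrX mulrC.
Qed.

Definition volume_const : R := N%:R * 2 ^+ N.

Lemma volume_const_ge0 : 0 <= volume_const.
Proof. by rewrite mulr_ge0// exprn_ge0. Qed.

Let pow2_gt0 j : 0 < (2 ^ j)%:R :> R.
Proof. by rewrite ltr0n expn_gt0. Qed.

(** The shell occupies the fraction 1 - (1 - 2 R0 / 2^i)^N of the large box, whatever j is. *)
Lemma density_tiling i j : (2 * R0 <= i)%N -> (i <= j)%N ->
  norm2 (fun mu => density j mu - tiling_mean (@tau R N) density i j mu) <=
  cost_norm * volume_const * (2 * R0)%:R * 2^-1 ^+ i.
Proof.
move=> Ri ij; have Rm : (2 * R0 <= 2 ^ i)%N by rewrite (leq_trans Ri)// ltnW// ltn_expl.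
have E mu : density j mu - tiling_mean (@tau R N) density i j mu = ((2 ^ j)%:R ^+ N)^-1 *
   (betti mu (grid_box (2 ^ j) 0) -
    \sum_(g <- ibox (0 : Z) (2 ^ (j - i))) betti mu (grid_box (2 ^ i) g)).
  rewrite mulrBr; congr (_ - _); rewrite /tiling_mean.
  under eq_bigr do rewrite density_dyadic.
  rewrite -mulr_sumr mulrA; congr (_ * _).
  have -> : size (ibox (0 : Z) (2 ^ (j - i))) = ((2 ^ (j - i)) ^ N)%N by exact: card_ibox.
  by rewrite natrX -invfM -exprMn -natrM -expnD subnK.
pose Sh := shell R0 (0 : Z) (2 ^ (j - i)) (2 ^ i) (0 : Z) (2 ^ j).
have sub g : g \in ibox (0 : Z) (2 ^ (j - i)) -> grid_box (2 ^ i) g `<=` (grid_box (2 ^ j) 0 : set V).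
  move=> /in_ibox gk x xg i'; have := xg i'; have := gk i'; rewrite !mxE.
  rewrite mulr0 add0r !rmorph0 add0r -lezD1 -!(ler_int R) !(rmorphD, rmorphM) /= -!pmulrn.
  set a := (g ord0 i')%:~R => /andP[a0 a1] /andP[x0 x1].
  have jE : (2 ^ j)%:R = (2 ^ i)%:R * (2 ^ (j - i))%:R :> R by rewrite -natrM -expnD subnKC.
  have h0 : 0 <= (2 ^ i)%:R * a by rewrite mulr_ge0.
  have h1 : (2 ^ i)%:R * (a + 1) <= (2 ^ i)%:R * (2 ^ (j - i))%:R by rewrite ler_pM2l.
  by rewrite jE; apply/andP; split; lra.
have cells (x : V) : grid_box (2 ^ j) 0 x -> cell_index 0 x \in ibox (0 : Z) (2 ^ j).
  exact: cells_grid_box.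
pose f mu := betti mu (grid_box (2 ^ j) 0) -
    \sum_(g <- ibox (0 : Z) (2 ^ (j - i))) betti mu (grid_box (2 ^ i) g).
have mf : measurable_fun setT f.
  apply: measurable_funB.
    by apply: measurable_betti => //; [exact: measurable_grid_box|exact: grid_box_coord_bounded].
  apply: measurable_sum => g.
  by apply: measurable_betti => //; [exact: measurable_grid_box|exact: grid_box_coord_bounded].
have fS mu : `|f mu| <= \sum_(z <- Sh) cost mu z.
  by apply: near_additive_grid => //; exact: grid_box_coord_bounded.
have [Lf nf] := norm2_le_cost mf fS.
under eq_fun do rewrite E.
rewrite norm2Z// ger0_norm ?invr_ge0 ?exprn_ge0// mulrC ler_pdivrMr ?exprn_gt0//.
apply: le_trans nf _; rewrite (card_shell rs R0_gt0 Rm sub cells).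
have jE : (2 ^ j)%:R = (2 ^ i)%:R * (2 ^ (j - i))%:R :> R by rewrite -natrM -expnD subnKC.
set m := (2 ^ i)%:R : R; set k := (2 ^ (j - i))%:R : R.
have m0 : 0 < m by exact: pow2_gt0.
have k0 : 0 < k by exact: pow2_gt0.
have RM : 2 * R0%:R <= m by rewrite /m -natrM ler_nat.
have -> : (2 ^ j)%:R ^+ N - (k * (m - 2 * R0%:R)) ^+ N =
    (m * k) ^+ N * (1 ^+ N - (1 - 2 * R0%:R / m) ^+ N).
  have -> : k * (m - 2 * R0%:R) = (m * k) * (1 - 2 * R0%:R / m) by field; rewrite gt_eqF.
  by rewrite jE -/m -/k [X in _ - X]exprMn expr1n mulrBr mulr1.
have h : 1 ^+ N - (1 - 2 * R0%:R / m) ^+ N <= volume_const * (2 * R0%:R / m).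
  apply: le_trans (expr_sub_le N _ _ _) _; rewrite ?ler1n//.
  - by rewrite subr_ge0 ler_pdivrMr// mul1r.
  - by rewrite gerBl divr_ge0 ?mulr_ge0// ltW.
  by rewrite opprB addrC subrK.
rewrite jE -/m -/k natrM.
have -> : cost_norm * volume_const * (2 * R0%:R) * 2^-1 ^+ i * (m * k) ^+ N =
   (m * k) ^+ N * (volume_const * (2 * R0%:R / m)) * cost_norm.
  by rewrite exprVn /m natrX; ring.
by apply: ler_wpM2r; [exact: cost_norm_ge0|apply: ler_wpM2l => //; rewrite exprn_ge0// mulr_ge0// ltW].
Qed.

Lemma shift_setD (x y : V) A : shift_set y (shift_set x A) = shift_set (x + y) A.
Proof.
by apply/seteqP; split => u; rewrite /shift_set /= opprD addrA addrAC.
Qed.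

(** For such x the moved box contains [0, n - 2w)^N and is contained in [-2w, n)^N, so one shell
    serves all these x; the grid consists of a single box. *)
Lemma shifted_box_bound (n w : nat) (x : V) mu : (2 * R0 <= n - 2 * w)%N -> (2 * w <= n)%N ->
    (forall i, - (2 * w)%:R <= x ord0 i <= 0) ->
  let Sh := shell R0 (0 : Z) 1 (n - 2 * w) (const_mx (- (2 * w)%N%:Z)) (n + 2 * w) in
  `|betti mu (shift_set x (grid_box n 0)) - betti mu (grid_box (n - 2 * w) 0)| <=
     \sum_(z <- Sh) cost mu z /\
  #|` Sh|%:R = (n + 2 * w)%:R ^+ N - ((n - 2 * w)%:R - 2 * R0%:R) ^+ N :> R.
Proof.
move=> Rn wn xw Sh.
have i01 : ibox (0 : Z) 1 = [fset 0]%fset.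
  apply/fsetP => g; rewrite inE; apply/in_ibox/eqP => [H|->]; last first.
    by move=> i; rewrite !mxE.
  by apply/rowP => i; have := H i; rewrite !mxE; move: (g ord0 i) => a; lia.
have sub g : g \in ibox (0 : Z) 1 -> grid_box (n - 2 * w) g `<=` shift_set x (grid_box n 0).
  rewrite i01 inE => /eqP -> u un i; have := un i; have := xw i; rewrite !mxE.
  by rewrite !mulr0 !rmorph0 !add0r natrB// => /andP[a1 a2] /andP[b1 b2]; apply/andP; split; lra.
have cells u : shift_set x (grid_box n 0) u ->
    cell_index 0 u \in ibox (const_mx (- (2 * w)%N%:Z) : Z) (n + 2 * w).
  move=> un; apply/in_ibox => i; have := un i; have := xw i; rewrite !mxE.
  have e : - (2 * w)%N%:Z + (n + 2 * w)%N%:Z = n%:Z by lia.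
  rewrite !mulr0 !rmorph0 !add0r mul1r floor_ge_int floor_lt_int e.
  by rewrite rmorphN /= -!pmulrn => /andP[a1 a2] /andP[b1 b2]; apply/andP; split; lra.
split; last by rewrite (card_shell rs R0_gt0 Rn sub cells) mul1r.
have := near_additive_grid F q kappaP rs R0_gt0 R0P mu Rn
  (coord_bounded_shift x (grid_box_coord_bounded n 0)) sub cells.
by rewrite i01 big_seq_fset1.
Qed.

Lemma density_shift (x : V) : exists C J, 0 <= C /\ forall j, (J <= j)%N ->
  norm2 (fun mu => density j mu - density j (tau x mu)) <= C * 2^-1 ^+ j.
Proof.
have [w xw] : exists w : nat, forall i, `|x ord0 i| <= w%:R.
  exists (Num.truncn (\sum_i `|x ord0 i|)).+1 => i; apply: ltW.
  by apply: le_lt_trans (truncnS_gt _); rewrite (bigD1 i)//= lerDl sumr_ge0.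
pose C := 2 * (cost_norm * volume_const * (4 * w + 2 * R0)%:R).
exists C, (2 * w + 2 * R0)%N; split.
  by rewrite !mulr_ge0// ?cost_norm_ge0// volume_const_ge0.
move=> j wj; have [n nE] : exists n, n = (2 ^ j)%N by exists (2 ^ j)%N.
have wn : (2 * w + 2 * R0 <= n)%N by rewrite nE (leq_trans wj)// ltnW// ltn_expl.
have n0 : 0 < n%:R :> R by rewrite nE; exact: pow2_gt0.
have nN0 : 0 < n%:R ^+ N :> R by rewrite exprn_gt0.
have wn1 : (2 * R0 <= n - 2 * w)%N by lia.
have wn2 : (2 * w <= n)%N by lia.
(* Subtracting y brings both shifts 0 and x into the range of [shifted_box_bound]; the measure is
   moved by [tau y] in exchange. *)
pose y : V := const_mx w%:R.
pose Sh := shell R0 (0 : Z) 1 (n - 2 * w) (const_mx (- (2 * w)%N%:Z)) (n + 2 * w).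
have key (x' : V) : (forall i, `|x' ord0 i| <= w%:R) ->
    (forall mu, `|betti mu (shift_set (x' - y) (grid_box n 0)) - betti mu (grid_box (n - 2 * w) 0)| <=
     \sum_(z <- Sh) cost mu z) /\
    #|` Sh|%:R = (n + 2 * w)%:R ^+ N - ((n - 2 * w)%:R - 2 * R0%:R) ^+ N :> R.
  move=> xw'; have H i : - (2 * w)%:R <= (x' - y) ord0 i <= 0.
    by have := xw' i; rewrite !mxE ler_norml natrM; lra.
  split; last by case: (shifted_box_bound point wn1 wn2 H).
  by move=> mu; case: (shifted_box_bound mu wn1 wn2 H).
have z0 i : `|(0 : V) ord0 i| <= w%:R by rewrite mxE normr0.
have [key0 card_Sh] := key 0 z0; have [keyx _] := key x xw.
(* Both values are within the same cost sum of a common one, so half their difference is bounded by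
   a single copy of it. *)
pose f mu := 2^-1 * (betti mu (grid_box n 0) - betti mu (shift_set x (grid_box n 0))).
have E mu : density j mu - density j (tau x mu) = (2 * (n%:R ^+ N)^-1) * f mu.
  rewrite density_tau /density /f -nE; set a := betti _ _; set b := betti _ _.
  by rewrite mulrACA mulfV ?pnatr_eq0// mul1r mulrBr.
have mB A : measurable A -> coord_bounded A -> measurable_fun setT (betti ^~ A).
  by move=> mA bA; exact: measurable_betti.
have mf : measurable_fun setT f.
  apply: measurable_funM => //; apply: measurable_funB.
    by apply: mB; [exact: measurable_grid_box|exact: grid_box_coord_bounded].
  rewrite /grid_box shift_rbox.
  by apply: mB; [exact: measurable_rbox|exact: rbox_coord_bounded].
have f_tau mu : f mu = 2^-1 * (betti (tau y mu) (shift_set (0 - y) (grid_box n 0)) -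
    betti (tau y mu) (shift_set (x - y) (grid_box n 0))).
  have b0 u : coord_bounded (shift_set u (grid_box n 0 : set V)).
    exact: coord_bounded_shift (grid_box_coord_bounded n 0).
  have bE u : betti (tau y mu) (shift_set (u - y) (grid_box n 0)) =
      betti mu (shift_set u (grid_box n 0)).
    by rewrite betti_tau; [rewrite shift_setD subrK|exact: kappaP|exact: b0].
  have s0 : shift_set 0 (grid_box n 0) = grid_box n 0 :> set V.
    by apply/seteqP; split => u; rewrite /shift_set /= subr0.
  by rewrite /f (bE 0) (bE x) s0.
have fS mu : `|f mu| <= \sum_(z <- Sh) cost (tau y mu) z.
  by rewrite f_tau; apply: half_diff_le (key0 (tau y mu)) (keyx (tau y mu)).
have LS : L2 (fun mu => \sum_(z <- Sh) cost (tau y mu) z).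
  exact: (L2_tau tauM Qtau y (L2_cost_sum Sh)).
have Lf : L2 f by exact: L2_le mf LS fS.
have nf : norm2 f <= #|` Sh|%:R * cost_norm.
  apply: le_trans (norm2_le Lf LS fS) _.
  by rewrite (norm2_tau tauM Qtau y (L2_cost_sum Sh)) norm2_cost_sum.
under eq_fun do rewrite E.
rewrite norm2Z// ger0_norm; last by rewrite mulr_ge0// invr_ge0 ltW.
apply: (@le_trans _ _ (2 * (n%:R ^+ N)^-1 * (#|` Sh|%:R * cost_norm))).
  by apply: ler_wpM2l => //; rewrite mulr_ge0// invr_ge0 ltW.
rewrite card_Sh /C.
have h : ((n + 2 * w)%:R ^+ N - ((n - 2 * w)%:R - 2 * R0%:R) ^+ N) / n%:R ^+ N <=
   volume_const * ((4 * w + 2 * R0)%:R / n%:R) :> R.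
  rewrite mulrBl -!expr_div_n natrB// (natrD _ n) (natrD _ (4 * w)%N).
  rewrite (natrM _ 4 w) (natrM _ 2 w) (natrM _ 2 R0).
  have e1 : 2 * w%:R + 2 * R0%:R <= n%:R :> R by rewrite -!natrM -natrD ler_nat.
  apply: le_trans (expr_sub_le N _ _ _) _.
  - by apply: divr_ge0; [lra|exact: ltW].
  - by rewrite ler_pM2r ?invr_gt0//; have := ler0n R w; have := ler0n R R0; lra.
  - by rewrite ler_pdivrMr//; have := ler0n R R0; lra.
  apply: ler_wpM2l; first exact: volume_const_ge0.
  by rewrite -mulrBl ler_pM2r ?invr_gt0//; lra.
have := ler_wpM2l (mulr_ge0 (ler0n R 2) cost_norm_ge0) h.
have -> : 2^-1 ^+ j = n%:R^-1 :> R by rewrite nE natrX exprVn.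
set a := _ - _; set k := (4 * w + 2 * R0)%:R => h'.
rewrite [leLHS](_ : _ = 2 * cost_norm * (a / n%:R ^+ N)); last by ring.
by rewrite [leRHS](_ : _ = 2 * cost_norm * (volume_const * (k / n%:R)))//; ring.
Qed.

Lemma L2_window (L : R) : L2 (betti ^~ (window L)).
Proof. by apply: L2_betti; [exact: measurable_window|exact: coord_bounded_window]. Qed.

Lemma density_cauchy e : 0 < e -> exists J, forall l k, (J <= l)%N -> (J <= k)%N ->
  norm2 (fun mu => density l mu - density k mu) <= e.
Proof.
pose C := cost_norm * volume_const * (2 * R0)%:R.
move=> e0; have C0 : 0 <= C by rewrite !mulr_ge0 ?volume_const_ge0 ?cost_norm_ge0.
apply: (near_averages_cauchy tauM Qtau (@tauD R N) L2_density (eps := fun i => C * 2^-1 ^+ i)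
  _ (cvg_geometric0 C) density_tiling _ e0).
  by move=> i; rewrite mulr_ge0// exprn_ge0// invr_ge0.
move=> x; have [c [J [c0 cJ]]] := density_shift x.
apply: (@squeeze_cvgr _ _ _ _ (fun=> 0) (fun j => c * 2^-1 ^+ j)).
- by exists J => // j /= Jj; rewrite norm2_ge0 cJ.
- exact: cvg_cst.
- exact: cvg_geometric0.
Qed.

Lemma mean_density_cvg : exists b : R, mean (density j) @[j --> \oo] --> b.
Proof.
suff H : cauchy ((fun j => mean (density j) : R) @ \oo) by apply/cvg_ex; exact: cauchy_cvg.
apply: cauchy_exP => e e0.
have e2 : 0 < e / 2 by rewrite divr_gt0.
have [J JP] := density_cauchy e2.
exists (mean (density J)); exists J => // k /= Jk; rewrite /ball /=.
apply: le_lt_trans (_ : e / 2 < e); last by lra.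
have IJ := L2_integrable (L2_density J); have Ik := L2_integrable (L2_density k).
rewrite -meanB//.
have L2d := L2B (L2_density J) (L2_density k).
apply: le_trans (norm_mean (L2_integrable L2d)) _.
by apply: le_trans (mean_le_norm2 L2d) _; exact: JP.
Qed.

Definition window_const : R := volume_const * (2 * R0 + 1)%:R.

Lemma mean_grid_box i (p : Z) :
  mean (betti ^~ (grid_box (2 ^ i) p)) = (2 ^ i)%:R ^+ N * mean (density i).
Proof.
have m0 : (2 ^ i)%:R ^+ N != 0 :> R by rewrite expf_neq0// pnatr_eq0 expn_eq0.
rewrite -(mean_tau tauM Qtau (dyadic_row R i p) (L2_integrable (L2_density i))).
rewrite -meanZ; last first.
  by apply: (integrableR_tau tauM Qtau); exact: (L2_integrable (L2_density i)).
congr mean; apply/funext => mu.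
by rewrite density_dyadic mulVKf.
Qed.

(** The factor 2 combines the mean cost of the shell with the volume missed by the grid, whose
    density is at most [cost_mean]. *)
Lemma mean_window i (L : R) : (2 * R0 <= i)%N ->
    (2 ^ i)%:R * (2 * (2 ^ i)%:R + 3) + 3 <= L ->
  `|mean (betti ^~ (window L)) / L ^+ N - mean (density i)| <=
  2 * cost_mean * window_const * 2^-1 ^+ i.
Proof.
move=> Ri; have [m mE] : exists m, m = (2 ^ i)%N by exists (2 ^ i)%N.
have -> : 2^-1 ^+ i = m%:R^-1 :> R by rewrite mE natrX exprVn.
rewrite -mE => Lm.
have Rm : (2 * R0 <= m)%N by rewrite mE (leq_trans Ri)// ltnW// ltn_expl.
have m0 : 0 < m%:R :> R by rewrite mE ltr0n expn_gt0.
have L0 : 0 < L.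
  by apply: lt_le_trans Lm; rewrite ltr_wpDl// mulr_ge0 ?ltW// ltr_wpDl// mulr_ge0// ltW.
have [_ _ shellK /andP[rho1 rho2]] := window_sizes N rs R0_gt0 Rm (ltW L0) Lm.
have Ib g : integrableR Q (betti ^~ (grid_box m g)).
  apply: L2_integrable; apply: L2_betti => //; [exact: measurable_grid_box|exact: grid_box_coord_bounded].
pose f mu := betti mu (window L) - \sum_(g <- window_grid N m L) betti mu (grid_box m g).
have Is := integrableR_sum (window_grid N m L) Ib.
have Iw := L2_integrable (L2_window L).
have meanf : mean f = mean (betti ^~ (window L)) -
    (m%:R * (2 * grid_radius m L)%:R) ^+ N * mean (density i).
  rewrite /f meanB// mean_sum//; apply: (f_equal (fun u => _ - u)).
  rewrite (eq_bigr (fun=> m%:R ^+ N * mean (density i))) => [|g _]; last first.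
    by rewrite mE; exact: mean_grid_box.
  rewrite big_const_seq count_predT iter_addr_0 card_ibox.
  by rewrite -[LHS]mulr_natl mulrCA mulrA exprMn natrX.
have If : integrableR Q f by exact: integrableRB.
have Lc := L2_cost_sum.
have fle : `|mean f| <= #|` window_shell N R0 m L|%:R * cost_mean.
  apply: le_trans (norm_mean If) _.
  rewrite -mean_cost_sum.
  apply: le_mean; [exact: integrableR_norm|exact: L2_integrable (Lc _)|move=> mu].
  exact: (window_near_additive F q kappaP rs R0_gt0 R0P Rm (ltW L0)).
move: (mean_density_le i) fle meanf.
move: (mean_ge0 Q (density_ge0 i)).
set a := mean (density i); set W := mean (betti ^~ (window L)).
set k := (2 * grid_radius m L)%:R in rho1 rho2 *; set S := #|` _|%:R in shellK *.
move: (cost_mean) (mean f) => c F0 a0 ac; rewrite -[N%:R * 2 ^+ N * _]/window_const in rho1 shellK *.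
move=> F1 F2.
have LN0 : 0 < L ^+ N by rewrite exprn_gt0.
have c0 : 0 <= c by exact: le_trans ac.
have -> : W / L ^+ N - a = F0 / L ^+ N + ((m%:R * k / L) ^+ N - 1) * a.
  by rewrite F2 expr_div_n; field; rewrite gt_eqF.
apply: le_trans (ler_normD _ _) _.
have h1 : `|F0 / L ^+ N| <= c * (window_const / m%:R).
  rewrite normrM normfV (ger0_norm (ltW LN0)) ler_pdivrMr//.
  apply: le_trans F1 _; rewrite mulrC -mulrA; exact: ler_wpM2l.
have h2 : `|((m%:R * k / L) ^+ N - 1) * a| <= c * (window_const / m%:R).
  rewrite normrM (ger0_norm a0) mulrC; apply: ler_pM => //.
  by rewrite ler0_norm ?subr_le0// opprB lerBlDr addrC -lerBlDr.
rewrite [leRHS](_ : _ = c * (window_const / m%:R) + c * (window_const / m%:R)); last by ring.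
exact: lerD.
Qed.

Lemma mean_window_cvg (b : R) : mean (density j) @[j --> \oo] --> b ->
  mean (betti ^~ (window L)) / L ^+ N @[L --> +oo] --> b.
Proof.
move=> ab; apply/cvgrPdist_le => e e0; have e2 : 0 < e / 2 by rewrite divr_gt0.
have := cvg_geometric0 (2 * cost_mean * window_const).
move/cvgr0Pnorm_le => /(_ _ e2)[I _ IP].
move/cvgrPdist_le : ab => /(_ _ e2)[J _ JP].
pose i := (I + J + 2 * R0)%N.
have h1 := IP i (leq_trans (leq_addr _ _) (leq_addr _ _)).
have h2 := JP i (leq_trans (leq_addl _ _) (leq_addr _ _)).
exists ((2 ^ i)%:R * (2 * (2 ^ i)%:R + 3) + 3); split; first exact: num_real.
move=> L /ltW Lbig; have := mean_window (leq_addl _ _) Lbig.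
rewrite distrC => h3; have -> : b - mean (betti ^~ (window L)) / L ^+ N =
   (b - mean (density i)) + (mean (density i) - mean (betti ^~ (window L)) / L ^+ N).
  by rewrite addrA subrK.
apply: le_trans (ler_normD _ _) _.
have := le_trans (ler_norm _) h1; rewrite -/i in h3; move: h2 h3 => /=.
by move: `|b - _| `|_ - _ / _| (2 * _ * _ * _) => u v w *; lra.
Qed.

Lemma window_deviation i (L b theta B lam : R) mu : (2 * R0 <= i)%N ->
    (2 ^ i)%:R * (2 * (2 ^ i)%:R + 3) + 3 <= L -> 0 < theta -> 0 <= B -> 0 <= lam ->
    \sum_(z <- zcube (0 : Z) (window_radius L)) cost mu z ^+ 2 <=
      B * (2 * window_radius L).+1%:R ^+ N ->
    \sum_(g <- zcube (0 : Z) (grid_radius (2 ^ i) L)) `|density i (tau (dyadic_row R i g) mu) - b| <=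
      lam * (2 * grid_radius (2 ^ i) L).+1%:R ^+ N ->
  `|betti mu (window L) / L ^+ N - b| <=
    (theta + `|b|) * window_const * 2^-1 ^+ i + (B / theta + lam) * 2 ^+ N.
Proof.
move=> Ri; have [m mE] : exists m, m = (2 ^ i)%N by exists (2 ^ i)%N.
have -> : 2^-1 ^+ i = m%:R^-1 :> R by rewrite mE natrX exprVn.
move=> Lm th0 B0 lam0 cost2; under eq_bigr do rewrite density_dyadic.
rewrite -mE in Lm *; move=> dens.
have Rm : (2 * R0 <= m)%N by rewrite mE (leq_trans Ri)// ltnW// ltn_expl.
have m0 : 0 < m%:R :> R by rewrite mE ltr0n expn_gt0.
have mN0 : 0 < m%:R ^+ N :> R by rewrite exprn_gt0.
have L0 : 0 < L.
  by apply: lt_le_trans Lm; rewrite ltr_wpDl// mulr_ge0 ?ltW// ltr_wpDl// mulr_ge0// ltW.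
have LN0 : 0 < L ^+ N by rewrite exprn_gt0.
have [radL gridL shellK /andP[rho1 rho2]] := window_sizes N rs R0_gt0 Rm (ltW L0) Lm.
pose G := window_grid N m L; pose S := window_shell N R0 m L.
have shell_le : `|betti mu (window L) - \sum_(g <- G) betti mu (grid_box m g)| <=
    (theta * (window_const / m%:R) + B / theta * 2 ^+ N) * L ^+ N.
  apply: le_trans (window_near_additive F q kappaP rs R0_gt0 R0P Rm (ltW L0) mu) _.
  (* The constant theta is summed over the few cubes of S only, while the squares are extended to
     the whole cube, where B controls them. *)
  apply: (@le_trans _ _ (\sum_(z <- S) (theta + theta^-1 * cost mu z ^+ 2))).
    apply: ler_sum => z _; rewrite -(ler_pM2l th0) mulrDr mulVKf ?gt_eqF//.
    by have := sqr_ge0 (theta - cost mu z); nra.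
  rewrite big_split /= big_const_seq count_predT iter_addr_0 mulrDl lerD//.
    by rewrite -[leLHS]mulr_natr -mulrA ler_pM2l.
  rewrite -mulr_sumr [B / _]mulrC -!mulrA ler_pM2l ?invr_gt0//.
  apply: (@le_trans _ _ (\sum_(z <- zcube (0 : Z) (window_radius L)) cost mu z ^+ 2)).
    by apply: ler_sum_fsubset; [move=> z; exact: sqr_ge0|exact: window_shell_sub].
  apply: le_trans cost2 _; rewrite -exprMn; apply: ler_wpM2l => //.
  by rewrite lerXn2r ?nnegrE// mulr_ge0// ltW.
have grid_le : `|\sum_(g <- G) betti mu (grid_box m g) - (m%:R * (2 * grid_radius m L)%:R) ^+ N * b| <=
    lam * 2 ^+ N * L ^+ N.
  have -> : (m%:R * (2 * grid_radius m L)%:R) ^+ N * b = \sum_(g <- G) m%:R ^+ N * b.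
    rewrite big_const_seq count_predT iter_addr_0 card_ibox.
    by rewrite -[RHS]mulr_natl mulrCA mulrA exprMn natrX.
  rewrite -sumrB; apply: le_trans (ler_norm_sum _ _ _) _.
  apply: (@le_trans _ _ (m%:R ^+ N * \sum_(g <- G) `|(m%:R ^+ N)^-1 * betti mu (grid_box m g) - b|)).
    rewrite mulr_sumr; apply: ler_sum => g _.
    rewrite -[X in X * `|_|]ger0_norm ?(ltW mN0)// -normrM mulrBr mulVKf// gt_eqF//.
  apply: (@le_trans _ _ (m%:R ^+ N * (lam * (2 * grid_radius m L).+1%:R ^+ N))).
    rewrite ler_pM2l//; apply: le_trans dens.
    by apply: ler_sum_fsubset; [move=> g; exact: normr_ge0|exact: window_grid_sub].
  rewrite mulrCA -exprMn -mulrA ler_wpM2l// -exprMn lerXn2r ?nnegrE// ?mulr_ge0 ?(ltW m0) ?(ltW L0)//.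
have rhoE : (m%:R * (2 * grid_radius m L)%:R) ^+ N * b =
    (m%:R * (2 * grid_radius m L)%:R / L) ^+ N * L ^+ N * b.
  by rewrite -exprMn divfK ?gt_eqF.
have rho12 : 1 - window_const / m%:R <= (m%:R * (2 * grid_radius m L)%:R / L) ^+ N <= 1.
  by apply/andP; split.
apply: le_trans (quotient_deviation LN0 shell_le grid_le rhoE rho12) _.
move: (B / theta) window_const (m%:R^-1) `|b| (2 ^+ N : R) => u c v w p.
by rewrite [leRHS](_ : _ = theta * (c * v) + u * p + lam * p + c * v * w)//; clear; ring.
Qed.

Lemma ae_window_cvg (b : R) : mean (fun mu => `|density j mu - b|) @[j --> \oo] --> 0 ->
  {ae Q, forall mu, betti mu (window L) / L ^+ N @[L --> +oo] --> b}.
Proof.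
move=> densb.
have Ldens j : integrableR Q (fun mu => `|density j mu - b|).
  apply: integrableR_norm; exact: L2_integrable (L2B (L2_density j) (L2_cst Q b)).
have real_rowD (z w : Z) : real_row R (z + w) = real_row R z + real_row R w.
  by apply/rowP => k; rewrite !mxE rmorphD.
have dyadD i (z w : Z) : dyadic_row R i (z + w) = dyadic_row R i z + dyadic_row R i w.
  by rewrite /dyadic_row scalerDr real_rowD.
have Lcost : integrableR Q (fun mu => cost mu 0 ^+ 2) by have [] := L2_cost 0.
have inv_gt0 (k : nat) : 0 < k.+1%:R^-1 :> R by rewrite invr_gt0.
have ae_cost := ae_average_bounded tauM Qtau (@tauD R N) real_rowD
  (fun mu => sqr_ge0 (cost mu 0)) Lcost.
(* Levels 1/(k+1) suffice and are countable, so one null set serves every e. *)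
have ae_dens := ae_foralln (fun k : nat => ae_average_small tauM Qtau (@tauD R N) dyadD
  (fun i mu => normr_ge0 (density i mu - b)) Ldens densb
  (inv_gt0 k)).
apply: filterS (filterI ae_cost ae_dens) => mu [[B [B0 HB]] dens].
apply/cvgrPdist_le => e e0.
pose p : R := 2 ^+ N; have p0 : 0 < p by rewrite exprn_gt0.
(* Order of choices: B depends on the measure, theta and lam on B and e, then i, then L. This theta
   makes B p / theta at most e/4; B + 1 keeps it positive when B = 0. *)
pose theta := (B + 1) * p * 4 / e.
have th0 : 0 < theta by rewrite divr_gt0// !mulr_gt0// ltr_wpDl.
pose k := Num.truncn (p * 4 / e); pose lam : R := k.+1%:R^-1.
have lam0 : 0 < lam by rewrite invr_gt0.
have lamp : lam * p <= e / 4.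
  rewrite mulrC ler_pdivrMr// [leRHS]mulrC.
  have /ltW := truncnS_gt (p * 4 / e); rewrite -/k ler_pdivrMr// mulrA ler_pdivlMr//.
have e2 : 0 < e / 4 by rewrite divr_gt0.
have := cvg_geometric0 ((theta + `|b|) * window_const).
move/cvgr0Pnorm_le => /(_ _ e2)[I _ IP].
have [i [Ii Hi]] := dens k (I + 2 * R0)%N.
have h1 := IP i (leq_trans (leq_addr _ _) Ii).
exists ((2 ^ i)%:R * (2 * (2 ^ i)%:R + 3) + 3); split; first exact: num_real.
move=> L /ltW Lbig; rewrite distrC.
apply: le_trans (window_deviation (leq_trans (leq_addl _ _) Ii) Lbig th0 B0 (ltW lam0) _ (Hi _)) _.
  by apply: le_trans (HB _); apply: ler_sum => z _; rewrite cost_tau.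
have h2 : B / theta * p <= e / 4.
  rewrite mulrAC ler_pdivrMr// /theta.
  rewrite [leRHS](_ : _ = (B + 1) * p); last by field; rewrite gt_eqF.
  by rewrite ler_pM2r// lerDl.
rewrite -/p [X in _ + X]mulrDl; have := le_trans (ler_norm _) h1; move: h2 lamp e0.
by move: (B / theta * p) (lam * p) (_ * _ * _) => u v w; lra.
Qed.

(** Convergence in mean to the ergodic constant c forces the means of the densities to tend to c as
    well, so c = b. *)
Lemma ergodic_window_cvg (b : R) : mean (density j) @[j --> \oo] --> b ->
    (forall I : set M, measurable I ->
      (forall x, Q ((I `\` tau x @^-1` I) `|` (tau x @^-1` I `\` I)) = 0%E) ->
      Q I = 0%E \/ Q I = 1%E) ->
  {ae Q, forall mu, betti mu (window L) / L ^+ N @[L --> +oo] --> b}.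
Proof.
move=> ab erg; have shift x : exists C J, 0 <= C /\ forall j, (J <= j)%N ->
    mean (fun mu => `|density j mu - density j (tau x mu)|) <= C * 2^-1 ^+ j.
  have [C [J [C0 CJ]]] := density_shift x; exists C, J; split => // j Jj.
  apply: le_trans (CJ j Jj); apply: mean_le_norm2; apply: L2B; first exact: L2_density.
  exact: (L2_tau tauM Qtau x (L2_density j)).
have [c densc] := cauchy_ergodic_limit tauM Qtau L2_density density_cauchy shift erg.
suff -> : b = c by exact: ae_window_cvg.
apply: (cvg_unique _ ab) => //.
have : mean (density j) - c @[j --> \oo] --> 0.
  apply/cvgr0Pnorm_le => e e0; move/cvgr0Pnorm_le : densc => /(_ _ e0)[J _ JP].
  exists J => // j /= Jj; apply: le_trans (JP j Jj); rewrite [leRHS]ger0_norm ?mean_ge0//.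
  have Ij := L2_integrable (L2_density j); have Ic := integrableR_cst Q c.
  have -> : mean (density j) - c = mean (fun mu => density j mu - c).
    by rewrite meanB// mean_cst.
  exact: norm_mean (integrableRB Ij Ic).
by move/subr_cvg0.
Qed.

End stationary_betti.

(** * Transfer between the process and its law *)

Section law_of_process.
Context (R : realType) (N : nat) (d : measure_display) (Omega : measurableType d)
  (P : probability Omega R) (Phi : {RV P >-> int_radon R N}).
Local Notation Q := (distribution P Phi).

Let Phi_preimage I : measurable I -> measurable (Phi @^-1` I).
Proof. by move=> mI; rewrite -[X in measurable X]setTI; exact: (measurable_funP Phi). Qed.

Lemma stationary_law : stationary_process Phi ->
  forall x I, measurable I -> Q (tau x @^-1` I) = Q I.
Proof. by move=> stat x I mI; exact: (stat (- x) I mI). Qed.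

Lemma ergodic_law : ergodic_process Phi -> forall I, measurable I ->
  (forall x, Q ((I `\` tau x @^-1` I) `|` (tau x @^-1` I `\` I)) = 0%E) ->
  Q I = 0%E \/ Q I = 1%E.
Proof.
move=> erg I mI inv; apply: (erg I mI) => x /=; rewrite translate_image; exact: inv.
Qed.

Lemma law_card_moments : all_finite_moments Phi -> forall A : set 'rV[R]_N,
  measurable A -> coord_bounded A -> forall k, (0 < k)%N ->
  (\int[Q]_mu ((#|` points mu A|)%:R ^+ k : R)%:E < +oo)%E.
Proof.
move=> mom A mA bA k k0.
have mk : measurable_fun setT (fun mu : int_radon R N => (#|` points mu A|%:R ^+ k : R)%:E).
  apply/measurable_EFinP; exact: measurable_card_pow.
rewrite ge0_integral_distribution; [|exact: mk|by move=> mu; rewrite lee_fin exprn_ge0].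
apply: le_lt_trans (mom A mA (coord_bounded_bounded bA) k k0).
apply: ge0_le_integral => //.
- by move=> w _; rewrite lee_fin exprn_ge0.
- exact: measurableT_comp mk (measurable_funP Phi).
- apply: measurable_expe; exact: (measurableT_comp (measurable_eval mA) (measurable_funP Phi)).
move=> w _ /=; have := card_points_le (Phi w) mA bA.
by rewrite EFin_expe; apply: lee_expe; rewrite lee_fin.
Qed.

Lemma ae_law (I : set (int_radon R N)) : {ae Q, forall mu, I mu} -> {ae P, forall w, I (Phi w)}.
Proof.
move=> [B [mB QB nB]]; exists (Phi @^-1` B); split => //; first exact: Phi_preimage.
by move=> w /= nI; apply: nB.
Qed.

End law_of_process.

Theorem theorem1p11 (R : realType) (N : nat) (N_ge1 : (1 <= N)%N) (q : nat)
    (F : fieldType)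
    (kappa : {fset 'rV[R]_N} -> \bar R) (kappaP : filtration_function kappa)
    (d : measure_display) (Omega : measurableType d) (P : probability Omega R)
    (Phi : {RV P >-> int_radon R N})
    (Phi_simple : simple_process Phi)
    (Phi_stationary : stationary_process Phi)
    (Phi_moments : all_finite_moments Phi)
    (r s : R) (r_ge0 : 0 <= r) (r_le_s : r <= s) :
  let betti (w : Omega) (L : R) : R :=
    (persistent_betti F q (kappa_complex kappa (points (Phi w) (window L)))
       r s)%:R in
  exists beta_hat : R,
    ('E_P[fun w => betti w L] / (L ^+ N)%:E)%E @[L --> +oo] --> beta_hat%:E
    /\ (ergodic_process Phi ->
        {ae P, forall w, (betti w L / L ^+ N) @[L --> +oo] --> beta_hat}).
Proof.
move=> bt; have [R0 [R0_gt0 R0P]] := kappa_range kappaP (le_trans r_ge0 r_le_s).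
have Qtau := stationary_law Phi_stationary.
have card_moments := law_card_moments Phi_moments.
pose Q : probability (int_radon R N) R := distribution P Phi.
pose window_betti L mu := betti F q kappa r s mu (window L).
have [b densb] := mean_density_cvg F q kappaP r_le_s R0_gt0 R0P Qtau card_moments.
exists b; split; last first.
  move=> /ergodic_law erg.
  exact: ae_law (ergodic_window_cvg kappaP r_le_s R0_gt0 R0P Qtau card_moments densb erg).
have wcvg := mean_window_cvg kappaP r_le_s R0_gt0 R0P Qtau card_moments densb.
have EE L : ('E_P[fun w => bt w L] = (mean Q (window_betti L))%:E)%E.
  have Lw := L2_window F q kappaP r_le_s R0P card_moments L.
  rewrite unlock -mean_EFin; last exact: L2_integrable Lw.
  rewrite [RHS]ge0_integral_distribution//; last by move=> mu; rewrite lee_fin betti_ge0.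
  by apply/measurable_EFinP; exact: Lw.1.
(* For L > 0 the extended real quotient is the image of the real one, so the two functions agree
   near infinity. *)
apply: (@cvg_trans _ ((mean Q (window_betti L) / L ^+ N)%:E @[L --> +oo])).
  apply: near_eq_cvg; near=> L.
  have L0 : 0 < L by near: L; exact: nbhs_pinfty_gt.
  by rewrite EE EFinM inver gt_eqF ?exprn_gt0.
by apply: cvg_EFin; [exact: nearW|exact: wcvg].
Unshelve. all: by end_near.
Qed.
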